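(* Let $A=k\oplus A_1\oplus A_2\oplus\cdots$ be a graded algebra as in the context and let $d\ge 2$ be the fixed integer. Then $A$ is a bi-Koszul algebra if and only if its Koszul dual $E(A)$ satisfies $$E^1(A)=E^1_1(A),\qquad E^2(A)=E^2_d(A)\oplus E^2_{d+1}(A),\qquad E^3(A)=E^3_{2d}(A),$$ and, for each $n\ge 1$, (a) $E^{3n}(A)=(E^3(A))^n=\underbrace{E^3(A)E^3(A)\cdots E^3(A)}_{n}$; (b) $E^{3n+1}(A)=E^1(A)E^{3n}(A)$; (c) $E^{3n+2}(A)\cong E^2(A)E^{3n}(A)\oplus \mathsf{E}^2_{2nd+d+1}\big(J\Omega^{3n}(k)\big)$ as $E^0(A)$-modules (i.e. as $k$-modules).
   Context: Fix a field $\mathbb{F}$. $A=k\oplus A_1\oplus A_2\oplus\cdots$ denotes an associative graded $\mathbb{F}$-algebra, where $k=A_0$ is a semisimple Artin algebra over $\mathbb{F}$, $A_1$ is a finitely generated $\mathbb{F}$-module, and $A$ is generated in degrees $0$ and $1$. $J=A_1\oplus A_2\oplus\cdots$ is the graded Jacobson radical and $k=A/J$ is the trivial left $A$-module. $Gr(A)$ is the category of graded left $A$-modules with degree-zero morphisms. Shift: $M(n)_j=M_{j-n}$. $\underline{\mathrm{Ext}}^*_A$ is the derived functor of $\underline{\mathrm{Hom}}_A(M,N)=\bigoplus_n\mathrm{Hom}_{Gr(A)}(M,N(n))$. Put $E(A)=\underline{\mathrm{Ext}}^*_A(k,k)$ (the Koszul dual, or Ext-algebra) and $\mathsf{E}(M)=\underline{\mathrm{Ext}}^*_A(M,k)$,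 bigraded with $\mathsf{E}^i_j(M)=\underline{\mathrm{Ext}}^i_A(M,k)_j$ (the component of internal degree $j$, coming from maps to $k(j)$), and similarly $E^i_j(A)$; $E^0(A)=k$. If $Q_i$ is the $i$-th term of the minimal graded projective resolution of $M$, then $\mathsf{E}^i_j(M)=\mathrm{Hom}_{Gr(A)}(Q_i,k(j))$. Products are Yoneda products, and a product of subspaces means the span of all products. For $M$ with minimal graded projective resolution $\cdots\to Q_1\xrightarrow{\partial_1}Q_0\xrightarrow{\partial_0}M\to0$, $\Omega^n(M)=\ker\partial_{n-1}$ is the $n$-th syzygy ($\Omega^0(M)=M$). Fix an integer $d\ge2$. The resolution map $\Delta$ assigns to $n\ge0$ the set of degrees $\Delta(3m)=\{2md\}$, $\Delta(3m+1)=\{2md+1\}$, $\Delta(3m+2)=\{2md+d,\,2md+d+1\}$. ''Generated in degrees $S$'' means generated by homogeneous elements with degrees in $S$. $A$ is a bi-Koszul algebra if the trivial left module $k$ has a minimal graded projective resolution $\cdots\to P_1\to P_0\to k\to0$ such that each $P_n$ is generated in degrees $\Delta(n)$, for all $n\ge0$. *)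

(* Defs.v *)
From HB Require Import structures.
From mathcomp Require Import all_boot all_order all_algebra.
From mathcomp Require Import boolp functions.

Set Implicit Arguments.
Unset Strict Implicit.
Unset Printing Implicit Defensive.

Import GRing.Theory.
Local Open Scope ring_scope.
Local Open Scope quotient_scope.

(* Subspaces are boolean predicates; this loses nothing, since [`[< P >]]
   reflects an arbitrary proposition. *)

Section Generalities.
Variables (R : pzRingType) (V : lmodType R).

Definition lspan (G : V -> Prop) : {pred V} :=
  [pred v | `[< forall S : {pred V}, submod_closed S ->
                (forall g, G g -> g \in S) -> v \in S >]].

Lemma lspan_submod (G : V -> Prop) : submod_closed (lspan G).
Proof.
split=> [|a u v /asboolP uG /asboolP vG]; apply/asboolP => S clS GS.
  by case: clS.
by case: (clS) => _; apply; [exact: uG | exact: vG].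
Qed.

Lemma mem_lspan (G : V -> Prop) v : G v -> v \in lspan G.
Proof. by move=> Gv; apply/asboolP => S _; apply. Qed.

Definition is_dsum2 (X Y : {pred V}) : Prop :=
  (forall v : V, exists x y, [/\ x \in X, y \in Y & v = x + y]) /\
  (forall v, v \in X -> v \in Y -> v = 0).

End Generalities.

(* V is the internal direct sum of the family D. *)
Definition direct_grading (I : eqType) (V : zmodType) (D : I -> {pred V}) :=
  (forall v : V, exists (s : seq I) (x : I -> V),
     [/\ uniq s, forall i, x i \in D i & v = \sum_(i <- s) x i]) /\
  (forall (s : seq I) (x : I -> V), uniq s -> (forall i, x i \in D i) ->
     \sum_(i <- s) x i = 0 -> forall i, i \in s -> x i = 0).

Record submod (R : pzRingType) (V : lmodType R) := Submod {
  sm_pred :> {pred V};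
  sm_closed : submod_closed sm_pred
}.

Section SubmodInstances.
Variables (R : pzRingType) (V : lmodType R) (N : submod V).

HB.instance Definition _ :=
  GRing.isSubmodClosed.Build R V (sm_pred N) (sm_closed N).

Fact submod_oppr_closed : oppr_closed N.
Proof. exact: (GRing.zmod_closedN (GRing.submod_closedB (sm_closed N))). Qed.

HB.instance Definition _ :=
  GRing.isOppClosed.Build V (sm_pred N) submod_oppr_closed.

End SubmodInstances.

Section LinearQuotient.
Variables (R : pzRingType) (V : lmodType R) (N : submod V).

Definition lquot : Type := Quotient.quot (sm_pred N).
HB.instance Definition _ := GRing.Zmodule.on lquot.

Definition lproj (v : V) : lquot := \pi_(Quotient.quot (sm_pred N)) v.

Lemma lprojD u v : lproj (u + v) = lproj u + lproj v.
Proof. exact: (raddfD (\pi_(Quotient.quot (sm_pred N)))). Qed.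

Lemma lproj_eq u v : lproj u = lproj v <-> u - v \in N.
Proof.
by split=> [/eqP|]; [rewrite -Quotient.idealrBE | rewrite Quotient.idealrBE => /eqP].
Qed.

Lemma lproj_surj (q : lquot) : exists v, q = lproj v.
Proof. by exists (repr (q : Quotient.quot (sm_pred N))); rewrite /lproj reprK. Qed.

Definition lquot_scale (a : R) (q : lquot) : lquot :=
  lproj (a *: repr (q : Quotient.quot (sm_pred N))).

Lemma lquot_scaleE a v : lquot_scale a (lproj v) = lproj (a *: v).
Proof.
apply/lproj_eq; rewrite -scalerBr rpredZ //.
by apply/lproj_eq; rewrite /lproj reprK.
Qed.

Fact lquot_scaleA a b q :
  lquot_scale a (lquot_scale b q) = lquot_scale (a * b) q.
Proof. by case: (lproj_surj q) => v ->; rewrite !lquot_scaleE scalerA. Qed.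

Fact lquot_scale1 : left_id 1 lquot_scale.
Proof. by move=> q; case: (lproj_surj q) => v ->; rewrite lquot_scaleE scale1r. Qed.

Fact lquot_scaleDr : right_distributive lquot_scale +%R.
Proof.
move=> a p q; case: (lproj_surj p) (lproj_surj q) => u -> [v ->].
by rewrite -lprojD !lquot_scaleE -lprojD scalerDr.
Qed.

Fact lquot_scaleDl q : {morph lquot_scale^~ q : a b / a + b}.
Proof.
by move=> a b; case: (lproj_surj q) => v ->; rewrite !lquot_scaleE -lprojD scalerDl.
Qed.

HB.instance Definition _ := GRing.Zmodule_isLmodule.Build R lquot
  lquot_scaleA lquot_scale1 lquot_scaleDr lquot_scaleDl.

Lemma lproj_linear : linear lproj.
Proof. by move=> a u v; rewrite lprojD -lquot_scaleE. Qed.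

HB.instance Definition _ :=
  GRing.isLinear.Build R V lquot _ lproj lproj_linear.

End LinearQuotient.

Section LinearSub.
Variables (R : pzRingType) (V : lmodType R) (N : submod V).

Record lsub : Type := LSub { lsub_val : V; lsub_valP : lsub_val \in N }.
HB.instance Definition _ := [isSub for lsub_val].
HB.instance Definition _ := [Choice of lsub by <:].
HB.instance Definition _ := [SubChoice_isSubLmodule of lsub by <:].

End LinearSub.

Record grAlg (F : fieldType) := GrAlg {
  ga_sort :> algType F;
  ga_deg : nat -> {pred ga_sort};
  ga_sub : forall n, submod_closed (ga_deg n);
  ga_dir : direct_grading ga_deg;
  ga_one : 1 \in ga_deg 0;
  ga_mul : forall i j a b,
    a \in ga_deg i -> b \in ga_deg j -> a * b \in ga_deg (i + j)%N
}.

Arguments ga_deg {F} _ _.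
Arguments ga_dir {F} _.

Section GradedAlgebra.
Variables (F : fieldType) (A : grAlg F).

Definition finite_dim (X : {pred A}) : Prop :=
  exists (n : nat) (b : 'I_n -> A), (forall i, b i \in X) /\
    forall x, x \in X -> exists c : 'I_n -> F, x = \sum_i c i *: b i.

Definition left_ideal0 (I : {pred A}) : Prop :=
  [/\ {subset I <= ga_deg A 0}, 0 \in I,
      forall x y, x \in I -> y \in I -> x + y \in I
    & forall a x, a \in ga_deg A 0 -> x \in I -> a * x \in I].

(* The left regular module of the ring A_0 is completely reducible. *)
Definition semisimple0 : Prop :=
  forall I, left_ideal0 I -> exists I', left_ideal0 I' /\
    (forall x, x \in ga_deg A 0 ->
       exists y z, [/\ y \in I, z \in I' & x = y + z]) /\
    (forall x, x \in I -> x \in I' -> x = 0).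

(* Artin algebras over the field F are the finite-dimensional ones. *)
Definition semisimple_artin0 : Prop :=
  finite_dim (ga_deg A 0) /\ semisimple0.

Definition generated_in_degrees_01 : Prop :=
  forall S : {pred A}, subalg_closed S ->
    {subset ga_deg A 0 <= S} -> {subset ga_deg A 1 <= S} ->
    forall a : A, a \in S.

Definition Jrad : {pred A} :=
  lspan (fun a : A => exists2 i, (0 < i)%N & a \in ga_deg A i).

Lemma Jrad_submod : submod_closed (Jrad : {pred A^o}).
Proof.
have [J0 Jl] := lspan_submod (fun a : A => exists2 i, (0 < i)%N & a \in ga_deg A i).
have JD u v : u \in Jrad -> v \in Jrad -> u + v \in Jrad.
  by move=> uJ vJ; rewrite -[u]scale1r; exact: Jl.
split=> // a u v /asboolP uJ vJ; apply: (JD) => //.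
apply: (uJ [pred w : A | a * w \in Jrad]) => [|w [i i0 wi]].
  split; first by change (a * 0 \in Jrad); rewrite mulr0.
  move=> c w w' wJ w'J; change (a * (c *: w + w') \in Jrad).
  by rewrite mulrDr -scalerAr; exact: Jl.
have [s [x [_ xD ->]]] := (ga_dir A).1 a.
change ((\sum_(i <- s) x i) * w \in Jrad); rewrite mulr_suml.
apply: (@big_ind _ (fun z : A => z \in Jrad)) => [|u' v'|j _]; [exact: J0|exact: JD|].
by apply: mem_lspan; exists (j + i)%N; rewrite ?addn_gt0 ?i0 ?orbT //; exact: ga_mul.
Qed.

Lemma Jrad_mulr a b : a \in Jrad -> a * b \in Jrad.
Proof.
have [J0 Jl] := Jrad_submod.
move=> /asboolP aJ; apply: (aJ [pred w : A | w * b \in Jrad]) => [|w [i i0 wi]].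
  split; first by change (0 * b \in Jrad); rewrite mul0r.
  move=> c w w' wJ w'J; change ((c *: w + w') * b \in Jrad).
  rewrite mulrDl -mulr_algl -mulrA; exact: (Jl c%:A).
have [s [x [_ xD ->]]] := (ga_dir A).1 b.
change (w * (\sum_(i <- s) x i) \in Jrad); rewrite mulr_sumr.
apply: (@big_ind _ (fun z : A => z \in Jrad)) => [|u v uJ vJ|j _]; first exact: J0.
  by have := Jl 1 u v uJ vJ; rewrite scale1r.
by apply: mem_lspan; exists (i + j)%N; rewrite ?addn_gt0 ?i0 //; exact: ga_mul.
Qed.

Record grMod := GrMod {
  gm_sort :> lmodType A;
  gm_deg : int -> {pred gm_sort};
  gm_sub : forall i, zmod_closed (gm_deg i);
  gm_dir : direct_grading gm_deg;
  gm_act : forall (i : nat) j a x,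
    a \in ga_deg A i -> x \in gm_deg j -> a *: x \in gm_deg (i%:Z + j)
}.

Arguments gm_deg _ _ : clear implicits.

Record grSub (M : grMod) := GrSub {
  gs_pred :> submod M;
  gs_homog : forall (s : seq int) (x : int -> M), uniq s ->
    (forall i, x i \in gm_deg M i) -> \sum_(i <- s) x i \in gs_pred ->
    forall i, i \in s -> x i \in gs_pred
}.

Section SubQuotient.
Variables (M : grMod) (S : grSub M).

Definition sub_deg (j : int) : {pred lsub S} :=
  [pred x | lsub_val x \in gm_deg M j].

Lemma sub_deg_zmod i : zmod_closed (sub_deg i).
Proof.
have [d0 dB] := gm_sub M i; split=> [|x y]; rewrite !inE.
  by rewrite (_ : lsub_val 0 = 0) //; exact: (raddf0 (val : lsub S -> M)).
rewrite (_ : lsub_val (x - y) = lsub_val x - lsub_val y); first exact: dB.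
exact: (raddfB (val : lsub S -> M)).
Qed.

Lemma sub_deg_dir : direct_grading sub_deg.
Proof.
have [dE dI] := gm_dir M; split=> [v|s x us xD s0 i si].
  have [s [x [us xD vE]]] := dE (val v).
  have xS i : (if i \in s then x i else 0) \in S.
    case: ifP => [si|_]; last by case: (sm_closed S).
    by apply: (gs_homog (s := s) us xD) => //; rewrite -vE; exact: lsub_valP.
  exists s, (fun i => LSub (xS i)); split=> // [i|].
    by rewrite inE /=; case: ifP => // _; have [] := gm_sub M i.
  apply: val_inj; rewrite vE (raddf_sum (val : lsub S -> M)) /=.
  by apply: eq_big_seq => i ->.
apply: val_inj; rewrite (raddf0 (val : lsub S -> M)).
apply: (dI s (fun i => val (x i))) => //.
by rewrite -(raddf_sum (val : lsub S -> M)) s0 raddf0.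
Qed.

Lemma sub_deg_act (i : nat) j a x :
  a \in ga_deg A i -> x \in sub_deg j -> a *: x \in sub_deg (i%:Z + j).
Proof.
rewrite !inE => aD xD.
rewrite (_ : lsub_val (a *: x) = a *: lsub_val x); first exact: gm_act.
exact: (linearZ_LR (val : lsub S -> M)).
Qed.

Definition subGr : grMod := GrMod sub_deg_zmod sub_deg_dir sub_deg_act.

Definition quo_deg (j : int) : {pred lquot S} :=
  [pred q | `[< exists2 x, x \in gm_deg M j & q = lproj S x >]].

Lemma quo_deg_zmod i : zmod_closed (quo_deg i).
Proof.
have [d0 dB] := gm_sub M i; split=> [|p q].
  by apply/asboolP; exists 0; rewrite ?raddf0.
move=> /asboolP[x xD ->] /asboolP[y yD ->]; apply/asboolP.
by exists (x - y); rewrite ?raddfB //; exact: dB.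
Qed.

Lemma quo_deg_dir : direct_grading quo_deg.
Proof.
have [dE dI] := gm_dir M; split=> [q|s q us qD s0 i si].
  have [v ->] := lproj_surj q; have [s [x [us xD vE]]] := dE v.
  exists s, (fun i => lproj S (x i)); split=> // [i|].
    by apply/asboolP; exists (x i).
  by rewrite vE raddf_sum.
have {qD} /choice[x xP] j : exists x, x \in gm_deg M j /\ q j = lproj S x.
  by have /asboolP[x xD ->] := qD j; exists x.
have xD j : x j \in gm_deg M j by case: (xP j).
rewrite (xP i).2 -(raddf0 (lproj S)); apply/lproj_eq; rewrite subr0.
apply: (gs_homog us xD) => //.
rewrite -[X in X \in _]subr0; apply/lproj_eq.
rewrite raddf0 raddf_sum -[RHS]s0; by apply: eq_bigr => j _; rewrite (xP j).2.
Qed.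

Lemma quo_deg_act (i : nat) j a q :
  a \in ga_deg A i -> q \in quo_deg j -> a *: q \in quo_deg (i%:Z + j).
Proof.
move=> aD /asboolP[x xD ->]; apply/asboolP; exists (a *: x); first exact: gm_act.
by rewrite linearZ.
Qed.

Definition quoGr : grMod := GrMod quo_deg_zmod quo_deg_dir quo_deg_act.

End SubQuotient.

Section Radical.
Variable M : grMod.

Definition JM_pred : {pred M} :=
  lspan (fun v : M => exists a x, a \in Jrad /\ v = a *: x).

Let homog (z : M) := exists i, z \in gm_deg M i.

Lemma JM_sum v : v \in JM_pred ->
  exists l : seq M,
    (forall z, z \in l -> homog z /\ z \in JM_pred) /\ v = \sum_(z <- l) z.
Proof.
have clJ := lspan_submod (fun v : M => exists a x, a \in Jrad /\ v = a *: x).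
have clJs (l : seq M) (a : A) : (forall z, z \in l -> homog z /\ z \in JM_pred) ->
    exists l' : seq M, (forall z, z \in l' -> homog z /\ z \in JM_pred) /\
      a *: (\sum_(z <- l) z) = \sum_(z <- l') z.
  move=> lP; have [s [x [us xD ->]]] := (ga_dir A).1 a.
  exists [seq x i *: z | i <- s, z <- l]; split.
    move=> _ /allpairsP[[i z] [_ /lP[[j zj] zJ] ->]]; split=> /=.
      by exists (i%:Z + j); exact: gm_act.
    by rewrite -[_ *: _]addr0; case: clJ => ? ->.
  rewrite big_allpairs_dep /= scaler_suml; apply: eq_bigr => i _.
  by rewrite scaler_sumr.
pose T : {pred M} := [pred v | `[< exists l : seq M,
   (forall z, z \in l -> homog z /\ z \in JM_pred) /\ v = \sum_(z <- l) z >]].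
have [T0 Tl] : submod_closed T.
  split; first by apply/asboolP; exists [::]; rewrite big_nil.
  move=> a u w /asboolP[l [lP ->]] /asboolP[l' [lP' ->]]; apply/asboolP.
  have [l2 [l2P ->]] := clJs l a lP.
  exists (l2 ++ l'); rewrite big_cat; split=> // z.
  by rewrite mem_cat => /orP[/l2P|/lP'].
have TD u w : u \in T -> w \in T -> u + w \in T.
  by move=> uT wT; rewrite -[u]scale1r; exact: Tl.
move=> /asboolP H; apply/asboolP; apply: (H T) => // _ [a [x [/asboolP aJ ->]]].
apply: (aJ [pred b : A | b *: x \in T]) => [|b [i i0 bi]].
  split; first by change (0 *: x \in T); rewrite scale0r.
  move=> c b b' bT b'T; change ((c *: b + b') *: x \in T).
  by rewrite scalerDl -[c *: b]mulr_algl -scalerA; exact: Tl.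
have [t [w [ut wD ->]]] := (gm_dir M).1 x.
change (b *: (\sum_(i <- t) w i) \in T); rewrite scaler_sumr.
apply: (@big_ind _ (fun z : M => z \in T)) => [|p q|j _]; [exact: T0|exact: TD|].
apply/asboolP; exists [:: b *: w j].
rewrite big_seq1; split=> // z; rewrite inE => /eqP->; split.
  by exists (i%:Z + j); exact: gm_act.
apply: mem_lspan; exists b, (w j); split=> //.
by apply: mem_lspan; exists i.
Qed.

Lemma homog_sum (S : {pred M}) (l : seq M) : submod_closed S ->
  (forall z, z \in l -> homog z /\ z \in S) ->
  exists (s : seq int) (x : int -> M),
    [/\ uniq s, forall i, x i \in gm_deg M i, forall i, x i \in S &
        \sum_(z <- l) z = \sum_(i <- s) x i].
Proof.
move=> [S0 Sl]; elim: l => [|z l IHl] lP.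
  exists [::], (fun=> 0); split=> //; last by rewrite !big_nil.
  by move=> i; case: (gm_sub M i).
have [|s [x [us xD xS E]]] := IHl.
  by move=> w wl; apply: lP; rewrite inE wl orbT.
have [[j zj] zS] := lP z (mem_head _ _).
pose s' := if j \in s then s else j :: s.
pose x0 i := if i \in s then x i else 0.
pose y i := x0 i + (if i == j then z else 0).
exists s', y; split.
- by rewrite /s'; case: ifP => //= ->.
- move=> i; have [d0 dB] := gm_sub M i.
  have dD u v : u \in gm_deg M i -> v \in gm_deg M i -> u + v \in gm_deg M i.
    by move=> uD vD; rewrite -[v]opprK dB // -sub0r dB.
  by apply: dD; [rewrite /x0; case: ifP | case: eqP => // ->].
- move=> i; rewrite /y -[x0 i]scale1r; apply: Sl; last by case: eqP.
  by rewrite /x0; case: ifP.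
rewrite big_cons E big_split /=.
have us' : uniq s' by rewrite /s'; case: ifP => //= ->.
have js' : j \in s' by rewrite /s'; case: ifP => // _; rewrite mem_head.
have -> : \sum_(i <- s') (if i == j then z else 0) = z.
  by rewrite -big_mkcond -big_filter filter_pred1_uniq // big_seq1.
rewrite addrC; congr (_ + _); rewrite /s'; case: ifP => js.
  by apply: eq_big_seq => i is_; rewrite /x0 is_.
rewrite big_cons {1}/x0 js add0r; apply: eq_big_seq => i is_; by rewrite /x0 is_.
Qed.

Lemma JM_homog (s : seq int) (x : int -> M) : uniq s ->
  (forall i, x i \in gm_deg M i) -> \sum_(i <- s) x i \in JM_pred ->
  forall i, i \in s -> x i \in JM_pred.
Proof.
move=> us xD /JM_sum[l [lP lE]] i si.
have clJ := lspan_submod (fun v : M => exists a x, a \in Jrad /\ v = a *: x).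
have [t [y [ut yD yJ E]]] := homog_sum clJ lP.
pose u := undup (s ++ t).
pose x0 i := if i \in s then x i else 0.
pose y0 i := if i \in t then y i else 0.
have uu : uniq u by exact: undup_uniq.
have sumE (r : seq int) (f : int -> M) : uniq r -> {subset r <= u} ->
    \sum_(j <- u) (if j \in r then f j else 0) = \sum_(j <- r) f j.
  move=> ur ru; rewrite -big_mkcond -big_filter; apply: perm_big.
  apply: uniq_perm => //; first exact: filter_uniq.
  move=> j; rewrite mem_filter; apply/andP/idP => [[]//|jr]; split=> //; exact: ru.
have su : {subset s <= u} by move=> j js; rewrite mem_undup mem_cat js.
have tu : {subset t <= u} by move=> j jt; rewrite mem_undup mem_cat jt orbT.
have /(_ i (su _ si)) : forall i, i \in u -> x0 i - y0 i = 0.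
  apply: ((gm_dir M).2 u (fun i => x0 i - y0 i)) => //.
    move=> j; have [d0 dB] := gm_sub M j.
    by apply: dB; rewrite /x0 /y0; case: ifP.
  by rewrite sumrB !sumE // lE E subrr.
rewrite {1}/x0 si => /subr0_eq ->.
by rewrite /y0; case: ifP => // _; case: clJ.
Qed.

Definition JM : grSub M := @GrSub M (Submod (lspan_submod _)) JM_homog.

End Radical.

Definition reg_deg (j : int) : {pred A^o} :=
  match j with Posz n => ga_deg A n | Negz _ => pred1 0 end.

Lemma reg_deg_zmod i : zmod_closed (reg_deg i).
Proof.
case: i => n /=; first exact: (GRing.submod_closedB (ga_sub A n)).
by split=> [|x y]; rewrite !inE // => /eqP-> /eqP->; rewrite subrr.
Qed.

Lemma reg_deg_dir : direct_grading reg_deg.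
Proof.
have [dE dI] := ga_dir A; split=> [v|s x us xD s0 i si].
  have [s [x [us xD vE]]] := dE v.
  exists (map Posz s), (fun j => if j is Posz n then x n else 0); split.
  - by rewrite map_inj_uniq // => m n [].
  - by case=> n //=; rewrite inE.
  - by rewrite vE big_map.
case: i si => n si; last by have := xD (Negz n); rewrite inE => /eqP.
pose t := pmap (fun j : int => if j is Posz n then Some n else None) s.
have tE m : (m \in t) = (Posz m \in s).
  rewrite mem_pmap; apply/mapP/idP => [[[k|k]//= ks [->]]//|ms].
  by exists (Posz m).
have ut : uniq t.
  rewrite /t; elim: s us {s0 si t tE} => //= -[k|k] s IHs /andP[ks us] /=.
    rewrite IHs // andbT mem_pmap; apply/negP => /mapP[[l|l]//= ls [kl]].
    by rewrite kl ls in ks.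
  exact: IHs.
apply: (dI t (fun m => x (Posz m)) ut) => //; last by rewrite tE.
rewrite -[RHS]s0 /t; elim: s {us s0 si t tE ut} => [|[k|k] s IHs] /=.
- by rewrite !big_nil.
- by rewrite !big_cons IHs.
- rewrite big_cons IHs; have := xD (Negz k); rewrite inE => /eqP->.
  by rewrite add0r.
Qed.

Lemma reg_deg_act (i : nat) j (a : A) (x : A^o) :
  a \in ga_deg A i -> x \in reg_deg j -> a *: x \in reg_deg (i%:Z + j).
Proof.
case: j => n aD /= xD; first exact: ga_mul.
move: xD; rewrite inE => /eqP->; rewrite scaler0.
by case: (reg_deg_zmod (i%:Z + Negz n)).
Qed.

Definition regGr : grMod := GrMod reg_deg_zmod reg_deg_dir reg_deg_act.

Lemma JM_regE : JM regGr =i (Jrad : {pred A^o}).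
Proof.
move=> a; apply/idP/idP => [/asboolP|aJ].
  apply=> [|_ [b [x [bJ ->]]]]; first exact: Jrad_submod.
  exact: Jrad_mulr.
by apply: mem_lspan; exists a, 1; split=> //; rewrite [RHS]mulr1.
Qed.

Lemma Jrad_homog (s : seq int) (x : int -> regGr) : uniq s ->
  (forall i, x i \in gm_deg regGr i) ->
  \sum_(i <- s) x i \in (Submod Jrad_submod : submod regGr) ->
  forall i, i \in s -> x i \in (Submod Jrad_submod : submod regGr).
Proof.
move=> us xD sJ i si; rewrite -[_ \in _]/(x i \in (Jrad : {pred A^o})) -JM_regE.
by apply: (gs_homog (g := JM regGr) us xD _ si); rewrite JM_regE.
Qed.

Definition Jgr : grSub regGr := @GrSub regGr (Submod Jrad_submod) Jrad_homog.

Definition trivial_mod : grMod := quoGr Jgr.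

Record grHom (M N : grMod) := GrHom {
  gh_fun :> M -> N;
  gh_linear : linear gh_fun;
  gh_deg : forall j x, x \in gm_deg M j -> gh_fun x \in gm_deg N j
}.

Section Kernel.
Variables (M N : grMod) (f : grHom M N).

Let ker_pred : {pred M} := [pred x | f x == 0].

Let g : M -> N := f.
HB.instance Definition _ := GRing.isLinear.Build A M N _ g (gh_linear f).

Lemma ker_submod : submod_closed ker_pred.
Proof.
split=> [|a x y]; first by rewrite inE -[gh_fun f]/g linear0.
rewrite !inE => /eqP x0 /eqP y0.
by rewrite gh_linear x0 y0 scaler0 addr0.
Qed.

Lemma ker_homog (s : seq int) (x : int -> M) : uniq s ->
  (forall i, x i \in gm_deg M i) -> \sum_(i <- s) x i \in Submod ker_submod ->
  forall i, i \in s -> x i \in Submod ker_submod.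
Proof.
move=> us xD; rewrite inE -[gh_fun f]/g linear_sum => /eqP s0 i si.
rewrite inE; apply/eqP; apply: ((gm_dir N).2 s (fun i => g (x i))) => // j.
exact: gh_deg.
Qed.

Definition kerGr : grMod := subGr (@GrSub M (Submod ker_submod) ker_homog).

End Kernel.

Definition projective (P : grMod) : Prop :=
  forall (N N' : grMod) (p : grHom N N') (f : grHom P N'),
    (forall y, exists x, p x = y) ->
    exists g : grHom P N, forall x, p (g x) = f x.

Record resolution (M : grMod) := Resolution {
  res_term :> nat -> grMod;
  res_dif : forall n, grHom (res_term n.+1) (res_term n);
  res_aug : grHom (res_term 0) M;
  res_proj : forall n, projective (res_term n);
  res_surj : forall y, exists x, res_aug x = y;
  res_exact0 : forall x, res_aug x = 0 <-> exists y, x = res_dif 0 y;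
  res_exact : forall n x, res_dif n x = 0 <-> exists y, x = res_dif n.+1 y
}.

(* ker d_n is contained in J Q_n, where d_0 is the augmentation and d_(n+1) is
   [res_dif Q n : Q n.+1 -> Q n]. *)
Definition minimal (M : grMod) (Q : resolution M) : Prop :=
  (forall x, res_aug Q x = 0 -> x \in JM (Q 0)) /\
  (forall n x, res_dif Q n x = 0 -> x \in JM (Q n.+1)).

Definition syzygy (M : grMod) (Q : resolution M) (n : nat) : grMod :=
  match n with
  | 0 => M
  | 1 => kerGr (res_aug Q)
  | m.+2 => kerGr (res_dif Q m)
  end.

Definition generated_in (M : grMod) (S : seq nat) : Prop :=
  forall N : {pred M}, submod_closed N ->
    (forall (j : nat) x, j \in S -> x \in gm_deg M j%:Z -> x \in N) ->
    forall x, x \in N.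

Definition Delta (d n : nat) : seq nat :=
  let m := (n %/ 3)%N in
  match (n %% 3)%N with
  | 0 => [:: 2 * m * d]%N
  | 1 => [:: 2 * m * d + 1]%N
  | _ => [:: 2 * m * d + d; 2 * m * d + d + 1]%N
  end.

Definition bi_Koszul (d : nat) : Prop :=
  exists P : resolution trivial_mod,
    minimal P /\ forall n, generated_in (P n) (Delta d n).

(* Restriction of scalars of an A-module along F -> A. *)
Section RestrictScalars.
Variable V : lmodType A.

Definition resF : Type := V.
HB.instance Definition _ := GRing.Zmodule.on resF.

Definition resF_scale (c : F) (v : resF) : resF := (c%:A : A) *: (v : V).

Fact resF_scaleA a b v : resF_scale a (resF_scale b v) = resF_scale (a * b) v.
Proof. by rewrite /resF_scale scalerA mulr_algl scalerA. Qed.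

Fact resF_scale1 : left_id 1 resF_scale.
Proof. by move=> v; rewrite /resF_scale !scale1r. Qed.

Fact resF_scaleDr : right_distributive resF_scale +%R.
Proof. by move=> a u v; rewrite /resF_scale scalerDr. Qed.

Fact resF_scaleDl v : {morph resF_scale^~ v : a b / a + b}.
Proof. by move=> a b; rewrite /resF_scale scalerDl scalerDl. Qed.

HB.instance Definition _ := GRing.Zmodule_isLmodule.Build F resF
  resF_scaleA resF_scale1 resF_scaleDr resF_scaleDl.

End RestrictScalars.

(* Hom_Gr(A)(M, N(j)): as N(j)_i = N_(i - j), these are the A-linear maps that
   lower degrees by j. *)
Definition homj (M N : grMod) (j : int) : {pred M -> resF N} :=
  [pred f : M -> N | `[< linear f /\
     forall i x, x \in gm_deg M i -> f x \in gm_deg N (i - j) >]].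

Arguments homj : clear implicits.

(* The sum over j of the Hom_Gr(A)(M, N(j)) inside Hom_A(M, N), where it is
   direct. *)
Definition uHom (M N : grMod) : {pred M -> resF N} :=
  lspan (fun f : M -> resF N => exists j, f \in homj M N j).

Arguments uHom : clear implicits.

Section Ext.
Variables (M : grMod) (P : resolution M) (N : grMod) (n : nat).

Definition cocycle_pred : {pred P n -> resF N} :=
  [pred f | (f \in uHom (P n) N) && `[< forall x, f (res_dif P n x) = 0 >]].

Lemma cocycle_submod : submod_closed cocycle_pred.
Proof.
have [h0 hl] := lspan_submod (fun f : P n -> resF N => exists j, f \in homj (P n) N j).
split=> [|a f g /andP[fH /asboolP f0] /andP[gH /asboolP g0]]; apply/andP; split.
- exact: h0.
- exact/asboolP.
- exact: hl.
- by apply/asboolP => x; rewrite -[LHS]/(a *: f _ + g _) f0 g0 scaler0 addr0.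
Qed.

Definition cocycle : Type := lsub (Submod cocycle_submod).
HB.instance Definition _ := GRing.Lmodule.on cocycle.

Definition coc_fun (c : cocycle) : P n -> resF N := lsub_val c.

End Ext.

Definition coboundary (M : grMod) (P : resolution M) (N : grMod) (n : nat) :
    (P n -> resF N) -> Prop :=
  match n with
  | 0 => fun f => f = 0
  | m.+1 => fun f =>
      exists2 g, g \in uHom (P m) N & forall x, f x = g (res_dif P m x)
  end.

Section ExtQuotient.
Variables (M : grMod) (P : resolution M) (N : grMod) (n : nat).

Definition cobound_pred : {pred cocycle P N n} :=
  [pred c | `[< coboundary (coc_fun c) >]].

Lemma cobound_submod : submod_closed cobound_pred.
Proof.
have c0 : coc_fun (0 : cocycle P N n) = 0.
  exact: (raddf0 (val : lsub (Submod (cocycle_submod P N n)) -> _)).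
have cl a (u v : cocycle P N n) : coc_fun (a *: u + v) = a *: coc_fun u + coc_fun v.
  exact: (linearP (val : lsub (Submod (cocycle_submod P N n)) -> _)).
split=> [|a u v]; rewrite !inE ?c0 ?cl.
  apply/asboolP; case: (n) => //= m; exists 0 => //.
  by have [] := lspan_submod (fun f : P m -> resF N => exists j, f \in homj (P m) N j).
move=> /asboolP uB /asboolP vB; apply/asboolP.
case: (n) (coc_fun u) (coc_fun v) uB vB => [f g /= -> ->|m f g /=].
  by rewrite scaler0 addr0.
move=> [f' f'H fE] [g' g'H gE]; exists (a *: f' + g').
  by have [_] := lspan_submod (fun f : P m -> resF N => exists j, f \in homj (P m) N j); exact.
by move=> x; rewrite -[LHS]/(a *: f _ + g _) fE gE.
Qed.

(* The n-th cohomology of the complex of underlined Hom's from P to N. *)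
Definition Ext : Type := lquot (Submod cobound_submod).
HB.instance Definition _ := GRing.Lmodule.on Ext.

Definition ext_class (c : cocycle P N n) : Ext := lproj (Submod cobound_submod) c.

Definition Ext_deg (j : int) : {pred Ext} :=
  [pred z | `[< exists2 c : cocycle P N n,
                  coc_fun c \in homj (P n) N j & z = ext_class c >]].

End ExtQuotient.

Arguments Ext_deg {M} P N n j.

(* [yoneda x y z]: z is the Yoneda product x y, that is, the class of f \o phi_i
   where f represents x and phi is a chain map lifting a cocycle that
   represents y. *)
Definition yoneda (M K N : grMod) (R : resolution M) (P : resolution K)
    (i m : nat) (x : Ext P N i) (y : Ext R K m) (z : Ext R N (i + m)) : Prop :=
  exists (f : cocycle P N i) (g : cocycle R K m) (h : cocycle R N (i + m))
         (phi : forall t, R (t + m)%N -> P t),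
    [/\ x = ext_class f, y = ext_class g & z = ext_class h] /\
    [/\ forall t, phi t \in uHom (R (t + m)%N) (P t),
        forall u, res_aug P (phi 0%N u) = coc_fun g u,
        forall t u, res_dif P t (phi t.+1 u) = phi t (res_dif R (t + m)%N u)
      & forall u, coc_fun h u = coc_fun f (phi i u)].

Definition yoneda_prod (M K N : grMod) (R : resolution M) (P : resolution K)
    (i m : nat) (X : {pred Ext P N i}) (Y : {pred Ext R K m}) :
    {pred Ext R N (i + m)} :=
  lspan (fun z => exists x y, [/\ x \in X, y \in Y & yoneda x y z]).

(* E(A) = Ext_A(k, k), computed by an arbitrary projective resolution P of k. *)
Section KoszulDual.
Variable P : resolution trivial_mod.

Definition E (n : nat) : Type := Ext P trivial_mod n.
HB.instance Definition _ n := GRing.Lmodule.on (E n).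

Definition E_deg (n j : nat) : {pred E n} := Ext_deg P trivial_mod n j%:Z.

Definition E_all (n : nat) : {pred E n} := predT.

Arguments E_deg n j : clear implicits.
Arguments E_all n : clear implicits.

Definition E_mul (i m : nat) (X : {pred E i}) (Y : {pred E m}) : {pred E (i + m)} :=
  yoneda_prod X Y.

(* (E^3)^n, with the convention (E^3)^0 = E^0. *)
Fixpoint E3_pow (n : nat) : {pred E (n * 3)} :=
  match n return {pred E (n * 3)} with
  | 0 => E_all 0
  | m.+1 =>
      (if m is 0 as m return {pred E (m * 3)} -> {pred E (m.+1 * 3)}
       then fun=> E_all 3 else E_mul (E_all 3)) (@E3_pow m)
  end.

End KoszulDual.

(* Isomorphism of left E^0(A)-modules between E^m(A) and X (+) Y, where
   X and Y are subspaces of E^m(A) and Ext^l_A(M, k). *)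
Definition E0_iso_dsum (P : resolution trivial_mod) (M : grMod) (R : resolution M)
    (m l : nat) (X : {pred E P m}) (Y : {pred Ext R trivial_mod l}) : Prop :=
  exists phi : {linear E P m -> (E P m * Ext R trivial_mod l)%type},
    [/\ injective phi,
        forall w, (exists e, phi e = w) <-> w.1 \in X /\ w.2 \in Y
      & forall (c : E P 0) (e e' : E P m), yoneda c e e' ->
          yoneda c (phi e).1 (phi e').1 /\ yoneda c (phi e).2 (phi e').2].

End GradedAlgebra.

Arguments trivial_mod {F} A.
Arguments Ext_deg {F A M} P N n j.
Arguments E_deg {F A} P n j.
Arguments E_all {F A} P n.
Arguments E3_pow {F A} P n.
Arguments gm_deg {F A} _ _.
Arguments homj {F A} M N j.
Arguments uHom {F A} M N.

(* Main.v *)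
Require Import Defs.
From mathcomp Require Import all_boot all_order all_algebra.
From HB Require Import structures.
From mathcomp Require Import boolp functions.

(* Let Q be the minimal resolution of k.  Both sides only see in which degrees
   Q_n is generated, since E^n_j(A) = Hom(Q_n, k(j)): A is bi-Koszul iff
   E^n_j(A) = 0 for j not in Delta(n).

   Fix m = 3n such that the syzygy M = Omega^m(k) is generated in the single
   degree b = 2nd.  Then M / JM is a finite direct sum of shifted summands of k,
   and in the exact sequence
     Ext^i(M/JM, k) -> Ext^i(M, k) = E^(i+m)(A) -> Ext^i(JM, k) -> Ext^(i+1)(M/JM, k)
   the image of the first map is E^i(A) E^m(A).  If E^i(A) vanishes in degrees
   < t, then filtering JM by degree shows that Ext^i(JM, k) vanishes in degrees
   < b + 1 + t; this gives (a) for i = 3 and (b) for i = 1, and for i = 2 it shows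
   that only degree b + d + 1 of E^(m+2)(A) can survive in Ext^2(JM, k).  That
   component of Ext^2(JM, k) is reached, because Ext^3(M/JM, k) lives in degree
   b + 2d > b + d + 1.  The resulting short exact sequence of E^0(A)-modules
   splits by semisimplicity, which is (c).  Conversely (a) and (b) bound the
   degrees of E^(3n) and E^(3n+1), and under (c) a dimension count in the same
   sequence bounds those of E^(3n+2). *)

Set Implicit Arguments.
Unset Strict Implicit.
Unset Printing Implicit Defensive.
Local Open Scope ring_scope.

Import Order.TTheory GRing.Theory Num.Theory.

(** * Homogeneous components *)

(** The classes live on arbitrary resolutions [P] and [R], and M/JM is only a direct summand of a
    sum of shifted copies of k, so a resolution of M need not be an extension of shifts of [P] by
    [R]. A dual basis of the bottom layer over the semisimple ring A_0 repairs this: it writes the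
    identity of a resolution of M, up to homotopy, as a sum of maps through shifts of [P] and
    through [R]. Evaluating a cocycle on this identity gives exactness without building the long
    exact sequence. The chain maps into the shifts of [P] lift classes in Hom(M, k), and these are
    exactly the lifts that occur in a Yoneda product; hence kernel classes are sums of products. The
    same homotopy data serve both for JM in M and for the layers of the degree filtration.
    Finite-dimensional graded components are needed for the dual basis, for the splitting in (c) and
    for the dimension count; they come from A_0 and A_1. The isomorphism assumed in (c) is abstract
    and need not be related to restriction, which is why the converse can use it only through
    dimensions. The assumption d >= 2 enters as 2d != d + 1. *)

Section LinearFunctions.
Variables (R : pzRingType) (V W : lmodType R) (f : V -> W).
Hypothesis lf : linear f.

Lemma lin0 : f 0 = 0.
Proof. by have := lf (-1) 0 0; rewrite scaler0 addr0 scaleN1r addNr. Qed.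

Lemma linD u v : f (u + v) = f u + f v.
Proof. by have := lf 1 u v; rewrite !scale1r. Qed.

Lemma linZ a u : f (a *: u) = a *: f u.
Proof. by have := lf a u 0; rewrite !addr0 lin0 addr0. Qed.

Lemma linN u : f (- u) = - f u.
Proof. by rewrite -scaleN1r linZ scaleN1r. Qed.

Lemma linB u v : f (u - v) = f u - f v.
Proof. by rewrite linD linN. Qed.

Lemma lin_sum (I : Type) (r : seq I) (P : pred I) (F : I -> V) :
  f (\sum_(i <- r | P i) F i) = \sum_(i <- r | P i) f (F i).
Proof. exact: (big_morph f linD lin0). Qed.

End LinearFunctions.

Lemma big_uniq_supp (I : eqType) (V : zmodType) (s r : seq I) (f : I -> V) :
  uniq s -> uniq r -> {subset s <= r} -> (forall i, i \notin s -> f i = 0) ->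
  \sum_(i <- r) f i = \sum_(i <- s) f i.
Proof.
move=> us ur sr f0.
transitivity (\sum_(i <- r | i \in s) f i).
  rewrite [LHS](bigID (mem s)) /= [X in _ + X]big1 ?addr0 // => i; exact: f0.
rewrite -big_filter; apply: perm_big; apply: uniq_perm => //; first exact: filter_uniq.
by move=> i; rewrite mem_filter; apply/andP/idP => [[]//|si]; split=> //; exact: sr.
Qed.

Section Components.
Variables (I : eqType) (V : zmodType) (D : I -> {pred V}).
Hypotheses (Dz : forall i, zmod_closed (D i)) (dg : direct_grading D).

Definition dsupp (v : V) : seq I := projT1 (cid (dg.1 v)).

(** The family provided by [direct_grading] is arbitrary off its index list, so the component is set
    to 0 there. *)
Definition dcomp (i : I) (v : V) : V :=
  if i \in dsupp v then projT1 (cid (projT2 (cid (dg.1 v)))) i else 0.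

Let D0 i : 0 \in D i. Proof. by case: (Dz i). Qed.
Let DB i x y : x \in D i -> y \in D i -> x - y \in D i.
Proof. by case: (Dz i) => _; exact. Qed.

Lemma dsupp_uniq v : uniq (dsupp v).
Proof. by rewrite /dsupp; case: cid => s [x []]. Qed.

Lemma dcomp_in i v : dcomp i v \in D i.
Proof.
rewrite /dcomp /dsupp; case: cid => s /= sP; case: cid => x /= [us xD _].
by case: ifP.
Qed.

Lemma dcomp_out i v : i \notin dsupp v -> dcomp i v = 0.
Proof. by rewrite /dcomp => /negbTE ->. Qed.

Lemma dcomp_sum v : v = \sum_(i <- dsupp v) dcomp i v.
Proof.
rewrite /dcomp /dsupp; case: cid => s /= sP; case: cid => x /= [us xD {1}->].
by apply: eq_big_seq => i ->.
Qed.

Lemma dcomp_sum_big v (r : seq I) : uniq r -> {subset dsupp v <= r} ->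
  v = \sum_(i <- r) dcomp i v.
Proof.
move=> ur sr; rewrite {1}(dcomp_sum v); symmetry.
by apply: big_uniq_supp => //; [exact: dsupp_uniq | move=> i; exact: dcomp_out].
Qed.

(** Components do not depend on the chosen decomposition: both decompositions are extended by zero
    to a common index list, where directness kills the differences. *)
Lemma dcomp_uniq (s : seq I) (x : I -> V) : uniq s -> (forall i, x i \in D i) ->
  forall j, dcomp j (\sum_(i <- s) x i) = if j \in s then x j else 0.
Proof.
move=> us xD j; set v := \sum_(i <- s) x i.
pose r := undup (s ++ dsupp v).
pose x0 i := if i \in s then x i else 0.
have x0D i : x0 i \in D i by rewrite /x0; case: ifP.
have ur : uniq r by exact: undup_uniq.
have vE : v = \sum_(i <- r) x0 i.
  rewrite (@big_uniq_supp _ _ s) //.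
  - by apply: eq_big_seq => i is_; rewrite /x0 is_.
  - by move=> i is_; rewrite mem_undup mem_cat is_.
  - by move=> i /negbTE is_; rewrite /x0 is_.
have vE' : v = \sum_(i <- r) dcomp i v.
  by apply: dcomp_sum_big => // i iv; rewrite mem_undup mem_cat iv orbT.
have [jr|jr] := boolP (j \in r).
  apply/eqP; rewrite -subr_eq0; apply/eqP.
  apply: (dg.2 r (fun i => dcomp i v - x0 i)) => //.
    by move=> i; apply: DB => //; exact: dcomp_in.
  by rewrite sumrB -vE -vE' subrr.
move: jr; rewrite mem_undup mem_cat negb_or => /andP[js jv].
by rewrite dcomp_out // (negbTE js).
Qed.

Lemma dcomp_hom i v : v \in D i -> forall j, dcomp j v = if j == i then v else 0.
Proof.
move=> vi j.
pose x k := if k == i then v else 0.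
have -> : v = \sum_(k <- [:: i]) x k by rewrite big_seq1 /x eqxx.
rewrite dcomp_uniq //; last by move=> k; rewrite /x; case: eqP => // ->.
by rewrite inE big_seq1 /x eqxx; case: eqP.
Qed.

Lemma dcompD j u v : dcomp j (u + v) = dcomp j u + dcomp j v.
Proof.
pose r := undup (dsupp u ++ dsupp v).
have ur : uniq r by exact: undup_uniq.
have uE : u = \sum_(i <- r) dcomp i u.
  by apply: dcomp_sum_big => // i ii; rewrite mem_undup mem_cat ii.
have vE : v = \sum_(i <- r) dcomp i v.
  by apply: dcomp_sum_big => // i ii; rewrite mem_undup mem_cat ii orbT.
rewrite {1}uE {1}vE -big_split /= dcomp_uniq //; last first.
  move=> i; rewrite -[dcomp i v]opprK; apply: DB; first exact: dcomp_in.
  by rewrite -sub0r; apply: DB => //; exact: dcomp_in.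
case: ifP => // /negbT; rewrite mem_undup mem_cat negb_or => /andP[ju jv].
by rewrite !dcomp_out // addr0.
Qed.

Lemma dcomp0 j : dcomp j 0 = 0.
Proof. by apply: (addrI (dcomp j 0)); rewrite -dcompD !addr0. Qed.

Lemma dcomp_big (J : Type) (r : seq J) (P : pred J) (F : J -> V) j :
  dcomp j (\sum_(i <- r | P i) F i) = \sum_(i <- r | P i) dcomp j (F i).
Proof. exact: (big_morph _ (dcompD j) (dcomp0 j)). Qed.

Lemma dcomp_id j v : v \in D j -> dcomp j v = v.
Proof. by move/dcomp_hom->; rewrite eqxx. Qed.

Lemma dcomp_ne i j v : v \in D i -> j != i -> dcomp j v = 0.
Proof. by move/dcomp_hom-> => /negbTE->. Qed.

Lemma dcomp_eq0 v : (forall j, dcomp j v = 0) -> v = 0.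
Proof. by move=> v0; rewrite (dcomp_sum v) big1. Qed.

Lemma homog_ind (S : V -> Prop) : S 0 -> (forall u v, S u -> S v -> S (u + v)) ->
  (forall i v, v \in D i -> S v) -> forall v, S v.
Proof.
move=> S0 SD Sh v; rewrite (dcomp_sum v).
by apply: big_ind => // i _; apply: (Sh i); exact: dcomp_in.
Qed.

End Components.

Section GradedModules.
Variables (F : fieldType) (A : grAlg F).
Implicit Types (M N K : grMod A).

Lemma ga_zmod i : zmod_closed (ga_deg A i).
Proof. exact: (GRing.submod_closedB (ga_sub A i)). Qed.

Definition gcomp M (j : int) (x : M) : M := dcomp (gm_dir M) j x.
Definition acomp (j : nat) (x : A) : A := dcomp (ga_dir A) j x.

Lemma gm_0 M j : 0 \in gm_deg M j.
Proof. by case: (gm_sub M j). Qed.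

Lemma gm_B M j x y : x \in gm_deg M j -> y \in gm_deg M j -> x - y \in gm_deg M j.
Proof. by case: (gm_sub M j) => _; exact. Qed.

Lemma gm_N M j x : x \in gm_deg M j -> - x \in gm_deg M j.
Proof. by move=> xj; rewrite -sub0r gm_B ?gm_0. Qed.

Lemma gm_D M j x y : x \in gm_deg M j -> y \in gm_deg M j -> x + y \in gm_deg M j.
Proof. by move=> xj yj; rewrite -[y]opprK gm_B ?gm_N. Qed.

Lemma gm_sum M j (I : Type) (r : seq I) (P : pred I) (f : I -> M) :
  (forall i, P i -> f i \in gm_deg M j) -> \sum_(i <- r | P i) f i \in gm_deg M j.
Proof. by move=> fP; apply: (big_ind (fun x => x \in gm_deg M j)) => //; [exact: gm_0|exact: gm_D]. Qed.

Lemma gcomp_in M j (x : M) : gcomp j x \in gm_deg M j.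
Proof. by exact: (dcomp_in (@gm_sub F A M)). Qed.

Lemma gcompD M j (x y : M) : gcomp j (x + y) = gcomp j x + gcomp j y.
Proof. by exact: (dcompD (@gm_sub F A M)). Qed.

Lemma gcomp0 M j : gcomp j (0 : M) = 0.
Proof. by exact: (dcomp0 (@gm_sub F A M)). Qed.

Lemma gcomp_big M (J : Type) (r : seq J) (P : pred J) (f : J -> M) j :
  gcomp j (\sum_(i <- r | P i) f i) = \sum_(i <- r | P i) gcomp j (f i).
Proof. by exact: (dcomp_big (@gm_sub F A M)). Qed.

Lemma gcomp_id M j (x : M) : x \in gm_deg M j -> gcomp j x = x.
Proof. by exact: (dcomp_id (@gm_sub F A M)). Qed.

Lemma gcomp_ne M i j (x : M) : x \in gm_deg M i -> j != i -> gcomp j x = 0.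
Proof. by exact: (dcomp_ne (@gm_sub F A M)). Qed.

Lemma gcomp_eq0 M (x : M) : (forall j, gcomp j x = 0) -> x = 0.
Proof. exact: dcomp_eq0. Qed.

Lemma gr_ind M (S : M -> Prop) : S 0 -> (forall u v, S u -> S v -> S (u + v)) ->
  (forall i v, v \in gm_deg M i -> S v) -> forall v, S v.
Proof. exact: (homog_ind (@gm_sub F A M) (gm_dir M)). Qed.

Lemma ga_ind (S : A -> Prop) : S 0 -> (forall u v, S u -> S v -> S (u + v)) ->
  (forall i v, v \in ga_deg A i -> S v) -> forall v, S v.
Proof. exact: (homog_ind ga_zmod (ga_dir A)). Qed.

Lemma gm_uniq M i j (x : M) : x \in gm_deg M i -> x \in gm_deg M j -> i != j -> x = 0.
Proof. by move=> xi xj ij; rewrite -(gcomp_id xi); exact: (gcomp_ne xj). Qed.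

Lemma gcomp_act M (i : nat) (a : A) (x : M) j :
  a \in ga_deg A i -> gcomp j (a *: x) = a *: gcomp (j - i%:Z) x.
Proof.
move=> ai; elim/gr_ind: x => [|u v IHu IHv|k v vk].
- by rewrite scaler0 !gcomp0 scaler0.
- by rewrite scalerDr !gcompD IHu IHv scalerDr.
have avk := gm_act ai vk.
have [->|jk] := eqVneq j (i%:Z + k).
  by rewrite gcomp_id // addrC addKr gcomp_id.
rewrite (gcomp_ne avk) // (gcomp_ne vk) ?scaler0 //.
by rewrite subr_eq addrC.
Qed.

Lemma grsub0 M (S : grSub M) : 0 \in S.
Proof. by case: (sm_closed S). Qed.

Lemma grsubD M (S : grSub M) x y : x \in S -> y \in S -> x + y \in S.
Proof. by case: (sm_closed S) => _ Sl xS yS; rewrite -[x]scale1r; exact: Sl. Qed.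

Lemma grsubZ M (S : grSub M) a x : x \in S -> a *: x \in S.
Proof. by case: (sm_closed S) => S0 Sl xS; rewrite -[_ *: _]addr0; exact: Sl. Qed.

Lemma grsubN M (S : grSub M) x : x \in S -> - x \in S.
Proof. by move=> xS; rewrite -scaleN1r grsubZ. Qed.

Lemma grsubB M (S : grSub M) x y : x \in S -> y \in S -> x - y \in S.
Proof. by move=> xS yS; rewrite grsubD ?grsubN. Qed.

Lemma grsub_sum M (S : grSub M) (I : Type) (r : seq I) (P : pred I) (f : I -> M) :
  (forall i, P i -> f i \in S) -> \sum_(i <- r | P i) f i \in S.
Proof. by move=> fP; apply: (big_ind (fun x => x \in S)) => //; [exact: grsub0|exact: grsubD]. Qed.

Lemma grsub_comp M (S : grSub M) j x : x \in S -> gcomp j x \in S.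
Proof.
move=> xS; have [js|js] := boolP (j \in dsupp (gm_dir M) x); last first.
  by rewrite /gcomp dcomp_out // grsub0.
apply: (gs_homog (s := dsupp (gm_dir M) x) (x := fun i => gcomp i x)) => //.
- exact: dsupp_uniq.
- by move=> i; exact: gcomp_in.
- by rewrite -dcomp_sum.
Qed.

Lemma grSub_homog M (S : {pred M}) :
  (forall j x, x \in S -> gcomp j x \in S) ->
  forall (clS : submod_closed S) (s : seq int) (x : int -> M), uniq s ->
    (forall i, x i \in gm_deg M i) -> \sum_(i <- s) x i \in Submod clS ->
    forall i, i \in s -> x i \in Submod clS.
Proof.
move=> Sc clS s x us xD xS i is_.
have := Sc i _ xS; rewrite /gcomp dcomp_uniq ?is_ //; exact: gm_sub.
Qed.

Definition mkGrSub M (S : {pred M}) (clS : submod_closed S)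
    (Sc : forall j x, x \in S -> gcomp j x \in S) : grSub M :=
  @GrSub F A M (Submod clS) (grSub_homog Sc (clS := clS)).

Lemma homjP M N j (f : M -> N) : reflect
  (linear f /\ forall i x, x \in gm_deg M i -> f x \in gm_deg N (i - j))
  (f \in homj M N j).
Proof. exact: asboolP. Qed.

Lemma homj_lin M N j (f : M -> N) : f \in homj M N j -> linear f.
Proof. by case/homjP. Qed.

Lemma homj_comp M N j (f : M -> N) i x : f \in homj M N j ->
  gcomp i (f x) = f (gcomp (i + j) x).
Proof.
case/homjP=> lf df; elim/gr_ind: x => [|u v IHu IHv|k v vk].
- by rewrite (lin0 lf) !gcomp0 (lin0 lf).
- by rewrite (linD lf) !gcompD IHu IHv (linD lf).
have fk := df _ _ vk.
have [->|ik] := eqVneq i (k - j).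
  by rewrite gcomp_id // subrK gcomp_id.
rewrite (gcomp_ne fk) // (gcomp_ne vk) ?(lin0 lf) //.
by apply: contraNneq ik => <-; rewrite addrK.
Qed.

End GradedModules.

(** * Graded homomorphisms *)

Section GradedHoms.
Variables (F : fieldType) (A : grAlg F).
Implicit Types (M N K : grMod A).

Lemma alg_deg0 (c : F) : (c%:A : A) \in ga_deg A 0.
Proof.
by case: (ga_sub A 0) => h0 hl; rewrite -[_%:A]addr0; apply: hl => //; exact: ga_one.
Qed.

Lemma gm_Z0 M j (a : A) (x : M) :
  a \in ga_deg A 0 -> x \in gm_deg M j -> a *: x \in gm_deg M j.
Proof. by move=> a0 xj; rewrite -[j]add0r; exact: gm_act. Qed.

Lemma homj_submod M N j :
  submod_closed (homj M N j : {pred M -> resF (N : lmodType A)}).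
Proof.
split=> [|c f g /homjP[lf df] /homjP[lg dg]]; apply/homjP.
  split=> [a u v|i x xi]; last exact: gm_0.
  by change (0 = a *: (0 : N) + 0); rewrite scaler0 addr0.
pose h (x : M) : N := (c%:A : A) *: (f x : N) + g x.
change (linear h /\ forall i x, x \in gm_deg M i -> h x \in gm_deg N (i - j)).
split=> [a u v|i x xi].
  rewrite /h lf lg scalerDr !scalerA mulr_algl.
  by rewrite addrACA scalerDr scalerA mulr_algr.
by apply: gm_D; [apply: gm_Z0; [exact: alg_deg0|exact: df]|exact: dg].
Qed.

(* [ghom (Some j)] is the component of degree [j] of [uHom], which is [ghom None]. *)
Definition ghom M N (o : option int) (f : M -> N) : Prop :=
  if o is Some j then f \in homj M N j else f \in uHom M N.

Lemma hom_ext M N o (f g : M -> N) : f =1 g -> ghom o f -> ghom o g.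
Proof. by move=> /funext->. Qed.

Lemma hom_linF M N o (c : F) (f g : M -> N) : ghom o f -> ghom o g ->
  ghom o (fun x => (c%:A : A) *: f x + g x).
Proof.
case: o => [j|].
  by case: (homj_submod M N j) => _ h; exact: h.
have [_ h] := lspan_submod (fun f : M -> resF N => exists j, f \in homj M N j).
exact: h.
Qed.

Lemma hom0 M N o : ghom o (fun _ : M => 0 : N).
Proof.
case: o => [j|]; first by case: (homj_submod M N j).
by case: (lspan_submod (fun f : M -> resF N => exists j, f \in homj M N j)).
Qed.

Lemma homD M N o (f g : M -> N) : ghom o f -> ghom o g -> ghom o (fun x => f x + g x).
Proof.
by move=> hf hg; apply: hom_ext (hom_linF 1 hf hg) => x; rewrite !scale1r.
Qed.

Lemma homZF M N o (c : F) (f : M -> N) : ghom o f -> ghom o (fun x => (c%:A : A) *: f x).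
Proof.
by move=> hf; apply: hom_ext (hom_linF c hf (hom0 M N o)) => x; rewrite addr0.
Qed.

Lemma homN M N o (f : M -> N) : ghom o f -> ghom o (fun x => - f x).
Proof.
by move=> /(homZF (-1)); apply: hom_ext => x; rewrite scaleN1r scaleN1r.
Qed.

Lemma homB M N o (f g : M -> N) : ghom o f -> ghom o g -> ghom o (fun x => f x - g x).
Proof. by move=> hf hg; apply: homD => //; exact: homN. Qed.

Lemma hom_sum M N o (I : Type) (r : seq I) (P : pred I) (f : I -> M -> N) :
  (forall i, P i -> ghom o (f i)) -> ghom o (fun x => \sum_(i <- r | P i) f i x).
Proof.
move=> hf; elim: r => [|i r IH].
  by apply: hom_ext (hom0 M N o) => x; rewrite big_nil.
case Pi: (P i).
  by apply: hom_ext (homD (hf _ Pi) IH) => x; rewrite big_cons Pi.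
by apply: hom_ext IH => x; rewrite big_cons Pi.
Qed.

Lemma uHom_homj M N j (f : M -> N) : ghom (Some j) f -> ghom None f.
Proof. by move=> hf; apply: mem_lspan; exists j. Qed.

Lemma hom_None M N o (f : M -> N) : ghom o f -> ghom None f.
Proof. by case: o => // j; exact: uHom_homj. Qed.

Lemma uHomP M N (f : M -> N) : ghom None f -> exists (s : seq int) (g : int -> M -> N),
  [/\ uniq s, forall j, ghom (Some j) (g j) & forall x, f x = \sum_(j <- s) g j x].
Proof.
move=> /asboolP fH.
(* The extra condition that [g j] vanishes off [s] allows two decompositions to be added over the
   union of their index lists. *)
pose S : {pred M -> resF N} := [pred f | `[< exists (s : seq int) (g : int -> M -> N),
  [/\ uniq s, forall j, ghom (Some j) (g j), forall j, j \notin s -> g j =1 (fun=> 0)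
    & forall x, f x = \sum_(j <- s) g j x] >]].
suff /asboolP[s [g [us gh _ fE]]] : f \in S by exists s, g.
apply: fH => [|g [j gj]]; last first.
  apply/asboolP; exists [:: j], (fun i => if i == j then g else fun=> 0); split=> //.
  - by move=> i; case: eqP => [->//|_]; exact: hom0.
  - by move=> i; rewrite inE => /negbTE->.
  - by move=> x; rewrite big_seq1 eqxx.
split.
  apply/asboolP; exists [::], (fun _ _ => 0); split=> // [j|x]; first exact: hom0.
  by rewrite big_nil.
move=> c f1 f2 /asboolP[s1 [g1 [us1 gh1 g10 f1E]]] /asboolP[s2 [g2 [us2 gh2 g20 f2E]]].
apply/asboolP; exists (undup (s1 ++ s2)), (fun j x => (c%:A : A) *: g1 j x + g2 j x).
split=> [|j|j|x]; first exact: undup_uniq.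
- exact: hom_linF.
- rewrite mem_undup mem_cat negb_or => /andP[j1 j2] x.
  by rewrite g10 // g20 // scaler0 addr0.
rewrite -[LHS]/((c%:A : A) *: (f1 x : N) + f2 x) f1E f2E big_split /= -scaler_sumr.
congr (_ *: _ + _); symmetry; apply: big_uniq_supp => //; rewrite ?undup_uniq //.
- by move=> j js; rewrite mem_undup mem_cat js.
- by move=> j /g10.
- by move=> j js; rewrite mem_undup mem_cat js orbT.
- by move=> j /g20.
Qed.

Lemma hom_linear M N o (f : M -> N) : ghom o f -> linear f.
Proof.
case: o => [j /homj_lin //|/uHomP[s [g [us gh fE]]]] a u v.
rewrite !fE scaler_sumr -big_split /=; apply: eq_bigr => j _.
exact: (homj_lin (gh j)).
Qed.

Lemma hom_linE M N o (f : M -> N) : ghom o f ->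
  [/\ f 0 = 0, {morph f : x y / x + y}, {morph f : x y / x - y},
     {morph f : x / - x} & forall a, {morph f : x / a *: x}].
Proof.
move/hom_linear=> lf; split; [exact: lin0|exact: linD|exact: linB|exact: linN|].
by move=> a x; exact: linZ.
Qed.

(** On a homogeneous element of degree i the values [g k v] lie in the distinct degrees i - k, so a
    single component isolates each of them. *)
Lemma homj_sum0 M N (s : seq int) (g : int -> M -> N) : uniq s ->
  (forall j, ghom (Some j) (g j)) -> (forall x, \sum_(j <- s) g j x = 0) ->
  forall j x, j \in s -> g j x = 0.
Proof.
move=> us gh s0 j x js; have lg i := homj_lin (gh i).
elim/gr_ind: x => [|u v IHu IHv|i v vi].
- exact: (lin0 (lg j)).
- by rewrite (linD (lg j)) IHu IHv addr0.
have gd k : g k v \in gm_deg N (i - k) by have /homjP[_] := gh k; exact.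
have := gcomp0 N (i - j); rewrite -(s0 v) gcomp_big (bigD1_seq j) //= big1 ?addr0.
  by rewrite gcomp_id.
move=> k kj; apply: (gcomp_ne (gd k)).
by apply: contraNneq kj => /addrI/oppr_inj->.
Qed.

Definition oadd (o o' : option int) : option int :=
  if o is Some i then if o' is Some j then Some (i + j) else None else None.

Lemma homj_compose M N K i j (f : M -> N) (g : N -> K) :
  ghom (Some i) f -> ghom (Some j) g -> ghom (Some (i + j)) (fun x => g (f x)).
Proof.
move=> /homjP[lf df] /homjP[lg dg]; apply/homjP; split=> [a u v|k x xk].
  by rewrite lf lg.
by rewrite opprD addrA; apply: dg; exact: df.
Qed.

Lemma hom_compose M N K o o' (f : M -> N) (g : N -> K) :
  ghom o f -> ghom o' g -> ghom (oadd o o') (fun x => g (f x)).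
Proof.
have main : ghom None f -> ghom None g -> ghom None (fun x => g (f x)).
  move=> /uHomP[s [f_ [_ fh fE]]] hg.
  have [_ _ _ _ _] := hom_linE hg; have [t [g_ [_ gh gE]]] := uHomP hg.
  apply: (@hom_ext _ _ _ (fun x => \sum_(i <- s) \sum_(j <- t) g_ j (f_ i x))).
    move=> x; rewrite fE (lin_sum (hom_linear hg)).
    by apply: eq_bigr => i _; rewrite gE.
  apply: hom_sum => i _; apply: hom_sum => j _.
  exact: uHom_homj (homj_compose (fh i) (gh j)).
case: o o' => [i|] [j|]; first exact: homj_compose; move=> hf hg; apply: main => //.
- exact: hom_None hf.
- exact: hom_None hg.
Qed.

Lemma hom_compose0r M N K o (f : M -> N) (g : N -> K) :
  ghom o f -> ghom (Some 0) g -> ghom o (fun x => g (f x)).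
Proof.
by move=> hf hg; have := hom_compose hf hg; case: o hf => [j|] hf //=; rewrite addr0.
Qed.

Lemma hom_compose0l M N K o (f : M -> N) (g : N -> K) :
  ghom (Some 0) f -> ghom o g -> ghom o (fun x => g (f x)).
Proof.
by move=> hf hg; have := hom_compose hf hg; case: o hg => [j|] hg //=; rewrite add0r.
Qed.

Lemma hom_gr M N (f : grHom M N) : ghom (Some 0) f.
Proof.
by apply/homjP; split=> [|i x xi]; [exact: gh_linear|rewrite subr0; exact: gh_deg].
Qed.

Lemma hom_id M : ghom (Some 0) (fun x : M => x).
Proof. by apply/homjP; split=> // i x; rewrite subr0. Qed.

Lemma gh_lin M N (f : grHom M N) : linear f.
Proof. exact: gh_linear. Qed.

End GradedHoms.

(** * Lifting maps of arbitrary degree through projectives *)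

Section Lifting.
Variables (F : fieldType) (A : grAlg F).
Implicit Types (M N K P : grMod A).

Section Shift.
Variables (M : grMod A) (j : int).

Definition shift_deg (i : int) : {pred M} := gm_deg M (i - j).

Lemma shift_sub i : zmod_closed (shift_deg i).
Proof. exact: gm_sub. Qed.

Lemma shift_dir : direct_grading shift_deg.
Proof.
have [dE dI] := gm_dir M; split=> [v|s x us xD s0 i si].
  have [s [x [us xD vE]]] := dE v.
  exists (map (+%R^~ j) s), (fun i => x (i - j)); split.
  - by rewrite map_inj_uniq //; exact: addIr.
  - by move=> i; exact: xD.
  - by rewrite vE big_map; apply: eq_bigr => i _; rewrite addrK.
have := dI (map (fun i => i - j) s) (fun i => x (i + j)).
rewrite map_inj_uniq ?big_map; last exact: addIr.
move=> /(_ us) h; rewrite -[i](subrK j); apply: h.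
- by move=> k; have := xD (k + j); rewrite /shift_deg addrK.
- by rewrite -[RHS]s0; apply: eq_bigr => k _; rewrite subrK.
- exact: map_f.
Qed.

Lemma shift_act (i : nat) k (a : A) x :
  a \in ga_deg A i -> x \in shift_deg k -> a *: x \in shift_deg (i%:Z + k).
Proof. by rewrite /shift_deg -addrA => ai xk; exact: gm_act. Qed.

Definition shiftGr : grMod A := GrMod shift_sub shift_dir shift_act.

End Shift.

Section Image.
Variables (M N : grMod A) (p : grHom M N).

Definition im_pred : {pred N} := [pred y | `[< exists x, p x = y >]].

Lemma im_submod : submod_closed im_pred.
Proof.
split=> [|a u v /asboolP[x <-] /asboolP[y <-]]; apply/asboolP.
  by exists 0; rewrite (lin0 (gh_lin p)).
by exists (a *: x + y); rewrite gh_linear.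
Qed.

Lemma im_comp j y : y \in im_pred -> gcomp j y \in im_pred.
Proof.
move=> /asboolP[x <-]; apply/asboolP; exists (gcomp j x).
by rewrite (homj_comp _ _ (hom_gr p)) addr0.
Qed.

Definition imGr : grSub N := mkGrSub im_submod im_comp.

End Image.

(** [projective] only lifts degree-zero maps along surjections. A map of degree j has degree zero
    into the shifted module, and [p] becomes surjective once its target is cut down to its image. *)
Lemma lift_homj P N N' (p : grHom N N') j (f : P -> N') : projective P ->
  ghom (Some j) f -> (forall x, exists y, p y = f x) ->
  exists2 g : P -> N, ghom (Some j) g & forall x, p (g x) = f x.
Proof.
move=> projP /homjP[lf df] fp.
have fI x : f x \in imGr p by apply/asboolP.
have pI x : p x \in imGr p by apply/asboolP; exists x.
pose N1 := shiftGr N j; pose N2 := shiftGr (subGr (imGr p)) j.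
pose p0 (x : N1) : N2 := LSub (pI x).
pose f0 (x : P) : N2 := LSub (fI x).
have lp0 : linear p0 by move=> a u v; apply: val_inj; exact: (gh_lin p).
have lf0 : linear f0 by move=> a u v; apply: val_inj; exact: lf.
have dp0 i x : x \in gm_deg N1 i -> p0 x \in gm_deg N2 i.
  by move=> xi; change (p x \in gm_deg N' (i - j)); exact: gh_deg.
have df0 i x : x \in gm_deg P i -> f0 x \in gm_deg N2 i.
  by move=> xi; change (f x \in gm_deg N' (i - j)); exact: df.
have [y|g gE] := projP _ _ (GrHom lp0 dp0) (GrHom lf0 df0).
  have /asboolP[x xE] := lsub_valP y.
  by exists x; apply: val_inj.
exists g => [|x].
  by apply/homjP; split=> [|i x xi]; [exact: (gh_lin g)|exact: (gh_deg g)].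
by have /(congr1 val) := gE x.
Qed.

Lemma lift_hom P N N' (p : grHom N N') o (f : P -> N') : projective P ->
  ghom o f -> (forall x, exists y, p y = f x) ->
  exists2 g : P -> N, ghom o g & forall x, p (g x) = f x.
Proof.
case: o => [j|]; first exact: lift_homj.
move=> projP /uHomP[s [f_ [us fh fE]]] fp.
have f_p j : exists g : P -> N, ghom (Some j) g /\ (j \in s -> forall x, p (g x) = f_ j x).
  have [js|js] := boolP (j \in s); last by exists (fun=> 0); split=> //; exact: hom0.
  have [x|g hg gE] := @lift_homj P N N' p j (f_ j) projP (fh j); last by exists g.
  (* Only [f] as a whole is known to land in the image of [p]. On a homogeneous element [f_ j] is a
     homogeneous component of the value of [f], and the image is a graded submodule. *)
  suff /asboolP : f_ j x \in imGr p by [].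
  have lfj := homj_lin (fh j).
  elim/gr_ind: x => [|u v IHu IHv|i v vi].
  - by rewrite (lin0 lfj) grsub0.
  - by rewrite (linD lfj) grsubD.
  have gd k : f_ k v \in gm_deg N' (i - k) by have /homjP[_] := fh k; exact.
  have fI : f v \in imGr p by apply/asboolP.
  have := grsub_comp (i - j) fI; rewrite fE gcomp_big (bigD1_seq j) //= big1 ?addr0.
    by rewrite gcomp_id.
  move=> k kj; apply: (gcomp_ne (gd k)).
  by apply: contraNneq kj => /addrI/oppr_inj->.
have [g gP] := choice f_p.
exists (fun x => \sum_(j <- s) g j x) => [|x].
  by apply: hom_sum => j _; apply: uHom_homj (gP j).1.
rewrite (lin_sum (gh_lin p)) fE; apply: eq_big_seq => j js.
exact: (gP j).2.
Qed.

End Lifting.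

(** * Lifting through projective complexes *)

Lemma dep_choice (T : nat -> Type) (I : forall t, T t -> Prop)
    (R : forall t, T t -> T t.+1 -> Prop) (x0 : T 0%N) :
  I 0%N x0 -> (forall t x, I t x -> exists2 y, I t.+1 y & R t x y) ->
  exists2 f : forall t, T t, f 0%N = x0 & forall t, I t (f t) /\ R t (f t) (f t.+1).
Proof.
move=> I0 step.
have next t (x : {x : T t | I t x}) : {y : {y : T t.+1 | I t.+1 y} | R t (sval x) (sval y)}.
  have /cid2[y Iy Ry] := step t _ (svalP x).
  by exists (exist _ y Iy).
pose f := fix f t : {x : T t | I t x} :=
  if t is t'.+1 then sval (next t' (f t')) else exist _ x0 I0.
exists (fun t => sval (f t)) => // t; split; first exact: (svalP (f t)).
exact: (svalP (next t (f t))).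
Qed.

Section Chains.
Variables (F : fieldType) (A : grAlg F).
Implicit Types (M N K P : grMod A).

Definition exact_at M N K (f : M -> N) (g : N -> K) : Prop :=
  forall y, g y = 0 <-> exists x, y = f x.

(* Chain maps out of the mapping cone of [k]. *)
Lemma solve_chain o (S : nat -> grMod A) (e : forall t, S t.+1 -> S t)
    N (Y : nat -> grMod A) (a : grHom (Y 0) N)
    (delta : forall t, grHom (Y t.+1) (Y t)) (r : S 0%N -> N)
    (k : forall t, S t.+1 -> Y t) :
  (forall t, projective (S t)) -> (forall t, ghom (Some 0) (e t)) ->
  (forall t x, e t (e t.+1 x) = 0) ->
  exact_at (delta 0%N) a -> (forall t, exact_at (delta t.+1) (delta t)) ->
  ghom o r -> (forall t, ghom o (k t)) -> (forall x, exists y, a y = r x) ->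
  (forall x, a (k 0%N x) = - r (e 0%N x)) ->
  (forall t x, delta t (k t.+1 x) = - k t (e t.+1 x)) ->
  exists u : forall t, S t -> Y t,
    [/\ forall t, ghom o (u t), forall x, a (u 0%N x) = r x
      & forall t x, delta t (u t.+1 x) = u t (e t x) + k t x].
Proof.
move=> Sproj eh ee ex0 ex rh kh ra ka kd.

have [u0 u0h u0E] := lift_hom (p := a) (Sproj 0%N) rh ra.
(* The invariant is what [lift_hom] needs at the next stage. It survives a step because e e = 0 and
   the two k-terms cancel by the sign in the hypothesis on [delta t (k t.+1 x)]; exactness of
   [delta] then provides the preimage. *)
pose I t (u : S t -> Y t) := ghom o u /\ (forall x, exists y, delta t y = u (e t x) + k t x).
pose R t (u : S t -> Y t) (u' : S t.+1 -> Y t.+1) :=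
  forall x, delta t (u' x) = u (e t x) + k t x.
have I0 : I 0%N u0.
  split=> // x.
  have /ex0[y ->] : a (u0 (e 0%N x) + k 0%N x) = 0.
    by rewrite (linD (gh_lin a)) u0E ka addrN.
  by exists y.
have [t u [uh im]|u uE uP] := @dep_choice (fun t => S t -> Y t) I R u0 I0.
  have [|u' u'h u'E] := @lift_hom _ _ _ _ _ (delta t) o _ (Sproj t.+1) _ im.
    by apply: homD => //; exact: (hom_compose0l (eh t) uh).
  exists u' => //; split=> // x.
  have /ex[y ->] : delta t (u' (e t.+1 x) + k t.+1 x) = 0.
    rewrite (linD (gh_lin (delta t))) u'E kd ee (lin0 (hom_linear uh)) add0r.
    by rewrite addrN.
  by exists y.
exists u; split=> [t|x|t]; first by case: (uP t) => -[].
- by rewrite uE.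
- by case: (uP t).
Qed.

Lemma res_exact_at0 M (X : resolution M) : exact_at (res_dif X 0) (res_aug X).
Proof. exact: res_exact0. Qed.

Lemma res_exact_at M (X : resolution M) t : exact_at (res_dif X t.+1) (res_dif X t).
Proof. exact: res_exact. Qed.

Lemma res_dd M (X : resolution M) t x : res_dif X t (res_dif X t.+1 x) = 0.
Proof. by apply/res_exact; exists x. Qed.

Lemma res_augd M (X : resolution M) x : res_aug X (res_dif X 0 x) = 0.
Proof. by apply/res_exact0; exists x. Qed.

(** Only the target has to be exact; the source is just a complex of projectives. It can therefore
    be a shifted, sign-changed or tail piece of a resolution. *)
Lemma compare o (S : nat -> grMod A) (e : forall t, S t.+1 -> S t)
    N (Y : nat -> grMod A) (a : grHom (Y 0) N)
    (delta : forall t, grHom (Y t.+1) (Y t)) (r : S 0%N -> N) :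
  (forall t, projective (S t)) -> (forall t, ghom (Some 0) (e t)) ->
  (forall t x, e t (e t.+1 x) = 0) ->
  exact_at (delta 0%N) a -> (forall t, exact_at (delta t.+1) (delta t)) ->
  ghom o r -> (forall x, exists y, a y = r x) -> (forall x, r (e 0%N x) = 0) ->
  exists u : forall t, S t -> Y t,
    [/\ forall t, ghom o (u t), forall x, a (u 0%N x) = r x
      & forall t x, delta t (u t.+1 x) = u t (e t x)].
Proof.
move=> Sproj eh ee ex0 ex rh ra re.
have [] := @solve_chain o S e N Y a delta r (fun t _ => 0) => //.
- by move=> t; exact: hom0.
- by move=> x; rewrite (lin0 (gh_lin a)) re oppr0.
- by move=> t x; rewrite (lin0 (gh_lin (delta t))) oppr0.
move=> u [uh u0 uE]; exists u; split=> // t x; by rewrite uE addr0.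
Qed.

Lemma res_compare o M N (S : resolution M) (Y : resolution N) (r : M -> N) :
  ghom o r -> exists u : forall t, S t -> Y t,
    [/\ forall t, ghom o (u t), forall x, res_aug Y (u 0%N x) = r (res_aug S x)
      & forall t x, res_dif Y t (u t.+1 x) = u t (res_dif S t x)].
Proof.
move=> rh; apply: (@compare o S (fun t => res_dif S t) N Y (res_aug Y) (fun t => res_dif Y t)).
- exact: res_proj.
- by move=> t; exact: hom_gr.
- exact: res_dd.
- exact: res_exact_at0.
- exact: res_exact_at.
- exact: (hom_compose0l (hom_gr (res_aug S)) rh).
- by move=> x; exact: res_surj.
- by move=> x; rewrite res_augd (lin0 (hom_linear rh)).
Qed.

(** A null homotopy is a solution of [solve_chain] for the target shifted by one place, with
    [phi t.+1] as correction term; negating the source differential produces the sign of the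
    homotopy formula. *)
Lemma nullhtpy o (S : nat -> grMod A) (e : forall t, S t.+1 -> S t)
    N (Y : resolution N) (phi : forall t, S t -> Y t) :
  (forall t, projective (S t)) -> (forall t, ghom (Some 0) (e t)) ->
  (forall t x, e t (e t.+1 x) = 0) ->
  (forall t, ghom o (phi t)) -> (forall x, res_aug Y (phi 0%N x) = 0) ->
  (forall t x, res_dif Y t (phi t.+1 x) = phi t (e t x)) ->
  exists s : forall t, S t -> Y t.+1,
    [/\ forall t, ghom o (s t), forall x, phi 0%N x = res_dif Y 0 (s 0%N x)
      & forall t x, phi t.+1 x = res_dif Y t.+1 (s t.+1 x) + s t (e t x)].
Proof.
move=> Sproj eh ee ph p0 pE.
have [] := @solve_chain o S (fun t x => - e t x) (Y 0) (fun t => Y t.+1)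
  (res_dif Y 0) (fun t => res_dif Y t.+1) (phi 0%N) (fun t => phi t.+1) => //.
- by move=> t; exact: homN.
- by move=> t x; rewrite (linN (hom_linear (eh t))) ee !oppr0.
- exact: res_exact_at.
- by move=> t; exact: res_exact_at.
- by move=> x; have /res_exact0[y ->] := p0 x; exists y.
- by move=> x; rewrite pE (linN (hom_linear (ph 0%N))) opprK.
- by move=> t x; rewrite pE (linN (hom_linear (ph t.+1))) opprK.
move=> s [sh s0 sE]; exists s; split=> // t x.
by rewrite sE (linN (hom_linear (sh t))) addrAC addNr add0r.
Qed.

End Chains.

(** * Free modules and existence of resolutions *)

Section FreeModules.
Variables (F : fieldType) (A : grAlg F).
Implicit Types (M N K P : grMod A).

Lemma reg_act M (k l : int) (a : A) (x : M) :
  a \in @reg_deg F A k -> x \in gm_deg M l -> a *: x \in gm_deg M (k + l).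
Proof.
case: k => n /= ak xl; first exact: gm_act.
by move: ak; rewrite inE => /eqP->; rewrite scale0r gm_0.
Qed.

Lemma gr_comp M N K (f : grHom M N) (g : grHom N K) :
  exists h : grHom M K, forall x, h x = g (f x).
Proof.
have lh : linear (fun x => g (f x)) by move=> a u v; rewrite !gh_linear.
have dh j x : x \in gm_deg M j -> g (f x) \in gm_deg K j.
  by move=> xj; do 2!apply: gh_deg.
by exists (GrHom lh dh).
Qed.

Lemma subval_linear M (S : grSub M) : linear (fun x : subGr S => lsub_val x).
Proof. by move=> a u v; exact: (linearP (val : lsub S -> M)). Qed.

Definition subval M (S : grSub M) : grHom (subGr S) M :=
  GrHom (@subval_linear M S) (fun j x xj => xj).

Lemma lproj_deg M (S : grSub M) j x :
  x \in gm_deg M j -> (lproj S x : quoGr S) \in gm_deg (quoGr S) j.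
Proof. by move=> xj; apply/asboolP; exists x. Qed.

Definition quoproj M (S : grSub M) : grHom M (quoGr S) :=
  @GrHom F A M (quoGr S) (lproj S) (lproj_linear S) (@lproj_deg M S).

Section Free.
Variable M : grMod A.

(* The pair [(j, x)] indexes a generator of degree [j] that covers the component
   of degree [j] of [x]. *)
Let I : eqType := (int * M)%type.

Definition finsupp_pred : {pred I -> A^o} :=
  [pred f | `[< exists s : seq I, forall i, i \notin s -> f i = 0 >]].

Lemma finsupp_submod : submod_closed finsupp_pred.
Proof.
split=> [|a f g /asboolP[s sP] /asboolP[t tP]]; apply/asboolP.
  by exists [::].
exists (s ++ t) => i; rewrite mem_cat negb_or => /andP[is_ it].
by rewrite -[LHS]/(a *: f i + g i) sP // tP // scaler0 addr0.
Qed.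

Definition free_sort : Type := lsub (Submod finsupp_submod).
HB.instance Definition _ := GRing.Lmodule.on free_sort.

Definition coef (i : I) (v : free_sort) : A := lsub_val v i.

Lemma coef_linear i : linear (coef i : free_sort -> A^o).
Proof.
move=> a u v; rewrite /coef.
by rewrite -[lsub_val (_ + _)]/(val (a *: u + v)) linearP.
Qed.

Lemma coef_ext u v : (forall i, coef i u = coef i v) -> u = v.
Proof. by move=> uv; apply: val_inj; apply: funext => i; exact: uv. Qed.

Definition fsupp (v : free_sort) : seq I := undup (sval (cid (asboolW (lsub_valP v)))).

Lemma fsupp_uniq v : uniq (fsupp v). Proof. exact: undup_uniq. Qed.

Lemma coef_out v i : i \notin fsupp v -> coef i v = 0.
Proof. by rewrite mem_undup; case: cid => s /= sP /sP. Qed.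

Lemma delta_finsupp (i : I) :
  (fun k => (k == i)%:R : A^o) \in Submod finsupp_submod.
Proof.
apply/asboolP; exists [:: i] => k; rewrite inE => /negbTE.
by move->.
Qed.

Definition fgen (i : I) : free_sort := LSub (delta_finsupp i).

Lemma coef_gen i k : coef k (fgen i) = (k == i)%:R.
Proof. by []. Qed.

Lemma free_sum (v : free_sort) : v = \sum_(i <- fsupp v) coef i v *: fgen i.
Proof.
apply: coef_ext => k; rewrite (lin_sum (coef_linear k)).
rewrite (eq_bigr (fun i => if i == k then coef i v else 0)); last first.
  move=> i _; rewrite (linZ (coef_linear k)) coef_gen eq_sym.
  by case: eqP => _; rewrite ?scaler0 // -[LHS]/(_ * _) mulr1.
rewrite -big_mkcond /= -big_filter.
have [kv|kv] := boolP (k \in fsupp v).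
  by rewrite filter_pred1_uniq ?fsupp_uniq // big_seq1.
rewrite coef_out // big1_seq // => i /andP[_].
by rewrite mem_filter => /andP[/eqP-> kv']; rewrite kv' in kv.
Qed.

Definition free_deg (j : int) : {pred free_sort} :=
  [pred v | `[< forall i, coef i v \in gm_deg (shiftGr (regGr A) i.1) j >]].

Lemma free_deg_zmod j : zmod_closed (free_deg j).
Proof.
split=> [|u v /asboolP uj /asboolP vj]; apply/asboolP => i.
  by rewrite (lin0 (coef_linear i)); exact: (gm_0 (shiftGr (regGr A) i.1)).
by rewrite (linB (coef_linear i)); exact: (@gm_B _ _ (shiftGr (regGr A) i.1)).
Qed.

Lemma free_deg_dir : direct_grading free_deg.
Proof.
pose G (i : I) := shiftGr (regGr A) i.1.
split=> [v|s x us xD s0 j js]; last first.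
  apply: coef_ext => i; rewrite (lin0 (coef_linear i)).
  apply: ((gm_dir (G i)).2 s (fun j => coef i (x j))) => //.
    by move=> k; have /asboolP := xD k.
  by rewrite -(lin_sum (coef_linear i)) s0 (lin0 (coef_linear i)).
have cS j : (fun i => gcomp j (coef i v : G i) : A^o) \in Submod finsupp_submod.
  by apply/asboolP; exists (fsupp v) => i /coef_out ->; rewrite gcomp0.
pose r := undup (flatten [seq dsupp (gm_dir (G i)) (coef i v : G i) | i <- fsupp v]).
exists r, (fun j => LSub (cS j)); split; first exact: undup_uniq.
  by move=> j; apply/asboolP => i; rewrite /coef /=; exact: gcomp_in.
apply: coef_ext => i; rewrite (lin_sum (coef_linear i)) /=.
have [iv|/coef_out i0] := boolP (i \in fsupp v); last first.
  rewrite {1}i0 big1 // => j _.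
  by rewrite -[LHS]/(gcomp j (coef i v : G i)) i0 gcomp0.
apply: (dcomp_sum_big (D := gm_deg (G i))) => //; first exact: undup_uniq.
move=> j ji; rewrite mem_undup; apply/flattenP.
by exists (dsupp (gm_dir (G i)) (coef i v : G i)) => //; exact: map_f.
Qed.

Lemma free_deg_act (k : nat) j (a : A) v :
  a \in ga_deg A k -> v \in free_deg j -> a *: v \in free_deg (k%:Z + j).
Proof.
move=> ak /asboolP vj; apply/asboolP => i; rewrite (linZ (coef_linear i)).
exact: (gm_act (g := shiftGr (regGr A) i.1)).
Qed.

Definition freeGr : grMod A := GrMod free_deg_zmod free_deg_dir free_deg_act.

Lemma fgen_deg i : (fgen i : freeGr) \in gm_deg freeGr i.1.
Proof.
apply/asboolP => k; rewrite coef_gen; case: eqP => [->|_]; last first.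
  exact: (gm_0 (shiftGr (regGr A) k.1)).
change ((1 : A^o) \in @reg_deg F A (i.1 - i.1)); rewrite subrr; exact: ga_one.
Qed.

Section Map.
Variables (N : grMod A) (n : I -> N).
Hypothesis nd : forall i, n i \in gm_deg N i.1.

Definition free_map_fun (v : freeGr) : N := \sum_(i <- fsupp v) coef i v *: n i.

Lemma free_mapE (r : seq I) v : uniq r -> {subset fsupp v <= r} ->
  free_map_fun v = \sum_(i <- r) coef i v *: n i.
Proof.
move=> ur sr; symmetry; apply: big_uniq_supp => //; first exact: fsupp_uniq.
by move=> i /coef_out->; rewrite scale0r.
Qed.

Lemma free_map_linear : linear free_map_fun.
Proof.
move=> a u v; pose r := undup (fsupp (a *: u + v) ++ fsupp u ++ fsupp v).
have ur : uniq r by exact: undup_uniq.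
rewrite !(@free_mapE r) //; last 3 first.
- by move=> i iv; rewrite mem_undup !mem_cat iv !orbT.
- by move=> i iv; rewrite mem_undup !mem_cat iv !orbT.
- by move=> i iv; rewrite mem_undup !mem_cat iv.
rewrite scaler_sumr -big_split /=; apply: eq_bigr => i _.
by rewrite -[X in X *: _]/(a * coef i u + coef i v) scalerDl scalerA.
Qed.

Lemma free_map_deg j v : v \in gm_deg freeGr j -> free_map_fun v \in gm_deg N j.
Proof.
move=> /asboolP vj; apply: gm_sum => i _.
by rewrite -[j](subrK i.1); apply: reg_act; [exact: vj|exact: nd].
Qed.

Definition free_map : grHom freeGr N := GrHom free_map_linear free_map_deg.

Lemma free_map_gen i : free_map (fgen i) = n i.
Proof.
rewrite /= (@free_mapE (undup (i :: fsupp (fgen i)))) ?undup_uniq //; last first.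
  by move=> k kv; rewrite mem_undup inE kv orbT.
rewrite (bigD1_seq i) ?undup_uniq ?mem_undup ?mem_head //=.
rewrite eqxx scale1r big1 ?addr0 // => k /negbTE ki.
by rewrite ki scale0r.
Qed.

End Map.

Lemma free_projective : projective freeGr.
Proof.
move=> N N' p f psurj.
have /choice[n nP] (i : I) : exists y, y \in gm_deg N i.1 /\ p y = f (fgen i).
  have [y yE] := psurj (f (fgen i)).
  exists (gcomp i.1 y); split; first exact: gcomp_in.
  rewrite -[i.1]addr0 -(homj_comp _ _ (hom_gr p)) yE gcomp_id //.
  exact/gh_deg/fgen_deg.
exists (free_map (fun i => (nP i).1)) => v; rewrite [in RHS](free_sum v).
rewrite /= (lin_sum (gh_lin p)) (lin_sum (gh_lin f)); apply: eq_bigr => i _.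
by rewrite (linZ (gh_lin p)) (linZ (gh_lin f)) (nP i).2.
Qed.

Definition cover : grHom freeGr M := free_map (fun i => gcomp_in i.1 i.2).

Lemma cover_surj y : exists x, cover x = y.
Proof.
elim/gr_ind: y => [|u v [x <-] [y <-]|j v vj].
- by exists 0; rewrite (lin0 (gh_lin cover)).
- by exists (x + y); rewrite (linD (gh_lin cover)).
- by exists (fgen (j, v)); rewrite free_map_gen gcomp_id.
Qed.

End Free.

Lemma JM_ind M (S : M -> Prop) j : S 0 -> (forall u v, S u -> S v -> S (u + v)) ->
  (forall (k : nat) a y, (0 < k)%N -> a \in ga_deg A k -> y \in gm_deg M (j - k%:Z) ->
     S (a *: y)) ->
  forall x, x \in JM M -> x \in gm_deg M j -> S x.
Proof.
move=> S0 SD Sa x xJ xj; rewrite -(gcomp_id xj).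
(* Quantifying over the multiplier [b] makes [T] closed under scalars, although [S] is only closed
   under sums. *)
pose T : {pred M} := [pred x | `[< forall b : A, S (gcomp j (b *: x)) >]].
suff /asboolP/(_ 1) : x \in T by rewrite scale1r.
have TJ a v : a \in @Jrad F A -> S (gcomp j (a *: v)).
  move=> /asboolP aJ.
  pose T' : {pred A} := [pred a | `[< forall v : M, S (gcomp j (a *: v)) >]].
  suff /asboolP : a \in T' by exact.
  apply: aJ => [|a' [k k0 ak]].
    split=> [|c u w /asboolP uT /asboolP wT]; apply/asboolP => z.
      by rewrite scale0r gcomp0.
    rewrite scalerDl gcompD; apply: SD => //.
    by rewrite -[c *: u]mulr_algr -scalerA.
  by apply/asboolP => z; rewrite (gcomp_act _ _ ak); apply: (Sa k) => //; exact: gcomp_in.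
move: xJ => /asboolP; apply=> [|_ [a [v [aJ ->]]]].
  split=> [|c u w /asboolP uT /asboolP wT]; apply/asboolP => b.
    by rewrite scaler0 gcomp0.
  by rewrite scalerDr scalerA gcompD; exact: SD.
apply/asboolP => b; rewrite scalerA; apply: TJ.
by have [J0 Jl] := Jrad_submod A; have := Jl b a 0 aJ J0; rewrite addr0.
Qed.

Lemma mem_JM M (k : nat) (a : A) (x : M) :
  (0 < k)%N -> a \in ga_deg A k -> a *: x \in JM M.
Proof.
move=> k0 ak; apply: mem_lspan; exists a, x; split=> //.
by apply: mem_lspan; exists k.
Qed.

(* A projective is a summand of a free module [L], and [J^n L] lives in degrees
   that tend to infinity on each coordinate. *)
Lemma projective_bounded P (b : int) : projective P ->
  (forall j x, (j < b)%R -> x \in gm_deg P j -> x \in JM P) ->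
  forall j x, (j < b)%R -> x \in gm_deg P j -> x = 0.
Proof.
move=> projP PJ.
have [s sE] := projP _ _ (cover P) (GrHom (fun _ _ _ => erefl) (fun _ _ => id) : grHom P P) (@cover_surj P).
have main (n : nat) : forall j x i, (j < b)%R -> x \in gm_deg P j -> (j - i.1 < n%:Z)%R ->
    coef i (s x) = 0.
  elim: n => [|n IHn] j x i jb xj ji.
    have /asboolP/(_ i) := gh_deg s xj.
    rewrite -[gm_deg _ _]/(@reg_deg F A (j - i.1)).
    by case: (j - i.1) ji => // k _ /eqP.
  pose S (x : P) := coef i (s x) = 0.
  apply: (@JM_ind P S j) => //; rewrite /S.
  - by rewrite (lin0 (gh_lin s)) (lin0 (coef_linear i)).
  - move=> u v; rewrite (linD (gh_lin s)) (linD (coef_linear i)) => -> ->.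
    exact: addr0.
  - move=> k a y k0 ak yj.
    rewrite (linZ (gh_lin s)) (linZ (coef_linear i)) (IHn (j - k%:Z)) ?scaler0 //.
      by apply: le_lt_trans jb; rewrite lerBlDr lerDl.
    rewrite addrAC ltrBlDr; apply: (lt_le_trans ji).
    by rewrite -PoszD lez_nat -addn1 leq_add2l.
  - exact: PJ jb xj.
move=> j x jb xj.
suff sx0 : s x = 0 by have := sE x; rewrite sx0 (lin0 (gh_lin (cover P))) => /esym.
apply: coef_ext => i; rewrite (lin0 (coef_linear i)).
apply: (main `|j - i.1|.+1 j) => //.
by rewrite -addn1 PoszD ltzD1 lez_abs.
Qed.

Lemma resolution_exists M : inhabited (resolution M).
Proof.
pose syz := fix syz n : grMod A := if n is n'.+1 then kerGr (cover (syz n')) else M.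
have [dif difE] : exists dif : forall n, grHom (freeGr (syz n.+1)) (freeGr (syz n)),
    forall n x, dif n x = lsub_val (cover (syz n.+1) x).
  have h n : {f : grHom (freeGr (syz n.+1)) (freeGr (syz n)) |
      forall x, f x = lsub_val (cover (syz n.+1) x)}.
    by apply: cid; exact: (gr_comp (cover (syz n.+1)) (subval _)).
  by exists (fun n => sval (h n)) => n; exact: (svalP (h n)).
constructor; apply: (@Resolution F A M (fun n => freeGr (syz n)) dif (cover M)).
- by move=> n; exact: free_projective.
- exact: cover_surj.
- move=> x; split=> [x0|[y ->]].
    have xK : x \in Submod (ker_submod (cover M)) by rewrite inE x0.
    by have [y yE] := cover_surj (LSub xK : syz 1); exists y; rewrite difE yE.
  by rewrite difE; have := lsub_valP (cover (syz 1) y); rewrite inE => /eqP.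
- move=> n x; split=> [|[y ->]].
    rewrite difE => x0.
    have xK : x \in Submod (ker_submod (cover (syz n.+1))).
      by rewrite inE; apply/eqP; apply: val_inj.
    by have [y yE] := cover_surj (LSub xK : syz n.+2); exists y; rewrite difE yE.
  rewrite !difE; have := lsub_valP (cover (syz n.+2) y); rewrite inE => /eqP->.
  by [].
Qed.

End FreeModules.

(** * Finite dimension *)

Section FiniteDimension.
Variable F : fieldType.
Implicit Types V W : lmodType F.

Definition span_seq V (s : seq V) : {pred V} := lspan (fun v => v \in s).

Lemma lspan_min V (G : V -> Prop) (S : {pred V}) : submod_closed S ->
  (forall g, G g -> g \in S) -> forall x, x \in lspan G -> x \in S.
Proof. by move=> Scl GS x /asboolP; apply. Qed.

Lemma lspanD V (G : V -> Prop) u v : u \in lspan G -> v \in lspan G -> u + v \in lspan G.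
Proof.
by case: (lspan_submod G) => _ h uG vG; rewrite -[u]scale1r; exact: h.
Qed.

Lemma lspan0 V (G : V -> Prop) : 0 \in lspan G.
Proof. by case: (lspan_submod G). Qed.

Lemma lspanZ V (G : V -> Prop) a u : u \in lspan G -> a *: u \in lspan G.
Proof.
by case: (lspan_submod G) => h0 h uG; rewrite -[_ *: _]addr0; exact: h.
Qed.

Lemma lspan_sum V (G : V -> Prop) (I : Type) (r : seq I) (P : pred I) (f : I -> V) :
  (forall i, P i -> f i \in lspan G) -> \sum_(i <- r | P i) f i \in lspan G.
Proof.
by move=> fG; apply: (big_ind (fun x => x \in lspan G)) => //; [exact: lspan0|exact: lspanD].
Qed.

Lemma lspan_sub V (G H : V -> Prop) : (forall x, G x -> x \in lspan H) ->
  forall x, x \in lspan G -> x \in lspan H.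
Proof. by move=> GH; apply: lspan_min => //; exact: lspan_submod. Qed.

Lemma span_seq_coef V (s : seq V) x : x \in span_seq s ->
  exists c : 'I_(size s) -> F, x = \sum_i c i *: s`_i.
Proof.
move=> xs; apply/asboolP; move: x xs.
apply: (@lspan_min V _ [pred x | `[< exists c : 'I_(size s) -> F, x = \sum_i c i *: s`_i >]]).
  split=> [|a u v /asboolP[c ->] /asboolP[c' ->]]; apply/asboolP.
    by exists (fun=> 0); rewrite big1 // => i _; rewrite scale0r.
  exists (fun i => a * c i + c' i); rewrite scaler_sumr -big_split /=.
  by apply: eq_bigr => i _; rewrite scalerDl scalerA.
move=> g gs; apply/asboolP; move: (gs); rewrite -index_mem => gi.
exists (fun i => (i == Ordinal gi)%:R).
rewrite (bigD1 (Ordinal gi)) //= eqxx scale1r nth_index // big1 ?addr0 // => i /negbTE->.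
by rewrite scale0r.
Qed.

(** The spanning list need not lie in [X], which makes this monotone in [X]; [fdim_basis] moves the
    list inside when [X] is a subspace. *)
Definition fdim V (X : V -> Prop) : Prop :=
  exists s : seq V, forall x, X x -> x \in span_seq s.

Definition lclosed V (X : V -> Prop) : Prop :=
  X 0 /\ forall a u v, X u -> X v -> X (a *: u + v).

Lemma fdim_sub V (X Y : V -> Prop) : (forall x, X x -> Y x) -> fdim Y -> fdim X.
Proof. by move=> XY [s sY]; exists s => x /XY/sY. Qed.

Lemma fdim_lspan V (X : V -> Prop) : fdim X -> fdim (fun x => x \in lspan X).
Proof. by move=> [s sX]; exists s; apply: lspan_sub. Qed.

Lemma fdim_image V W (f : V -> W) (X : V -> Prop) : linear f -> fdim X ->
  fdim (fun y => exists2 x, X x & y = f x).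
Proof.
move=> lf [s sX]; exists (map f s) => _ [x /sX xs ->].
apply/asboolP => T [T0 Tl] sT.
move: x xs; apply: (@lspan_min V _ [pred x | f x \in T]).
  by split=> [|a u v uT vT]; rewrite inE ?(lin0 lf) ?lf //; exact: Tl.
by move=> g gs; apply: sT; exact: map_f.
Qed.

Lemma fdim_cup V (X Y : V -> Prop) : fdim X -> fdim Y ->
  fdim (fun z => exists x y, [/\ X x, Y y & z = x + y]).
Proof.
move=> [s sX] [t tY]; exists (s ++ t) => _ [x [y [/sX xs /tY yt ->]]].
by apply: lspanD; [move: x xs|move: y yt]; apply: lspan_sub => g gs;
  apply: mem_lspan; rewrite mem_cat gs ?orbT.
Qed.

Lemma fdim_bigcup V (n : nat) (X : nat -> V -> Prop) :
  (forall i, (i < n)%N -> fdim (X i)) -> fdim (fun x => exists2 i, (i < n)%N & X i x).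
Proof.
elim: n => [|n IHn] Xf; first by exists [::] => x [].
have [|s sX] := IHn; first by move=> i /ltnW; exact: Xf.
have [t tX] := Xf n (leqnn _).
exists (s ++ t) => x [i]; rewrite ltnS leq_eqVlt => /orP[/eqP->|ii] xX.
  by move/tX: xX; move: x; apply: lspan_sub => g gs; apply: mem_lspan; rewrite mem_cat gs orbT.
have : exists2 i, (i < n)%N & X i x by exists i.
by move/sX; move: x {xX}; apply: lspan_sub => g gs; apply: mem_lspan; rewrite mem_cat gs.
Qed.

Definition lfree V n (b : 'I_n -> V) : Prop :=
  forall c : 'I_n -> F, \sum_i c i *: b i = 0 -> forall i, c i = 0.

(** If p exceeded the length of [s], the p-row coefficient matrix would have a nonzero left kernel,
    that is, a linear relation among the [u i]. *)
Lemma steinitz V (s : seq V) p (u : 'I_p -> V) : (forall i, u i \in span_seq s) ->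
  lfree u -> (p <= size s)%N.
Proof.
move=> us fu; rewrite leqNgt; apply/negP => sp.
have [c cP] := choice (fun i => span_seq_coef (us i)).
pose M : 'M[F]_(p, size s) := \matrix_(i, j) c i j.
have : kermx M != 0.
  rewrite -mxrank_eq0 mxrank_ker -lt0n subn_gt0.
  exact: leq_ltn_trans (rank_leq_col M) sp.
case/rowV0Pn => v /sub_kermxP vM /eqP []; apply/rowP => i; rewrite mxE.
apply: (fu (fun i => v 0 i)).
transitivity (\sum_(k < p) \sum_j (v 0 k * c k j) *: s`_j).
  apply: eq_bigr => k _; rewrite {1}(cP k) scaler_sumr.
  by apply: eq_bigr => j _; rewrite scalerA.
rewrite exchange_big big1 //= => j _; rewrite -scaler_suml.
have := congr1 (fun N : 'rV_(size s) => N 0 j) vM; rewrite !mxE => vj.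
rewrite (_ : \sum_k _ = 0) ?scale0r // -[RHS]vj.
by apply: eq_bigr => k _; rewrite mxE.
Qed.

(** Steinitz bounds the length of independent families in [X], so a longest one exists; a vector
    outside its span would extend it. *)
Lemma lfree_basis V (X : V -> Prop) : lclosed X -> fdim X ->
  exists n (b : 'I_n -> V), [/\ forall i, X (b i), lfree b
    & forall x, X x -> exists c : 'I_n -> F, x = \sum_i c i *: b i].
Proof.
move=> [X0 Xl] [s sX].
pose P n := `[< exists b : 'I_n -> V, (forall i, X (b i)) /\ lfree b >].
have exP : exists n, P n.
  by exists 0%N; apply/asboolP; exists (fun=> 0); split=> [i|c _ i]; case: i.
have ubP n : P n -> (n <= size s)%N.
  rewrite /P => /asboolP[b [bX fb]]; apply: (steinitz _ fb) => i; exact: sX.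
case: (ex_maxnP exP ubP) => n /asboolP[b [bX fb]] nmax.
exists n, b; split=> // x xX; apply: contrapT => nx.
suff : P n.+1 by move/nmax; rewrite ltnn.
apply/asboolP; exists (fun i => oapp b x (unlift ord0 i)); split=> [i|c].
  by case: (unlift ord0 i) => [j|] /=.
rewrite big_ord_recl unlift_none /= => c0.
have cE : c ord0 *: x = - \sum_(i < n) c (lift ord0 i) *: b i.
  apply/eqP; rewrite -subr_eq0 opprK; apply/eqP; rewrite -[RHS]c0; congr (_ + _).
  by apply: eq_bigr => i _; rewrite liftK.
have c00 : c ord0 = 0.
  apply/eqP; apply: contrapT => /negP cn; apply: nx.
  exists (fun i => - ((c ord0)^-1 * c (lift ord0 i))).
  transitivity ((c ord0)^-1 *: (c ord0 *: x)); first by rewrite scalerA mulVf ?scale1r.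
  rewrite cE scalerN scaler_sumr -sumrN; apply: eq_bigr => i _.
  by rewrite scalerA scaleNr.
have cl : forall i, c (lift ord0 i) = 0.
  apply: fb; apply: oppr_inj; by rewrite -cE c00 scale0r oppr0.
by move=> i; case: (unliftP ord0 i) => [j|] ->.
Qed.

Lemma fdim_basis V (X : V -> Prop) : lclosed X -> fdim X ->
  exists2 s : seq V, forall x, x \in s -> X x & forall x, X x -> x \in span_seq s.
Proof.
move=> Xl /(lfree_basis Xl)[n [b [bX _ bE]]].
exists [seq b i | i <- enum 'I_n] => [x /mapP[i _ ->] //|x /bE[c ->]].
apply: lspan_sum => i _; apply: lspanZ; apply: mem_lspan.
by apply: map_f; rewrite mem_enum.
Qed.

Lemma fdim_ext V W (f : V -> W) (X : V -> Prop) : linear f -> lclosed X ->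
  fdim (fun y => exists2 x, X x & y = f x) -> fdim (fun x => X x /\ f x = 0) -> fdim X.
Proof.
move=> lf [X0 Xl] imf kerf.
have [|s sX sE] := fdim_basis _ imf.
  split=> [|a _ _ [u uX ->] [v vX ->]]; first by exists 0; rewrite ?(lin0 lf).
  by exists (a *: u + v); [exact: Xl|rewrite lf].
have [t tE] := kerf.
have /choice[g gP] y : exists x, y \in s -> X x /\ f x = y.
  have [/sX[x xX ->]|_] := boolP (y \in s); last by exists 0.
  by exists x.
pose S : {pred W} := [pred y | `[< exists x, [/\ X x, x \in span_seq (map g s) & f x = y] >]].
have sS y : y \in span_seq s -> y \in S.
  apply: lspan_min => [|z zs]; last first.
    apply/asboolP; exists (g z); have [gX gE] := gP _ zs; split=> //.
    by apply: mem_lspan; exact: map_f.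
  split=> [|a u v /asboolP[u' [uX us <-]] /asboolP[v' [vX vs <-]]]; apply/asboolP.
    by exists 0; rewrite lspan0 (lin0 lf).
  by exists (a *: u' + v'); rewrite lf lspanD ?lspanZ //; split=> //; exact: Xl.
exists (map g s ++ t) => x xX.
have /asboolP[x' [x'X x's fx]] : f x \in S by apply/sS/sE; exists x.
rewrite -[x](subrK x') addrC; apply: lspanD.
  by move: x' x's {x'X fx}; apply: lspan_sub => v vs; apply: mem_lspan; rewrite mem_cat vs.
have : x - x' \in span_seq t.
  apply: tE; split; last by rewrite (linB lf) fx subrr.
  by rewrite addrC -[x']scale1r -scaleNr; exact: Xl.
by move: (x - x'); apply: lspan_sub => v vs; apply: mem_lspan; rewrite mem_cat vs orbT.
Qed.

End FiniteDimension.

(** * The algebra and its trivial module *)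

Section AlgebraComponents.
Variables (F : fieldType) (A : grAlg F).

Lemma acomp_in j (x : A) : acomp j x \in ga_deg A j.
Proof. exact: (dcomp_in (@ga_zmod F A)). Qed.

Lemma acompD j (x y : A) : acomp j (x + y) = acomp j x + acomp j y.
Proof. exact: (dcompD (@ga_zmod F A)). Qed.

Lemma acomp0 j : acomp j (0 : A) = 0.
Proof. exact: (dcomp0 (@ga_zmod F A)). Qed.

Lemma acomp_id j (x : A) : x \in ga_deg A j -> acomp j x = x.
Proof. exact: (dcomp_id (@ga_zmod F A)). Qed.

Lemma acomp_ne i j (x : A) : x \in ga_deg A i -> j != i -> acomp j x = 0.
Proof. exact: (dcomp_ne (@ga_zmod F A)). Qed.

Lemma acompZ j (c : F) (x : A) : acomp j (c *: x) = c *: acomp j x.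
Proof.
elim/ga_ind: x => [|u v IHu IHv|i v vi]; first by rewrite scaler0 acomp0 scaler0.
  by rewrite scalerDr !acompD scalerDr IHu IHv.
have cvi : c *: v \in ga_deg A i.
  by case: (ga_sub A i) => h0 hl; rewrite -[_ *: _]addr0; exact: hl.
have [->|ji] := eqVneq j i; first by rewrite !acomp_id.
by rewrite (acomp_ne cvi) // (acomp_ne vi) // scaler0.
Qed.

Fixpoint deg1_pow (i : nat) : {pred A} :=
  if i is i'.+1 then
    lspan (fun z : A => exists a w, [/\ a \in ga_deg A 1, w \in deg1_pow i' & z = a * w])
  else ga_deg A 0.

Lemma deg1_pow_submod i : submod_closed (deg1_pow i).
Proof. by case: i => [|i]; [exact: ga_sub|exact: lspan_submod]. Qed.

Let pow0 i : 0 \in deg1_pow i. Proof. by case: (deg1_pow_submod i). Qed.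
Let powD i x y : x \in deg1_pow i -> y \in deg1_pow i -> x + y \in deg1_pow i.
Proof. by case: (deg1_pow_submod i) => _ h ? ?; rewrite -[x]scale1r; exact: h. Qed.
Let powZ i c x : x \in deg1_pow i -> c *: x \in deg1_pow i.
Proof. by case: (deg1_pow_submod i) => h0 h ?; rewrite -[_ *: _]addr0; exact: h. Qed.

Lemma deg1_pow_mul0 j a b : a \in ga_deg A 0 -> b \in deg1_pow j -> a * b \in deg1_pow j.
Proof.
elim: j b => [|j _] b a0 /= bj; first exact: (@ga_mul _ A 0 0).
move: b bj; apply: (@lspan_min _ _ _ [pred b | a * b \in deg1_pow j.+1]).
  split=> [|c u v]; rewrite !inE; first by rewrite mulr0; exact: (pow0 j.+1).
  by move=> uj vj; rewrite mulrDr -scalerAr; apply: (powD (i := j.+1)) => //; exact: (powZ (i := j.+1)).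
move=> _ [x [w [x1 wj ->]]]; rewrite inE; apply: mem_lspan; exists (a * x), w.
by rewrite mulrA; split=> //; exact: (@ga_mul _ A 0 1).
Qed.

Lemma deg1_pow_mul i j a b :
  a \in deg1_pow i -> b \in deg1_pow j -> a * b \in deg1_pow (i + j).
Proof.
elim: i a => [|i IHi] a; first exact: deg1_pow_mul0.
move=> ai bj; move: a ai.
apply: (@lspan_min _ _ _ [pred a | a * b \in deg1_pow (i + j).+1]).
  split=> [|c u v]; rewrite !inE; first by rewrite mul0r; exact: (pow0 (i + j).+1).
  by move=> uj vj; rewrite mulrDl -scalerAl; apply: (powD (i := (i + j).+1)) => //; exact: (powZ (i := (i + j).+1)).
move=> _ [x [w [x1 wj ->]]]; rewrite inE -mulrA; apply: mem_lspan.
by exists x, (w * b); split=> //; exact: IHi.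
Qed.

Lemma deg1_pow_deg i x : x \in deg1_pow i -> x \in ga_deg A i.
Proof.
elim: i x => [//|i IHi]; apply: lspan_min; first exact: ga_sub.
by move=> _ [x [w [x1 /IHi wi ->]]]; exact: (@ga_mul _ A 1 i).
Qed.

Hypothesis A_gen : generated_in_degrees_01 A.

(** The elements all of whose components lie in the spans A_1...A_1 A_0 form a subalgebra containing
    A_0 and A_1, hence everything. Finite dimension of each A_i follows from that of A_0 and A_1. *)
Lemma ga_deg_pow i x : x \in ga_deg A i -> x \in deg1_pow i.
Proof.
move=> xi.
pose S : {pred A} := [pred a | `[< forall i, acomp i a \in deg1_pow i >]].
suff /asboolP/(_ i) : x \in S by rewrite acomp_id.
apply: A_gen => [|a a0|a a1].
- split.
  + apply/asboolP => k; have [->|k0] := eqVneq k 0%N.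
      by rewrite acomp_id; exact: ga_one.
    by rewrite (acomp_ne (ga_one A)).
  + move=> c u v /asboolP uS /asboolP vS; apply/asboolP => k.
    by rewrite acompD acompZ; apply: powD => //; exact: powZ.
  + move=> u v /asboolP uS /asboolP vS; apply/asboolP => k.
    rewrite (dcomp_sum (ga_dir A) u) mulr_suml /acomp (dcomp_big (@ga_zmod F A)).
    apply: (big_ind (fun x => x \in deg1_pow k)) => // [|l _]; first exact: powD.
    rewrite (dcomp_sum (ga_dir A) v) mulr_sumr (dcomp_big (@ga_zmod F A)).
    apply: (big_ind (fun x => x \in deg1_pow k)) => // [|m _]; first exact: powD.
    have h : dcomp (ga_dir A) l u * dcomp (ga_dir A) m v \in deg1_pow (l + m).
      by apply: deg1_pow_mul; [exact: uS|exact: vS].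
    have [->|klm] := eqVneq k (l + m)%N.
      by rewrite (dcomp_id (@ga_zmod F A)) //; exact: deg1_pow_deg.
    by rewrite (dcomp_ne (@ga_zmod F A) _ (deg1_pow_deg h)).
- apply/asboolP => k; have [->|k0] := eqVneq k 0%N; first by rewrite acomp_id.
  by rewrite (acomp_ne a0).
- apply/asboolP => k; have [->|k0] := eqVneq k 1%N; last by rewrite (acomp_ne a1).
  rewrite acomp_id //; apply: mem_lspan; exists a, 1; rewrite mulr1.
  by split=> //; exact: ga_one.
Qed.

Hypotheses (A0_fd : finite_dim (ga_deg A 0)) (A1_fd : finite_dim (ga_deg A 1)).

Lemma finite_dim_fdim (X : {pred A}) : finite_dim X -> fdim (fun x => x \in X).
Proof.
move=> [n [b [_ bX]]]; exists [seq b i | i <- enum 'I_n] => x /bX[c ->].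
apply: lspan_sum => i _; apply: lspanZ; apply: mem_lspan.
by apply: map_f; rewrite mem_enum.
Qed.

Lemma fdim_mul (X Y : A -> Prop) : fdim X -> fdim Y ->
  fdim (fun z : A => exists a w, [/\ X a, Y w & z = a * w]).
Proof.
move=> [s sX] [t tY]; pose r := [seq a * b | a <- s, b <- t].
exists r => _ [a [w [/sX aX /tY wY ->]]].
move: a aX; apply: (@lspan_min _ _ _ [pred a | a * w \in span_seq r]).
  split=> [|c u v]; rewrite !inE; first by rewrite mul0r; exact: lspan0.
  by move=> us vs; rewrite mulrDl -scalerAl; apply: lspanD => //; exact: lspanZ.
move=> a aX; rewrite inE.
move: w wY; apply: (@lspan_min _ _ _ [pred w | a * w \in span_seq r]).
  split=> [|c u v]; rewrite !inE; first by rewrite mulr0; exact: lspan0.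
  by move=> us vs; rewrite mulrDr -scalerAr; apply: lspanD => //; exact: lspanZ.
by move=> w wY; apply: mem_lspan; exact: allpairs_f.
Qed.

Lemma ga_deg_fdim i : fdim (fun x => x \in ga_deg A i).
Proof.
apply: fdim_sub (@ga_deg_pow i) _; elim: i => [|i IHi]; first exact: finite_dim_fdim.
by apply: fdim_lspan; apply: fdim_mul => //; exact: finite_dim_fdim.
Qed.

End AlgebraComponents.

Section TrivialModule.
Variables (F : fieldType) (A : grAlg F).
Implicit Types (M N K P : grMod A).
Local Notation T := (trivial_mod A).

Definition tproj (a : A) : T := lproj (Jgr A) (a : A^o).

Lemma tprojD a b : tproj (a + b) = tproj a + tproj b.
Proof. exact: lprojD. Qed.

Lemma tproj_scale a b : a *: tproj b = tproj (a * b).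
Proof. by rewrite /tproj -(linZ (lproj_linear (Jgr A))). Qed.

Lemma tproj_surj t : exists a, t = tproj a.
Proof. by have [v ->] := @lproj_surj _ _ (Jgr A) t; exists v. Qed.

Lemma tproj_eq a b : tproj a = tproj b <-> a - b \in @Jrad F A.
Proof. exact: (@lproj_eq _ _ (Jgr A)). Qed.

Lemma tproj0 : tproj 0 = 0.
Proof. exact: (lin0 (lproj_linear (Jgr A))). Qed.

Lemma tproj_eq0 a : tproj a = 0 <-> a \in @Jrad F A.
Proof. by rewrite -tproj0; split=> [/tproj_eq|aJ]; [|apply/tproj_eq]; rewrite subr0. Qed.

Lemma JradD (a b : A) : a \in @Jrad F A -> b \in @Jrad F A -> a + b \in @Jrad F A.
Proof.
by have [J0 Jl] := Jrad_submod A => aJ bJ; rewrite -[a]mul1r; exact: (Jl 1 a b).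
Qed.

Lemma Jrad_deg (k : nat) (a : A) : (0 < k)%N -> a \in ga_deg A k -> a \in @Jrad F A.
Proof. by move=> k0 ak; apply: mem_lspan; exists k. Qed.

Lemma Jrad_comp0 (a : A) : a \in @Jrad F A -> acomp 0 a = 0.
Proof.
move=> aJ; apply/eqP; move: a aJ.
apply: (@lspan_min _ _ _ [pred a | acomp 0 a == 0]).
  split=> [|c u v]; rewrite !inE; first by rewrite acomp0.
  by move=> /eqP u0 /eqP v0; rewrite acompD acompZ u0 v0 scaler0 addr0.
by move=> g [i i0 gi]; rewrite inE (acomp_ne gi) // eq_sym -lt0n.
Qed.

Lemma Jrad_deg0 (a : A) : a \in @Jrad F A -> a \in ga_deg A 0 -> a = 0.
Proof. by move=> /Jrad_comp0 + a0; rewrite acomp_id. Qed.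

Lemma sub_comp0_Jrad (a : A) : a - acomp 0 a \in @Jrad F A.
Proof.
elim/ga_ind: a => [|u v uJ vJ|i v vi].
- by rewrite acomp0 subr0; case: (Jrad_submod A).
- by rewrite acompD opprD addrACA; exact: JradD.
- case: i vi => [|i] vi; first by rewrite acomp_id // subrr; case: (Jrad_submod A).
  by rewrite (acomp_ne vi) // subr0; exact: (Jrad_deg _ vi).
Qed.

Lemma tproj_surj0 t : exists2 a, a \in ga_deg A 0 & t = tproj a.
Proof.
have [a ->] := tproj_surj t; exists (acomp 0 a); first exact: acomp_in.
by apply/tproj_eq; exact: sub_comp0_Jrad.
Qed.

Lemma tproj_deg (a : A) : a \in ga_deg A 0 -> tproj a \in gm_deg T 0.
Proof. by move=> a0; apply/asboolP; exists a. Qed.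

Lemma trivial_deg0 (t : T) : t \in gm_deg T 0.
Proof. by have [a a0 ->] := tproj_surj0 t; exact: tproj_deg. Qed.

Lemma trivial_deg (t : T) j : t \in gm_deg T j -> j != 0 -> t = 0.
Proof. by move=> tj j0; apply: (gm_uniq tj (trivial_deg0 t)). Qed.

Lemma Jrad_trivial (a : A) (t : T) : a \in @Jrad F A -> a *: t = 0.
Proof.
have [b ->] := tproj_surj t => aJ; rewrite tproj_scale; apply/tproj_eq0.
exact: Jrad_mulr.
Qed.

Lemma hom_JM M o (f : M -> T) x : ghom o f -> x \in JM M -> f x = 0.
Proof.
move=> fh /asboolP xJ; have lf := hom_linear fh; apply/eqP.
apply: (xJ [pred x | f x == 0]) => [|_ [a [v [aJ ->]]]].
  split=> [|a u v]; rewrite !inE ?(lin0 lf) // => /eqP u0 /eqP v0.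
  by rewrite lf u0 v0 scaler0 addr0.
by rewrite inE (linZ lf) Jrad_trivial.
Qed.

Lemma homj_trivial_ne M j i (f : M -> T) x : ghom (Some j) f ->
  x \in gm_deg M i -> i != j -> f x = 0.
Proof.
by move=> /homjP[_ df] xi ij; apply: trivial_deg (df _ _ xi) _; rewrite subr_eq0.
Qed.

Lemma generated_hom0 M (S : seq nat) (j : int) (f : M -> T) : generated_in M S ->
  (forall s, s \in S -> j != s%:Z) -> ghom (Some j) f -> forall x, f x = 0.
Proof.
move=> Mgen jS fh x; have lf := hom_linear fh; apply/eqP.
apply: (Mgen [pred x | f x == 0]) => [|s y sS ys].
  split=> [|a u v]; rewrite !inE ?(lin0 lf) // => /eqP u0 /eqP v0.
  by rewrite lf u0 v0 scaler0 addr0.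
by rewrite inE (homj_trivial_ne fh ys) // eq_sym jS.
Qed.

(** Graded Nakayama: in a degree outside [S] every element is a sum of products with factors of
    lower degree, and the induction over degrees stops because M has no negative part. *)
Lemma generated_in_bounded M (S : seq nat) :
  (forall j x, (j < 0)%R -> x \in gm_deg M j -> x = 0) ->
  (forall j x, x \in gm_deg M j -> (forall s, s \in S -> j != s%:Z) -> x \in JM M) ->
  generated_in M S.
Proof.
move=> M0 MJ N [N0 Nl] NS.
have ND u v : u \in N -> v \in N -> u + v \in N.
  by move=> uN vN; rewrite -[u]scale1r; exact: Nl.
have main (n : nat) j x : (j < n%:Z)%R -> x \in gm_deg M j -> x \in N.
  elim: n j x => [|n IHn] j x jn xj; first by rewrite (M0 _ _ jn xj).
  have [/hasP[s sS /eqP js]|/hasPn jS] := boolP (has (fun s : nat => j == s%:Z) S).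
    by apply: (NS s) => //; rewrite -js.
  apply: (@JM_ind _ _ M (fun x => x \in N) j) => //.
    move=> k a y k0 ak yj; rewrite -[_ *: _]addr0; apply: Nl => //.
    apply: (IHn (j - k%:Z)) => //.
    by rewrite ltrBlDr; apply: (lt_le_trans jn); rewrite -PoszD lez_nat -addn1 leq_add2l.
  by apply: (MJ j).
elim/gr_ind => // j x xj; apply: (main `|j|.+1 j) => //.
by rewrite -addn1 PoszD ltzD1 lez_abs.
Qed.

End TrivialModule.

(** * Semisimplicity and local finiteness *)

Section Semisimple.
Variables (F : fieldType) (A : grAlg F).
Implicit Types (M N K P : grMod A).
Local Notation T := (trivial_mod A).
Hypothesis A0_ss : semisimple0 A.

Lemma ga0_0 : 0 \in ga_deg A 0. Proof. by case: (ga_sub A 0). Qed.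

Lemma ga0_D a b : a \in ga_deg A 0 -> b \in ga_deg A 0 -> a + b \in ga_deg A 0.
Proof. by case: (ga_sub A 0) => _ h a0 b0; rewrite -[a]scale1r; exact: h. Qed.

Lemma ga0_N a : a \in ga_deg A 0 -> - a \in ga_deg A 0.
Proof.
by case: (ga_sub A 0) => h0 h a0; rewrite -[- a]addr0 -scaleN1r; exact: h.
Qed.

Lemma ga0_B a b : a \in ga_deg A 0 -> b \in ga_deg A 0 -> a - b \in ga_deg A 0.
Proof. by move=> a0 b0; rewrite ga0_D ?ga0_N. Qed.

Lemma ga0_M a b : a \in ga_deg A 0 -> b \in ga_deg A 0 -> a * b \in ga_deg A 0.
Proof. exact: (@ga_mul _ A 0 0). Qed.

(** Write 1 = e + z along a complement of I. For a in I the element a - a e = a z lies in both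
    summands, hence is 0. *)
Lemma left_ideal_idem (I : {pred A}) : left_ideal0 I ->
  exists2 e, e \in I & forall a, a \in I -> a = a * e.
Proof.
move=> II; have [I0 [[I0sub _ I0D I0M] [I0E I0d]]] := A0_ss II.
have [Isub _ ID IM] := II.
have [e [z [eI zI E]]] := I0E 1 (ga_one A); exists e => // a aI.
apply/eqP; rewrite -subr_eq0; apply/eqP; apply: I0d.
  apply: ID => //; rewrite -mulN1r; apply: (IM); first by rewrite ga0_N ?ga_one.
  by apply: IM => //; exact: Isub.
rewrite -[X in X - _]mulr1 -mulrBr (_ : 1 - e = z); last by rewrite E addrAC subrr add0r.
by apply: I0M => //; exact: Isub.
Qed.

Section DualBasis.
Variable M : grMod A.

Fixpoint Aspan (s : seq M) (x : M) : Prop :=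
  if s is g :: s' then exists2 a, a \in ga_deg A 0 & Aspan s' (x - a *: g) else x = 0.

Lemma Aspan0 s : Aspan s 0.
Proof.
by elim: s => //= g s IHs; exists 0; rewrite ?ga0_0 // scale0r subr0.
Qed.

Lemma AspanD s x y : Aspan s x -> Aspan s y -> Aspan s (x + y).
Proof.
elim: s x y => [|g s IHs] x y /=; first by move=> -> ->; rewrite addr0.
move=> [a a0 xs] [b b0 ys]; exists (a + b); first exact: ga0_D.
by rewrite scalerDl opprD addrACA; exact: IHs.
Qed.

Lemma AspanZ s a x : a \in ga_deg A 0 -> Aspan s x -> Aspan s (a *: x).
Proof.
move=> a0; elim: s x => [|g s IHs] x /=; first by move=> ->; rewrite scaler0.
move=> [b b0 xs]; exists (a * b); first exact: ga0_M.
by rewrite -scalerA -scalerBr; exact: IHs.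
Qed.

Lemma AspanN s x : Aspan s x -> Aspan s (- x).
Proof. by move=> xs; rewrite -scaleN1r; apply: AspanZ => //; rewrite ga0_N ?ga_one. Qed.

Lemma AspanB s x y : Aspan s x -> Aspan s y -> Aspan s (x - y).
Proof. by move=> xs ys; apply: AspanD => //; exact: AspanN. Qed.

Lemma Aspan_cons g s x : Aspan s x -> Aspan (g :: s) x.
Proof. by move=> xs; exists 0; rewrite ?ga0_0 // scale0r subr0. Qed.

Lemma Aspan_mem g s : g \in s -> Aspan s g.
Proof.
elim: s => //= h s IHs; rewrite inE => /orP[/eqP->|/IHs gs].
  by exists 1; rewrite ?ga_one // scale1r subrr; exact: Aspan0.
exact: Aspan_cons.
Qed.

(** Finitely generated modules over the semisimple ring A_0 are projective; this is the dual basis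
    form of that fact. The list may be redundant, so coordinates have to be chosen in a linear
    way. *)
Lemma Aspan_dual (s : seq M) : exists y : nat -> M -> A,
  [/\ forall i x, Aspan s x -> y i x \in ga_deg A 0,
      forall i x x', Aspan s x -> Aspan s x' -> y i (x + x') = y i x + y i x',
      forall i a x, a \in ga_deg A 0 -> Aspan s x -> y i (a *: x) = a * y i x
    & forall x, Aspan s x -> x = \sum_(i < size s) y i x *: s`_i].
Proof.
elim: s => [|g s [y [y0 yD yZ yE]]].
  exists (fun _ _ => 0); split=> /=.
  - by move=> *; exact: ga0_0.
  - by move=> *; rewrite addr0.
  - by move=> *; rewrite mulr0.
  - by move=> x ->; rewrite big_ord0.
(* The coefficient of [g] in an element of the span is determined exactly up to this left ideal. *)
pose I : {pred A} := [pred a | (a \in ga_deg A 0) && `[< Aspan s (a *: g) >]].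
have II : left_ideal0 I.
  split.
  - by move=> a /andP[].
  - by rewrite inE ga0_0; apply/asboolP; rewrite scale0r; exact: Aspan0.
  - move=> a b /andP[a0 /asboolP aI] /andP[b0 /asboolP bI].
    by rewrite inE ga0_D //; apply/asboolP; rewrite scalerDl; exact: AspanD.
  - move=> a b a0 /andP[b0 /asboolP bI].
    by rewrite inE ga0_M //; apply/asboolP; rewrite -scalerA; exact: AspanZ.
have [e /andP[e0 /asboolP eI] eP] := left_ideal_idem II.
have /choice[al alP] x : exists a, Aspan (g :: s) x ->
    a \in ga_deg A 0 /\ Aspan s (x - a *: g).
  have [[a a0 xs]|nx] := pselect (Aspan (g :: s) x); first by exists a.
  by exists 0.
(* Elements of I satisfy a = a e, so a - a e depends only on the class of a modulo I: an arbitrary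
   choice [al] becomes well defined and A_0-linear. *)
pose Y x := al x - al x * e.
have Y0 x : Aspan (g :: s) x -> Y x \in ga_deg A 0.
  by move=> /alP[a0 _]; rewrite ga0_B ?ga0_M.
have Yuniq x a : a \in ga_deg A 0 -> Aspan s (x - a *: g) -> Y x = a - a * e.
  move=> a0 xa; have xs : Aspan (g :: s) x by exists a.
  have [b0 xb] := alP _ xs.
  have abI : al x - a \in I.
    rewrite inE ga0_B //; apply/asboolP.
    rewrite scalerBl (_ : _ - _ = (x - a *: g) - (x - al x *: g)); first exact: AspanB.
    by rewrite opprB [RHS]addrC addrA subrK.
  apply/eqP; rewrite -subr_eq0 /Y; have /eqP := eP _ abI; rewrite -subr_eq0.
  suff -> : al x - al x * e - (a - a * e) = al x - a - (al x - a) * e by [].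
  by rewrite mulrBl !opprD !opprK addrACA.
have YD x x' : Aspan (g :: s) x -> Aspan (g :: s) x' -> Y (x + x') = Y x + Y x'.
  move=> /alP[a0 xa] /alP[a'0 x'a]; rewrite (@Yuniq _ (al x + al x')) ?ga0_D //.
    by rewrite mulrDl opprD addrACA.
  by rewrite scalerDl opprD addrACA; exact: AspanD.
have YZ a x : a \in ga_deg A 0 -> Aspan (g :: s) x -> Y (a *: x) = a * Y x.
  move=> a0 /alP[b0 xb]; rewrite (@Yuniq _ (a * al x)) ?ga0_M //.
    by rewrite mulrBr mulrA.
  by rewrite -scalerA -scalerBr; exact: AspanZ.
have Ys x : Aspan (g :: s) x -> Aspan s (x - Y x *: g).
  move=> /alP[a0 xa]; rewrite /Y scalerBl opprB addrCA addrC.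
  by apply: AspanD => //; rewrite -scalerA; exact: AspanZ.
exists (fun i => if i is i'.+1 then fun x => y i' (x - Y x *: g) else Y); split.
- by case=> [|i] x xs; [exact: Y0|apply: y0; exact: Ys].
- case=> [|i] x x' xs xs'; first exact: YD.
  rewrite -yD; [|exact: Ys|exact: Ys]; congr (y i _).
  by rewrite YD // scalerDl opprD addrACA.
- case=> [|i] a x a0 xs; first exact: YZ.
  rewrite -yZ //; last exact: Ys.
  by rewrite YZ // scalerBr scalerA.
- move=> x xs; rewrite big_ord_recl /=.
  by rewrite -(yE _ (Ys _ xs)) addrC subrK.
Qed.

(** The A_0-linear coordinates on degree c, composed with A_0 = A/J and extended by zero, are
    A-linear because no element of positive degree acts nontrivially into degree c. *)
Lemma dual_basis (c : int) : fdim (V := resF M) (fun x => x \in gm_deg M c) ->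
  (forall (k : nat) a x, (0 < k)%N -> a \in ga_deg A k -> x \in gm_deg M (c - k%:Z) ->
     a *: x = 0) ->
  exists n (g : 'I_n -> M) (y : 'I_n -> M -> T),
    [/\ forall l, g l \in gm_deg M c, forall l, ghom (Some c) (y l)
      & forall x, x \in gm_deg M c -> exists al : 'I_n -> A,
          (forall l, al l \in ga_deg A 0 /\ y l x = tproj (al l)) /\
          x = \sum_l al l *: g l].
Proof.
move=> Mc_fd Mc_top.
have [|s sM sE] := fdim_basis _ Mc_fd.
  split=> [|a u v uc vc]; first exact: gm_0.
  by apply: gm_D => //; apply: gm_Z0 => //; exact: alg_deg0.
have Ms x : x \in gm_deg M c -> Aspan s x.
  move=> /sE xs; apply/asboolP; move: x xs.
  apply: (@lspan_min _ (resF M) _ [pred x | `[< Aspan s x >]]).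
    split=> [|a u v /asboolP us /asboolP vs]; apply/asboolP; first exact: Aspan0.
    by apply: AspanD => //; apply: AspanZ => //; exact: alg_deg0.
  by move=> g gs; apply/asboolP; exact: Aspan_mem.
have [y [y0 yD yZ yE]] := Aspan_dual s.
have yc i x : y i (gcomp c x) \in ga_deg A 0 by apply: y0; apply: Ms; exact: gcomp_in.
have y00 i : y i 0 = 0.
  by have := yZ i 0 0 ga0_0 (Aspan0 s); rewrite scaler0 mul0r.
have yh i : ghom (Some c) (fun x : M => tproj (y i (gcomp c x)) : T).
  apply/homjP; split=> [a u v|j x xj]; last first.
    have [->|jc] := eqVneq j c; first by rewrite subrr; exact: tproj_deg.
    by rewrite (gcomp_ne xj) 1?eq_sym // y00 tproj0 gm_0.
  rewrite gcompD yD; [|by apply: Ms; exact: gcomp_in..].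
  rewrite tprojD; congr (_ + _); elim/ga_ind: a => [|a b IHa IHb|k a ak].
  - by rewrite !scale0r gcomp0 y00 tproj0.
  - by rewrite !scalerDl gcompD yD ?tprojD ?IHa ?IHb //; apply: Ms; exact: gcomp_in.
  rewrite (gcomp_act _ _ ak) tproj_scale; case: k ak => [|k] ak.
    by rewrite subr0 yZ //; apply: Ms; exact: gcomp_in.
  rewrite (Mc_top k.+1) ?gcomp_in // y00 tproj0; symmetry; apply/tproj_eq0.
  by apply: Jrad_mulr; exact: (Jrad_deg _ ak).
exists (size s), (fun l => s`_l), (fun l x => tproj (y l (gcomp c x))); split=> //.
  by move=> l; apply: sM; exact: mem_nth.
move=> x xc; exists (fun l => y l x); split=> [l|]; last by apply: yE; exact: Ms.
by rewrite gcomp_id //; split=> //; apply: y0; exact: Ms.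
Qed.

End DualBasis.

(** J acts as zero on M/JM, so [dual_basis] applies there in every degree; an element all of whose
    coordinates vanish is 0 in M/JM. *)
Lemma detect_JM M (j : int) x : fdim (V := resF M) (fun x => x \in gm_deg M j) ->
  x \in gm_deg M j -> (forall y : M -> T, ghom (Some j) y -> y x = 0) -> x \in JM M.
Proof.
move=> Mj_fd xj y0.
have [||n [g [y [gj yh yE]]]] := @dual_basis (quoGr (JM M)) j.
- apply: fdim_sub (fdim_image (V := resF M) (W := resF (quoGr (JM M))) (f := lproj (JM M)) _ Mj_fd).
    by move=> q /asboolP.
  by move=> c u v; exact: (lproj_linear (JM M)).
- move=> k a q k0 ak _; have [v ->] := lproj_surj q.
  rewrite -(linZ (lproj_linear (JM M))) -[RHS](lin0 (lproj_linear (JM M))).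
  by apply/lproj_eq; rewrite subr0; exact: (mem_JM _ k0 ak).
have [al [alP alE]] := yE (lproj (JM M) x) (lproj_deg (JM M) xj).
suff : lproj (JM M) x = 0.
  by rewrite -(lin0 (lproj_linear (JM M))) => /lproj_eq; rewrite subr0.
rewrite alE big1 // => l _; have [al0 alT] := alP l.
rewrite (Jrad_deg0 (a := al l)) ?scale0r //; apply/tproj_eq0; rewrite -alT.
apply: (y0 (fun z => y l (lproj (JM M) z))).
exact: (hom_compose0l (hom_gr (quoproj (JM M))) (yh l)).
Qed.

End Semisimple.

Section LocalFiniteness.
Variables (F : fieldType) (A : grAlg F).
Implicit Types (M N K P : grMod A).
Local Notation T := (trivial_mod A).

Definition locally_fd M : Prop :=
  forall j, fdim (V := resF M) (fun x => x \in gm_deg M j).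

Hypothesis A_lfd : forall i, fdim (fun x => x \in ga_deg A i).

Lemma fdim_act M (X : A -> Prop) (Y : M -> Prop) : fdim X -> fdim (V := resF M) Y ->
  fdim (V := resF M) (fun z => exists a w, [/\ X a, Y w & z = a *: w]).
Proof.
move=> [s sX] [t tY]; pose r : seq (resF M) := [seq a *: (b : M) | a <- s, b <- t].
exists r => _ [a [w [/sX aX /tY wY ->]]].
move: a aX; apply: (@lspan_min _ _ _ [pred a | (a *: (w : M) : resF M) \in span_seq r]).
  split=> [|c u v]; rewrite !inE; first by rewrite scale0r; exact: lspan0.
  move=> us vs; rewrite scalerDl -[c *: u]mulr_algl -scalerA.
  by apply: (lspanD (V := resF M)) => //; exact: (lspanZ (V := resF M) c).
move=> a aX; rewrite inE.
move: w wY; apply: (@lspan_min _ (resF M) _ [pred w | (a *: (w : M) : resF M) \in span_seq r]).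
  split=> [|c u v]; rewrite !inE; first by rewrite scaler0; exact: lspan0.
  move=> us vs.
  have -> : a *: (c *: u + v : M) = (c%:A : A) *: (a *: (u : M)) + a *: (v : M).
    by rewrite scalerDr !scalerA mulr_algl mulr_algr.
  by apply: (lspanD (V := resF M)) => //; exact: (lspanZ (V := resF M) c).
by move=> w wY; apply: mem_lspan; exact: allpairs_f.
Qed.

Lemma gm_lclosed M j : lclosed (V := resF M) (fun x => x \in gm_deg M j).
Proof.
split=> [|a u v uj vj]; first exact: gm_0.
by apply: gm_D => //; apply: gm_Z0 => //; exact: alg_deg0.
Qed.

Lemma resF_linear M N (f : M -> N) : linear f -> linear (f : resF M -> resF N).
Proof. by move=> lf a u v; exact: lf. Qed.

Lemma trivial_lfd : locally_fd T.
Proof.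
move=> j; have [->|j0] := eqVneq j 0; last first.
  by exists [::] => t tj; rewrite (trivial_deg tj j0) lspan0.
apply: fdim_sub (fdim_image (V := A) (W := resF T) (f := @tproj F A) _ (A_lfd 0)).
  by move=> t _; have [a a0 ->] := tproj_surj0 t; exists a.
move=> c u v; rewrite tprojD -[c *: u]mulr_algl -tproj_scale; congr (_ + _).
Qed.

Lemma sub_lfd M (S : grSub M) : locally_fd M -> locally_fd (subGr S).
Proof.
move=> Mf j.
apply: (@fdim_ext F (resF (subGr S)) (resF M) (fun x => lsub_val x)) => //.
- exact: gm_lclosed.
- by apply: fdim_sub (Mf j) => y [x xj ->].
- exists [::] => x [_ x0]; rewrite (_ : x = 0) ?lspan0 //.
  by apply: val_inj; rewrite /= x0.
Qed.

(** In degree j the image of f is finite-dimensional, and the kernel lies in the sum of the products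
    A_k M_(j-k) with k > 0. Only finitely many k matter since M vanishes in negative degrees, so
    induction on j applies. *)
Lemma min_cover_lfd M N (f : grHom M N) : locally_fd N ->
  (forall j x, (j < 0)%R -> x \in gm_deg M j -> x = 0) ->
  (forall x, f x = 0 -> x \in JM M) -> locally_fd M.
Proof.
move=> Nf M0 fJ.
have main (n : nat) j : (j < n%:Z)%R -> fdim (V := resF M) (fun x => x \in gm_deg M j).
  elim: n j => [|n IHn] j jn.
    by exists [::] => x xj; rewrite (M0 _ _ jn xj) lspan0.
  apply: (@fdim_ext F (resF M) (resF N) f).
  - exact: (resF_linear (gh_lin f)).
  - exact: gm_lclosed.
  - by apply: fdim_sub (Nf j) => y [x xj ->]; exact: gh_deg.
  pose X (k : nat) (z : resF M) := exists a w, [/\ a \in ga_deg A k.+1,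
     (w : M) \in gm_deg M (j - k.+1%:Z) & z = a *: (w : M)].
  have Xf : fdim (fun z => exists2 k, (k < n)%N & X k z).
    apply: fdim_bigcup => k kn; apply: (fdim_act (M := M)) => //.
    by apply: IHn; rewrite ltrBlDr; apply: (lt_le_trans jn); rewrite -PoszD lez_nat addnS ltnS leq_addr.
  apply: fdim_sub (fdim_lspan Xf) => x [xj /fJ xJ].
  apply: (@JM_ind _ _ M (fun x => x \in lspan (V := resF M) _) j) => //.
  - exact: lspan0.
  - by move=> u v; exact: lspanD.
  - move=> [//|k] a y _ ak yj.
    have [kn|nk] := ltnP k n; first by apply: mem_lspan; exists k => //; exists a, y.
    have -> : y = 0.
      apply: (M0 _ _ _ yj); rewrite subr_lt0.
      by apply: (lt_le_trans jn); rewrite lez_nat.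
    by rewrite scaler0; exact: lspan0.
move=> j; apply: (main `|j|.+1) => //.
by rewrite -addn1 PoszD ltzD1 lez_abs.
Qed.

(** An element of negative degree is mapped to 0 by induction, hence lies in J Q_n by minimality,
    and [projective_bounded] turns this into vanishing. *)
Lemma minimal_ge0 (Q : resolution T) : minimal Q ->
  forall n j x, (j < 0)%R -> x \in gm_deg (Q n) j -> x = 0.
Proof.
move=> [min0 min]; elim=> [|n IHn] j x j0 xj.
  apply: (projective_bounded (@res_proj _ _ _ Q 0) (b := 0) _ j0 xj) => i y i0 yi.
  by apply: min0; apply: (trivial_deg (gh_deg _ yi)); rewrite lt_eqF.
apply: (projective_bounded (@res_proj _ _ _ Q n.+1) (b := 0) _ j0 xj) => i y i0 yi.
by apply: min; apply: (IHn i) => //; exact: gh_deg.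
Qed.

Lemma minimal_lfd (Q : resolution T) : minimal Q -> forall n, locally_fd (Q n).
Proof.
move=> Qmin; have [min0 min] := Qmin; elim=> [|n IHn].
  apply: (min_cover_lfd (f := res_aug Q)) => //; first exact: trivial_lfd.
  by move=> j x; exact: (minimal_ge0 Qmin).
apply: (min_cover_lfd (f := res_dif Q n)) => //; last exact: min.
by move=> j x; exact: (minimal_ge0 Qmin).
Qed.

End LocalFiniteness.

(** * Splitting off the bottom layer of a module *)

Section BottomLayer.
Variables (F : fieldType) (A : grAlg F).
Local Notation T := (trivial_mod A).
Hypothesis A0_ss : semisimple0 A.

Variables (M : grMod A) (c : int) (M' : grSub M).
Hypotheses (Mc_fd : fdim (V := resF M) (fun x => x \in gm_deg M c))
  (M_low : forall j x, (j < c)%R -> x \in gm_deg M j -> x = 0)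
  (M'_high : forall j x, (c < j)%R -> x \in gm_deg M j -> x \in M')
  (M'_low : forall x, x \in M' -> x \in gm_deg M c -> x = 0).

(** The section hypotheses say that M is its degree-c component plus M'. They hold for M' = JM when
    M is generated in degree c, and for the part of M in degrees above c when c is a lower bound of
    M; both cases are used. *)
Lemma sub_bottom_mem x : x - gcomp c x \in M'.
Proof.
elim/gr_ind: x => [|u v uM vM|j x xj].
- by rewrite gcomp0 subr0 grsub0.
- by rewrite gcompD opprD addrACA grsubD.
- have [jc|cj|jc] := ltgtP j c.
  + by rewrite (M_low jc xj) gcomp0 subr0 grsub0.
  + by rewrite (gcomp_ne xj) ?lt_eqF // subr0; exact: (M'_high cj xj).
  + by rewrite -jc gcomp_id // subrr grsub0.
Qed.

Lemma Jrad_bottom a g : g \in gm_deg M c -> a \in @Jrad F A -> a *: g \in M'.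
Proof.
move=> gc aJ; move: a aJ; apply: (@lspan_min _ _ _ [pred a | a *: g \in M']).
  split=> [|k u v uM vM]; first by rewrite inE scale0r grsub0.
  rewrite inE scalerDl; apply: grsubD => //.
  by rewrite -[k *: u]mulr_algl -scalerA; exact: grsubZ.
move=> a [k k0 ak]; rewrite inE; apply: (@M'_high (k%:Z + c)); last exact: gm_act.
by rewrite ltrDr ltz_nat.
Qed.

Lemma hom_bottom (y : M -> T) x : ghom (Some c) y -> x \in M' -> y x = 0.
Proof.
move=> yh xM'; have <- : gcomp 0 (y x) = y x by rewrite gcomp_id ?trivial_deg0.
rewrite (homj_comp _ _ yh) add0r (_ : gcomp c x = 0) ?(lin0 (hom_linear yh)) //.
by apply: M'_low; [exact: grsub_comp|exact: gcomp_in].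
Qed.

Variables (P : resolution T) (S : resolution M) (R : resolution (subGr M')).

(* The generator [1] of the trivial module is sent to the class of [g] modulo
   [M']. *)
Lemma lift_bottom g : g \in gm_deg M c -> exists2 r : P 0%N -> M, ghom (Some (- c)) r &
  forall x al, res_aug P x = tproj al -> r x - al *: g \in M'.
Proof.
move=> gc; have [al alE] := choice (fun x : P 0%N => tproj_surj (res_aug P x)).
pose f (x : P 0%N) : quoGr M' := lproj M' (al x *: g).
have fE x b : res_aug P x = tproj b -> f x = lproj M' (b *: g).
  move=> xb; apply/lproj_eq; rewrite -scalerBl; apply: Jrad_bottom => //.
  by apply/tproj_eq; rewrite -alE.
have lf : linear f.
  move=> a u v; rewrite (@fE _ (a * al u + al v)).
    by rewrite scalerDl -scalerA lproj_linear.
  by rewrite gh_linear tprojD -tproj_scale !alE.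
have fh : ghom (Some (- c)) f.
  apply/homjP; split=> // j x xj; rewrite opprK.
  have [j0|j0] := eqVneq j 0; last first.
    rewrite (@fE x 0); first by rewrite scale0r (lin0 (lproj_linear M')) gm_0.
    by rewrite tproj0; apply: trivial_deg j0; exact: gh_deg.
  have [b b0 xb] := tproj_surj0 (res_aug P x).
  rewrite (fE _ _ xb) j0 add0r; apply: lproj_deg; exact: gm_Z0.
have [x|r rh rE] := lift_hom (p := quoproj M') (@res_proj _ _ _ P 0) fh.
  by have [y ->] := lproj_surj (f x); exists y.
exists r => // x b xb; apply/lproj_eq; rewrite -[lproj _ (r x)]/(quoproj M' (r x)).
by rewrite rE; exact: fE.
Qed.

Variable iota : forall t, R t -> S t.
Hypotheses (iota_h : forall t, ghom (Some 0) (@iota t))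
  (iota_aug : forall x, res_aug S (iota x) = lsub_val (res_aug R x))
  (iota_d : forall t x, res_dif S t (iota x) = iota (res_dif R t x)).

(* Homotopy data witnessing that [S] is, up to homotopy, an extension of finitely
   many shifts of [P] by [R]: the maps [sg l] and [rho], together with the
   homotopy [theta], split the identity of [S], and [kp] is the failure of [sg]
   and [rho] to be chain maps. *)
Lemma bottom_layer_maps : exists n (y : 'I_n -> M -> T)
    (Phi : 'I_n -> forall t, S t -> P t) (sg : 'I_n -> forall t, P t -> S t)
    (kp : 'I_n -> forall t, P t.+1 -> R t) (rho : forall t, S t -> R t)
    (theta : forall t, S t -> S t.+1) (h : 'I_n -> forall t, R t -> P t.+1)
    (w : forall t, R t -> R t.+1),
  [/\ [/\ forall l, ghom (Some c) (y l), forall l t, ghom (Some c) (Phi l t),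
         forall l x, res_aug P (Phi l 0%N x) = y l (res_aug S x)
       & forall l t x, res_dif P t (Phi l t.+1 x) = Phi l t (res_dif S t x)],
     [/\ forall l t, ghom (Some (- c)) (sg l t), forall l t, ghom (Some (- c)) (kp l t),
         forall l t x, res_dif R t (kp l t.+1 x) = - kp l t (res_dif P t.+1 x)
       & forall l t x, res_dif S t (sg l t.+1 x) = sg l t (res_dif P t x) - iota (kp l t x)],
     [/\ forall t, ghom (Some 0) (rho t), forall t, ghom (Some 0) (theta t),
         forall t x, res_dif R t (rho t.+1 x) =
           rho t (res_dif S t x) + \sum_l kp l t (Phi l t.+1 x)
       & forall t x, x = \sum_l sg l t.+1 (Phi l t.+1 x) + iota (rho t.+1 x) +
           (res_dif S t.+1 (theta t.+1 x) + theta t (res_dif S t x))]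
   & [/\ forall l t, ghom (Some c) (h l t), forall t, ghom (Some 0) (w t),
         forall l t x, Phi l t.+1 (iota x) =
           res_dif P t.+1 (h l t.+1 x) + h l t (res_dif R t x)
       & forall t x, rho t.+1 (iota x) + \sum_l kp l t.+1 (h l t.+1 x) =
           x + (res_dif R t.+1 (w t.+1 x) + w t (res_dif R t x))]].
Proof.
have Mc_top k (a : A) x : (0 < k)%N -> a \in ga_deg A k -> x \in gm_deg M (c - k%:Z) ->
    a *: x = 0.
  move=> k0 _ xk; rewrite (M_low _ xk) ?scaler0 //.
  by rewrite gtrDl oppr_lt0 ltz_nat.
have [n [g [y [gc yh yE]]]] := dual_basis A0_ss Mc_fd Mc_top.
have yE' m : exists al : 'I_n -> A, (forall l, y l m = tproj (al l)) /\
    m - \sum_l al l *: g l \in M'.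
  have [al [alP alE]] := yE _ (gcomp_in c m); exists al.
  rewrite -alE; split; last exact: sub_bottom_mem.
  move=> l; rewrite -(alP l).2 -[m in LHS](subrK (gcomp c m)).
  rewrite (linD (hom_linear (yh l))) (hom_bottom (yh l)) ?add0r //.
  exact: sub_bottom_mem.
have /choice[Phi PhiP] l := res_compare S P (yh l).
have /choice[r rP] l : exists r : P 0%N -> M, ghom (Some (- c)) r /\
    forall x al, res_aug P x = tproj al -> r x - al *: g l \in M'.
  by have [r rh rE] := lift_bottom (gc l); exists r.
have [vR vRE'] := gr_comp (res_aug R) (subval M').
have vRE x : vR x = lsub_val (res_aug R x) := vRE' x.
have vR_ex : exact_at (res_dif R 0) vR.
  move=> x; rewrite -res_exact_at0 vRE; split=> [x0|->]; last by [].
  by apply: val_inj; exact: x0.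
have vR_surj m : m \in M' -> exists x, vR x = m.
  move=> mM; have [x xE] := res_surj R (LSub mM : subGr M').
  by exists x; rewrite vRE xE.
have vR_mem x : vR x \in M' by rewrite vRE; exact: lsub_valP.
have Pproj t := @res_proj _ _ _ P t; have Sproj t := @res_proj _ _ _ S t.
have Rproj t := @res_proj _ _ _ R t.
have dPh t : ghom (Some 0) (res_dif P t) := hom_gr _.
have dSh t : ghom (Some 0) (res_dif S t) := hom_gr _.
have dRh t : ghom (Some 0) (res_dif R t) := hom_gr _.
(* The map [r l] sends the generator of T to [g l] only modulo M', so on boundaries it takes values
   in M' instead of 0. Its lift [kp l] to [R] represents the connecting class of the extension. *)
have rd l x : r l (res_dif P 0 x) \in M'.
  have := (rP l).2 (res_dif P 0 x) 0; rewrite scale0r subr0; apply.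
  by rewrite res_augd tproj0.
have /choice[kp kpP] l : exists u : forall t, P t.+1 -> R t,
    [/\ forall t, ghom (Some (- c)) (u t), forall x, vR (u 0%N x) = r l (res_dif P 0 x)
      & forall t x, res_dif R t (u t.+1 x) = u t (- res_dif P t.+1 x)].
  apply: (@compare _ _ _ (fun t => P t.+1) (fun t x => - res_dif P t.+1 x) M R vR
    (fun t => res_dif R t) (fun x => r l (res_dif P 0 x))) => //.
  - by move=> t; apply: homN.
  - by move=> t x; rewrite (linN (gh_lin (res_dif P t.+1))) res_dd !oppr0.
  - exact: res_exact_at.
  - exact: (hom_compose0l (dPh 0%N) (rP l).1).
  - by move=> x; apply: vR_surj; exact: rd.
  - move=> x; rewrite (linN (gh_lin (res_dif P 0))) res_dd oppr0.
    exact: (lin0 (hom_linear (rP l).1)).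
have kph l t : ghom (Some (- c)) (kp l t) by case: (kpP l).
have kpd l t x : res_dif R t (kp l t.+1 x) = - kp l t (res_dif P t.+1 x).
  by have [_ _ ->] := kpP l; rewrite (linN (hom_linear (kph l t))).
have kp0 l x : lsub_val (res_aug R (kp l 0%N x)) = r l (res_dif P 0 x).
  by have [_ <- _] := kpP l; rewrite vRE.
have ikh l t : ghom (Some (- c)) (fun x => - iota (kp l t x)).
  by apply: homN; exact: (hom_compose0r (kph l t) (iota_h t)).
(* Because of that defect [r l] lifts to a chain map only up to the term [iota (kp l t x)]. *)
have /choice[sg sgP] l : exists u : forall t, P t -> S t,
    [/\ forall t, ghom (Some (- c)) (u t), forall x, res_aug S (u 0%N x) = r l x
      & forall t x, res_dif S t (u t.+1 x) = u t (res_dif P t x) - iota (kp l t x)].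
  apply: (@solve_chain _ _ _ P (fun t => res_dif P t) M S (res_aug S)
    (fun t => res_dif S t) (r l) (fun t x => - iota (kp l t x))) => //.
  - exact: res_dd.
  - exact: res_exact_at0.
  - exact: res_exact_at.
  - exact: (rP l).1.
  - by move=> x; exact: res_surj.
  - by move=> x; rewrite (linN (gh_lin (res_aug S))) iota_aug kp0.
  - move=> t x; rewrite (linN (gh_lin (res_dif S t))) iota_d kpd.
    by rewrite (linN (hom_linear (iota_h t))).
have sgh l t : ghom (Some (- c)) (sg l t) by case: (sgP l).
have sgd l t x : res_dif S t (sg l t.+1 x) = sg l t (res_dif P t x) - iota (kp l t x).
  by case: (sgP l).
have sg0 l x : res_aug S (sg l 0%N x) = r l x by case: (sgP l).
have Phih l t : ghom (Some c) (Phi l t) by case: (PhiP l).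
have Phid l t x : res_dif P t (Phi l t.+1 x) = Phi l t (res_dif S t x).
  by case: (PhiP l).
have Phi0 l x : res_aug P (Phi l 0%N x) = y l (res_aug S x) by case: (PhiP l).
have comp0 (X Y Z : grMod A) (f : X -> Y) (k : Y -> Z) :
    ghom (Some c) f -> ghom (Some (- c)) k -> ghom (Some 0) (fun x => k (f x)).
  by move=> fh kh; have := hom_compose fh kh; rewrite /= addrN.
have comp0' (X Y Z : grMod A) (f : X -> Y) (k : Y -> Z) :
    ghom (Some (- c)) f -> ghom (Some c) k -> ghom (Some 0) (fun x => k (f x)).
  by move=> fh kh; have := hom_compose fh kh; rewrite /= addNr.
(* By the dual basis identity an element of M minus its bottom part lies in M'; this remainder is
   the map that [rho] lifts to [R]. *)
have rPhi x : res_aug S x - \sum_l r l (Phi l 0%N x) \in M'.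
  have [al [alP alM]] := yE' (res_aug S x).
  rewrite -[res_aug S x](subrK (\sum_l al l *: g l)) -addrA -sumrB.
  apply: grsubD => //; apply: grsub_sum => l _; rewrite -opprB; apply: grsubN.
  by apply: (rP l).2; rewrite Phi0.
have [] := @solve_chain _ _ (Some 0) S (fun t => res_dif S t) M R vR (fun t => res_dif R t)
    (fun x => res_aug S x - \sum_l r l (Phi l 0%N x))
    (fun t x => \sum_l kp l t (Phi l t.+1 x)) => //.
- exact: res_dd.
- exact: res_exact_at.
- apply: homB; first exact: hom_gr.
  by apply: hom_sum => l _; apply: comp0 => //; exact: (rP l).1.
- by move=> t; apply: hom_sum => l _; exact: comp0.
- by move=> x; apply: vR_surj.
- move=> x; rewrite (lin_sum (gh_lin vR)) res_augd sub0r opprK.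
  by apply: eq_bigr => l _; rewrite vRE kp0 Phid.
- move=> t x; rewrite (lin_sum (gh_lin (res_dif R t))) -sumrN.
  by apply: eq_bigr => l _; rewrite kpd Phid.
move=> rho [rhoh rho0 rhod].
(* The defects of [sg] and [rho] cancel, so the difference of the identity and their sum is a chain
   map; it covers 0 on M, hence is null homotopic. *)
have [] := @nullhtpy _ _ (Some 0) S (fun t => res_dif S t) M S
    (fun t x => x - (\sum_l sg l t (Phi l t x) + iota (rho t x))) => //.
- exact: res_dd.
- move=> t; apply: homB; first exact: hom_id.
  apply: homD; first by apply: hom_sum => l _; exact: comp0.
  exact: (hom_compose0r (rhoh t) (iota_h t)).
- move=> x; rewrite (linB (gh_lin (res_aug S))) (linD (gh_lin (res_aug S))).
  rewrite (lin_sum (gh_lin (res_aug S))) iota_aug -vRE rho0.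
  rewrite (eq_bigr (fun l => r l (Phi l 0%N x))) => [|l _]; last exact: sg0.
  by rewrite [X in _ - X]addrC subrK subrr.
- move=> t x; rewrite (linB (gh_lin (res_dif S t))) (linD (gh_lin (res_dif S t))).
  rewrite (lin_sum (gh_lin (res_dif S t))) iota_d rhod (linD (hom_linear (iota_h t))).
  rewrite (lin_sum (hom_linear (iota_h t))).
  rewrite (eq_bigr (fun l => sg l t (Phi l t (res_dif S t x)) - iota (kp l t (Phi l t.+1 x)))).
    by rewrite sumrB [iota _ + _]addrC addrA subrK.
  by move=> l _; rewrite sgd Phid.
move=> theta [thetah _ thetad].
(* The functional [y l] has degree c and M' has no component there, so [Phi l] composed with [iota]
   covers 0. *)
have Phi_iota0 l x : res_aug P (Phi l 0%N (iota x)) = 0.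
  by rewrite Phi0 iota_aug (hom_bottom (yh l)) //; exact: lsub_valP.
have /choice[h hP] l : exists s : forall t, R t -> P t.+1,
    [/\ forall t, ghom (Some c) (s t), forall x, Phi l 0%N (iota x) = res_dif P 0 (s 0%N x)
      & forall t x, Phi l t.+1 (iota x) = res_dif P t.+1 (s t.+1 x) + s t (res_dif R t x)].
  apply: (@nullhtpy _ _ _ R (fun t => res_dif R t) T P (fun t x => Phi l t (iota x))) => //.
  - exact: res_dd.
  - by move=> t; exact: (hom_compose0l (iota_h t) (Phih l t)).
  - by move=> t x; rewrite Phid iota_d.
have hh l t : ghom (Some c) (h l t) by case: (hP l).
have hd l t x : Phi l t.+1 (iota x) = res_dif P t.+1 (h l t.+1 x) + h l t (res_dif R t x).
  by case: (hP l).
have h0 l x : Phi l 0%N (iota x) = res_dif P 0 (h l 0%N x) by case: (hP l).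
(* On M' the map [rho \o iota] covers the inclusion minus the terms [r l \o Phi l], and
   [kp l \o h l] restores precisely these, so the sum covers the identity of M'. *)
have [] := @nullhtpy _ _ (Some 0) R (fun t => res_dif R t) _ R
    (fun t x => rho t (iota x) + \sum_l kp l t (h l t x) - x) => //.
- exact: res_dd.
- move=> t; apply: homB; last exact: hom_id.
  apply: homD; first exact: (hom_compose0l (iota_h t) (rhoh t)).
  by apply: hom_sum => l _; exact: comp0.
- move=> x; apply: val_inj; rewrite /= -[lsub_val (res_aug R _)]vRE.
  rewrite (linB (gh_lin vR)) (linD (gh_lin vR)) (lin_sum (gh_lin vR)) rho0 iota_aug.
  rewrite vRE addrAC [X in _ + X](eq_bigr (fun l => r l (Phi l 0%N (iota x)))).
    by rewrite addrAC subrK subrr.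
  by move=> l _; rewrite vRE kp0 h0.
- move=> t x; rewrite (linB (gh_lin (res_dif R t))) (linD (gh_lin (res_dif R t))).
  rewrite (lin_sum (gh_lin (res_dif R t))) rhod iota_d; congr (_ - _).
  rewrite -addrA; congr (_ + _); rewrite -big_split /=; apply: eq_bigr => l _.
  by rewrite hd (linD (hom_linear (kph l t))) kpd addrAC subrr add0r.
move=> w [wh _ wd].
exists n, y, Phi, sg, kp, rho, theta, h, w; split; split=> // t x.
- by rewrite -thetad addrC subrK.
- by rewrite -wd [RHS]addrC subrK.
Qed.

(** Exactness at Ext(M, T): evaluate z on the split identity. The part through [iota] is g composed
    with a boundary and turns into [kp] terms; adding these to [z \o sg l] is what makes each [f l]
    a cocycle. *)
Lemma bottom_layer_lift o t (z : S t.+1 -> T) (g : R t -> T) :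
  ghom o z -> (forall x, z (res_dif S t.+1 x) = 0) -> ghom o g ->
  (forall x, z (iota x) = g (res_dif R t x)) ->
  exists n (y : 'I_n -> M -> T) (Phi : 'I_n -> forall t, S t -> P t)
      (f : 'I_n -> P t.+1 -> T) (b : S t -> T),
    [/\ [/\ forall l, ghom (Some c) (y l), forall l t, ghom (Some c) (Phi l t),
           forall l x, res_aug P (Phi l 0%N x) = y l (res_aug S x)
         & forall l t x, res_dif P t (Phi l t.+1 x) = Phi l t (res_dif S t x)],
       forall l, ghom (oadd o (Some (- c))) (f l),
       forall l x, f l (res_dif P t.+1 x) = 0, ghom o b
     & forall x, z x = \sum_l f l (Phi l t.+1 x) + b (res_dif S t x)].
Proof.
move=> zh zd gh zg.
have [n [y [Phi [sg [kp [rho [theta [_ [_ [Phi_ [sgh kph kpd sgd] [rhoh thetah rhod split_id] _]]]]]]]]]] :=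
  bottom_layer_maps.
have zl := hom_linear zh; have gl := hom_linear gh.
have oc o' o'' : oadd o' o'' = oadd o'' o'.
  by case: o' o'' => [i|] [j|] //=; rewrite addrC.
exists n, y, Phi, (fun l x => z (sg l t.+1 x) + g (kp l t x)).
exists (fun x => g (rho t x) + z (theta t x)); split=> // [l|l x||x].
- by rewrite oc; apply: homD; [exact: hom_compose (sgh _ _) zh|exact: hom_compose (kph _ _) gh].
- have := sgd l t.+1 x => /(congr1 z); rewrite zd (linB zl) zg => /esym/eqP.
  by rewrite subr_eq0 => /eqP ->; rewrite kpd (linN gl) addNr.
- by apply: homD; [exact: hom_compose0l (rhoh t) gh|exact: hom_compose0l (thetah t) zh].
rewrite {1}(split_id t x) !(linD zl) zd add0r zg rhod (linD gl) !addrA; congr (_ + _).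
rewrite addrAC; congr (_ + _); rewrite (lin_sum zl) (lin_sum gl) -big_split /=.
by [].
Qed.

(** Exactness at Ext(M', T): the obstructions to extending w are the classes of [w \o kp l], one
    cohomological degree higher on [P] and shifted by -c. Once they bound, [w \o rho] corrected by
    the bounding cochains is the extension. *)
Lemma bottom_layer_extend o t (w : R t.+1 -> T) :
  ghom o w -> (forall x, w (res_dif R t.+1 x) = 0) ->
  (forall f : P t.+2 -> T, ghom (oadd (Some (- c)) o) f ->
     (forall x, f (res_dif P t.+2 x) = 0) ->
     exists2 g : P t.+1 -> T, ghom (oadd (Some (- c)) o) g &
       forall x, f x = g (res_dif P t.+1 x)) ->
  exists (z : S t.+1 -> T) (v : R t -> T),
    [/\ ghom o z, forall x, z (res_dif S t.+1 x) = 0, ghom o v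
      & forall x, z (iota x) = w x + v (res_dif R t x)].
Proof.
move=> wh wd Pvanish.
have [n [y [Phi [sg [kp [rho [theta [h [u [[yh Phih Phi0 Phid] [sgh kph kpd sgd]
  [rhoh thetah rhod split_id] [hh uh Phi_iota rho_iota]]]]]]]]]]] := bottom_layer_maps.
have wl := hom_linear wh.
have /choice[g gP] l : exists g : P t.+1 -> T, ghom (oadd (Some (- c)) o) g /\
    forall x, w (kp l t.+1 x) = g (res_dif P t.+1 x).
  have [||g gh gE] := Pvanish (fun x => w (kp l t.+1 x)); last by exists g.
  - exact: hom_compose (kph _ _) wh.
  - move=> x; have := kpd l t.+1 x => /(congr1 w); rewrite wd (linN wl) => /esym/eqP.
    by rewrite oppr_eq0 => /eqP.
have gh l : ghom (oadd (Some (- c)) o) (g l) by case: (gP l).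
have gE l x : w (kp l t.+1 x) = g l (res_dif P t.+1 x) by case: (gP l).
have gc (X Y : grMod A) (f : X -> Y) (k : Y -> T) : ghom (Some c) f ->
    ghom (oadd (Some (- c)) o) k -> ghom o (fun x => k (f x)).
  by move=> fh kh; have := hom_compose fh kh; case: (o) => //= j; rewrite addNKr.
exists (fun x => w (rho t.+1 x) + \sum_l g l (Phi l t.+1 x)).
exists (fun x => w (u t x) + \sum_l g l (h l t x)); split.
- apply: homD; first exact: hom_compose0l (rhoh _) wh.
  by apply: hom_sum => l _; exact: gc.
- move=> x; have := rhod t.+1 x => /(congr1 w); rewrite wd (linD wl) (lin_sum wl) => /esym E.
  by rewrite -[RHS]E; congr (_ + _); apply: eq_bigr => l _; rewrite gE Phid.
- apply: homD; first exact: hom_compose0l (uh _) wh.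
  by apply: hom_sum => l _; exact: gc.
move=> x; have := rho_iota t x => /(congr1 w).
rewrite !(linD wl) wd add0r (lin_sum wl) => E.
rewrite [RHS]addrA -E -addrA; congr (_ + _); rewrite -big_split /=.
apply: eq_bigr => l _; rewrite Phi_iota (linD (hom_linear (gh l))).
by rewrite gE.
Qed.

End BottomLayer.

(** * Coboundaries *)

Section Coboundaries.
Variables (F : fieldType) (A : grAlg F).
Implicit Types (M N K : grMod A).

Definition cob (o : option int) M (P : resolution M) N (n : nat) : (P n -> N) -> Prop :=
  match n with
  | 0 => fun f => forall x, f x = 0
  | m.+1 => fun f => exists2 g : P m -> N, ghom o g & forall x, f x = g (res_dif P m x)
  end.

Lemma coboundaryP M (P : resolution M) N n (f : P n -> N) :
  coboundary (f : P n -> resF N) <-> @cob None M P N n f.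
Proof.
by case: n f => [|m] f //=; split=> [->|f0] //; exact: funext.
Qed.

Lemma cob_ext o M (P : resolution M) N n (f g : P n -> N) :
  f =1 g -> cob o f -> cob o g.
Proof. by move=> /funext->. Qed.

Lemma cob0 o M (P : resolution M) N n : @cob o M P N n (fun=> 0).
Proof. by case: n => [|m] //=; exists (fun=> 0) => //; exact: hom0. Qed.

Lemma cobD o M (P : resolution M) N n (f g : P n -> N) :
  cob o f -> cob o g -> cob o (fun x => f x + g x).
Proof.
case: n f g => [|m] f g /=; first by move=> f0 g0 x; rewrite f0 g0 addr0.
move=> [f' f'h fE] [g' g'h gE]; exists (fun x => f' x + g' x); first exact: homD.
by move=> x; rewrite fE gE.
Qed.

Lemma cobN o M (P : resolution M) N n (f : P n -> N) : cob o f -> cob o (fun x => - f x).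
Proof.
case: n f => [|m] f /=; first by move=> f0 x; rewrite f0 oppr0.
move=> [f' f'h fE]; exists (fun x => - f' x); first exact: homN.
by move=> x; rewrite fE.
Qed.

Lemma cobB o M (P : resolution M) N n (f g : P n -> N) :
  cob o f -> cob o g -> cob o (fun x => f x - g x).
Proof. by move=> fc gc; apply: cobD => //; exact: cobN. Qed.

Lemma cobZF o M (P : resolution M) N n (c : F) (f : P n -> N) :
  cob o f -> cob o (fun x => (c%:A : A) *: f x).
Proof.
case: n f => [|m] f /=; first by move=> f0 x; rewrite f0 scaler0.
move=> [f' f'h fE]; exists (fun x => (c%:A : A) *: f' x); first exact: homZF.
by move=> x; rewrite fE.
Qed.

Lemma cob_None o M (P : resolution M) N n (f : P n -> N) : cob o f -> cob None f.
Proof.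
by case: n f => [|m] f //= [g gh gE]; exists g => //; exact: hom_None gh.
Qed.

(** The components of f and those of g composed with the differential are compared over the union of
    both index lists, where the sum of homogeneous Hom spaces is direct. *)
Lemma cob_comp M (P : resolution M) N n (s : seq int) (f : int -> P n -> N) :
  uniq s -> (forall j, ghom (Some j) (f j)) ->
  cob None (fun x => \sum_(j <- s) f j x) -> forall j, j \in s -> cob (Some j) (f j).
Proof.
move=> us fh; case: n f fh => [|m] f fh /=.
  by move=> f0 j js x; exact: (homj_sum0 us fh f0).
move=> [g /uHomP[t [g_ [ut gh gE]]] fE] j js.
pose G l (x : P m.+1) : N :=
  (if l \in s then f l else fun=> 0) x -
  (if l \in t then fun y => g_ l (res_dif P m y) else fun=> 0) x.
pose r := undup (s ++ t).
have Gh l : ghom (Some l) (G l).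
  apply: homB; case: ifP => _ //; try exact: hom0.
  exact: (hom_compose0l (hom_gr (res_dif P m)) (gh l)).
have G0 x : \sum_(l <- r) G l x = 0.
  rewrite sumrB (@big_uniq_supp _ _ s r) ?undup_uniq //; last 2 first.
  - by move=> l ls; rewrite mem_undup mem_cat ls.
  - by move=> l /negbTE->.
  rewrite (@big_uniq_supp _ _ t r) ?undup_uniq //; last 2 first.
  - by move=> l ls; rewrite mem_undup mem_cat ls orbT.
  - by move=> l /negbTE->.
  apply/eqP; rewrite subr_eq0; apply/eqP.
  rewrite (eq_big_seq (fun l => f l x)); last by move=> l ->.
  rewrite [RHS](eq_big_seq (fun l => g_ l (res_dif P m x))); last by move=> l ->.
  by rewrite fE gE.
have jr : j \in r by rewrite mem_undup mem_cat js.
have := fun x => homj_sum0 (undup_uniq _) Gh G0 x jr; rewrite /G js => Gj.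
exists (if j \in t then g_ j else fun=> 0).
  by case: ifP => _; [exact: gh|exact: (hom0 _ _ (Some j))].
move=> x; have /eqP := Gj x; rewrite subr_eq0 => /eqP ->.
by case: ifP.
Qed.

Lemma chain_cob o M M' (P : resolution M) (R : resolution M') N n
    (mu : forall t, R t -> P t) (f : P n -> N) :
  (forall t, ghom (Some 0) (mu t)) ->
  (forall t x, res_dif P t (mu t.+1 x) = mu t (res_dif R t x)) ->
  cob o f -> cob o (fun x => f (mu n x)).
Proof.
move=> muh mud; case: n f => [|n] f /=; first by move=> f0 x.
move=> [g gh gE]; exists (fun x => g (mu n x)); first exact: hom_compose0l (muh n) gh.
by move=> x; rewrite gE mud.
Qed.

Lemma htpy_cob_oadd o o' M M' (P : resolution M) (R : resolution M') N n
    (psi : forall t, R t -> P t) (f : P n -> N) :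
  ghom o f -> (forall x, f (res_dif P n x) = 0) ->
  (forall t, ghom o' (psi t)) -> (forall x, res_aug P (psi 0%N x) = 0) ->
  (forall t x, res_dif P t (psi t.+1 x) = psi t (res_dif R t x)) ->
  cob (oadd o' o) (fun x => f (psi n x)).
Proof.
move=> fh fd psih psi0 psid.
have [s [sh s0 sE]] := nullhtpy (fun t => @res_proj _ _ _ R t)
  (fun t => hom_gr (res_dif R t)) (@res_dd _ _ _ R) psih psi0 psid.
have fl := hom_linear fh.
case: n f fh fd fl => [|n] f fh fd fl /=; first by move=> x; rewrite s0 fd.
exists (fun x => f (s n x)); first exact: hom_compose (sh n) fh.
by move=> x; rewrite sE (linD fl) fd add0r.
Qed.

Lemma htpy_cob o M M' (P : resolution M) (R : resolution M') N n
    (psi : forall t, R t -> P t) (f : P n -> N) :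
  ghom o f -> (forall x, f (res_dif P n x) = 0) ->
  (forall t, ghom (Some 0) (psi t)) -> (forall x, res_aug P (psi 0%N x) = 0) ->
  (forall t x, res_dif P t (psi t.+1 x) = psi t (res_dif R t x)) ->
  cob o (fun x => f (psi n x)).
Proof.
move=> fh fd psih psi0 psid; have := htpy_cob_oadd fh fd psih psi0 psid.
by case: (o) => [j|] //; rewrite /= add0r.
Qed.

Lemma resolutions_eqv M (P Q : resolution M) :
  exists (al : forall t, Q t -> P t) (be : forall t, P t -> Q t),
  [/\ [/\ forall t, ghom (Some 0) (al t), forall x, res_aug P (al 0%N x) = res_aug Q x
       & forall t x, res_dif P t (al t.+1 x) = al t (res_dif Q t x)],
     [/\ forall t, ghom (Some 0) (be t), forall x, res_aug Q (be 0%N x) = res_aug P x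
       & forall t x, res_dif Q t (be t.+1 x) = be t (res_dif P t x)],
     forall o N n (f : P n -> N), ghom o f -> (forall x, f (res_dif P n x) = 0) ->
       cob o (fun x => f x - f (al n (be n x)))
   & forall o N n (f : Q n -> N), ghom o f -> (forall x, f (res_dif Q n x) = 0) ->
       cob o (fun x => f x - f (be n (al n x)))].
Proof.
have [al [alh al0 ald]] := res_compare Q P (hom_id M).
have [be [beh be0 bed]] := res_compare P Q (hom_id M).
have half (X Y : resolution M) (u : forall t, Y t -> X t) (v : forall t, X t -> Y t) :
    (forall t, ghom (Some 0) (u t)) -> (forall x, res_aug X (u 0%N x) = res_aug Y x) ->
    (forall t x, res_dif X t (u t.+1 x) = u t (res_dif Y t x)) ->
    (forall t, ghom (Some 0) (v t)) -> (forall x, res_aug Y (v 0%N x) = res_aug X x) ->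
    (forall t x, res_dif Y t (v t.+1 x) = v t (res_dif X t x)) ->
    forall o N n (f : X n -> N), ghom o f -> (forall x, f (res_dif X n x) = 0) ->
       cob o (fun x => f x - f (u n (v n x))).
  move=> uh u0 ud vh v0 vd o N n f fh fd.
  apply: (@cob_ext _ _ _ _ _ (fun x => f (x - u n (v n x)))).
    by move=> x; rewrite (linB (hom_linear fh)).
  apply: (@htpy_cob o _ _ X X N n (fun t x => x - u t (v t x))) => //.
  - by move=> t; apply: homB; [exact: hom_id|exact: hom_compose0l (vh t) (uh t)].
  - by move=> x; rewrite (linB (gh_lin (res_aug X))) u0 v0 subrr.
  - by move=> t x; rewrite (linB (gh_lin (res_dif X t))) ud vd.
by exists al, be; split=> //; exact: half.
Qed.

End Coboundaries.

(** * Degree bounds by truncation and filtration *)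

Section DegreeBound.
Variables (F : fieldType) (A : grAlg F).
Implicit Types (M N K : grMod A).
Local Notation T := (trivial_mod A).

Section Truncation.
Variables (M : grMod A) (c : int).

Definition trunc_pred : {pred M} :=
  [pred x | `[< forall l, (l < c)%R -> gcomp l x = 0 >]].

Lemma trunc_submod : submod_closed trunc_pred.
Proof.
split=> [|a u v /asboolP uT /asboolP vT]; apply/asboolP => l lc.
  by rewrite gcomp0.
rewrite gcompD (vT l lc) addr0; elim/ga_ind: a => [|a b IHa IHb|k a ak].
- by rewrite scale0r gcomp0.
- by rewrite scalerDl gcompD IHa IHb addr0.
- rewrite (gcomp_act _ _ ak) uT ?scaler0 //.
  by apply: le_lt_trans lc; rewrite gerDl oppr_le0.
Qed.

Lemma trunc_comp j x : x \in trunc_pred -> gcomp j x \in trunc_pred.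
Proof.
move=> /asboolP xT; apply/asboolP => l lc.
have [lj|lj] := eqVneq l j; last by rewrite (gcomp_ne (gcomp_in j x)).
by rewrite gcomp_id -lj ?gcomp_in // xT.
Qed.

Definition truncGr : grSub M := mkGrSub trunc_submod trunc_comp.

Lemma mem_trunc j x : x \in gm_deg M j -> (c <= j)%R -> x \in truncGr.
Proof.
move=> xj cj; apply/asboolP => l lc; apply: (gcomp_ne xj).
by apply: contraTneq lc => ->; rewrite -leNgt.
Qed.

Lemma trunc_deg0 j x : x \in truncGr -> x \in gm_deg M j -> (j < c)%R -> x = 0.
Proof. by move=> /asboolP xT xj jc; rewrite -(gcomp_id xj) xT. Qed.

Lemma trunc_split x : exists x1 x2,
  [/\ x = x1 + x2, x1 \in truncGr & forall l, (c <= l)%R -> gcomp l x2 = 0].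
Proof.
elim/gr_ind: x => [|u v [u1 [u2 [uE u1T u20]]] [v1 [v2 [vE v1T v20]]]|j x xj].
- by exists 0, 0; rewrite addr0 grsub0; split=> // l _; rewrite gcomp0.
- exists (u1 + v1), (u2 + v2); rewrite uE vE addrACA grsubD //; split=> // l cl.
  by rewrite gcompD u20 // v20 // addr0.
- have [jc|cj] := ltP j c.
    exists 0, x; rewrite add0r grsub0; split=> // l cl; apply: (gcomp_ne xj).
    by apply: contraTneq cl => ->; rewrite -ltNge.
  exists x, 0; rewrite addr0 (mem_trunc xj cj); split=> // l _; exact: gcomp0.
Qed.

Lemma trunc_low0 x : x \in truncGr -> (forall l, (c <= l)%R -> gcomp l x = 0) -> x = 0.
Proof.
move=> /asboolP xT x0; apply: gcomp_eq0 => l.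
by have [lc|cl] := ltP l c; [exact: xT|exact: x0].
Qed.

Lemma trunc_full : (forall j x, (j < c)%R -> x \in gm_deg M j -> x = 0) ->
  forall x, x \in truncGr.
Proof.
by move=> M0 x; apply/asboolP => l lc; apply: M0 lc _; exact: gcomp_in.
Qed.

End Truncation.

Lemma hom_trunc M N c (f : grHom M N) x : x \in truncGr M c -> f x \in truncGr N c.
Proof.
move=> /asboolP xT; apply/asboolP => l lc.
by rewrite (homj_comp _ _ (hom_gr f)) addr0 xT // (lin0 (gh_lin f)).
Qed.

(** Exactness is degreewise, so the part of [R] in degrees at least b still resolves M. Its terms
    need not be projective, but [compare] asks projectivity of the source only. Thus the identity of
    [R] is homotopic to a map through the truncation, on which a map of degree j < b to T
    vanishes. *)
Lemma cob_below M (R : resolution M) (b j : int) n (f : R n -> T) :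
  (forall l x, (l < b)%R -> x \in gm_deg M l -> x = 0) -> (j < b)%R ->
  ghom (Some j) f -> (forall x, f (res_dif R n x) = 0) -> cob (Some j) f.
Proof.
move=> M0 jb fh fd.
pose Y t := subGr (truncGr (R t) b).
have [delta deltaE] : exists delta : forall t, grHom (Y t.+1) (Y t),
    forall t x, lsub_val (delta t x) = res_dif R t (lsub_val x).
  have dT t (x : Y t.+1) : res_dif R t (lsub_val x) \in truncGr (R t) b.
    by apply: hom_trunc; exact: lsub_valP.
  pose d t (x : Y t.+1) : Y t := LSub (dT t x).
  have ld t : linear (d t) by move=> a u v; apply: val_inj; exact: (gh_lin (res_dif R t)).
  have dd t i (x : Y t.+1) : x \in gm_deg (Y t.+1) i -> d t x \in gm_deg (Y t) i.
    move=> xi; change (res_dif R t (lsub_val x) \in gm_deg (R t) i); exact: gh_deg.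
  by exists (fun t => GrHom (ld t) (dd t)).
have [a aE] := gr_comp (subval (truncGr (R 0%N) b)) (res_aug R).
(* The low part x2 of a preimage contributes nothing: p x2 = y - p x1 has only degrees below b and
   also lies in the truncation. *)
have lift_trunc N N' (p : grHom N N') y : y \in truncGr N' b -> (exists x, y = p x) ->
    exists2 x, x \in truncGr N b & y = p x.
  move=> yT [x yE]; have [x1 [x2 [xE x1T x20]]] := trunc_split b x.
  exists x1 => //; apply/eqP; rewrite -subr_eq0; apply/eqP.
  have yx : y - p x1 = p x2 by rewrite yE xE (linD (gh_lin p)) addrC addKr.
  apply: (@trunc_low0 _ b); first by apply: grsubB => //; exact: hom_trunc.
  move=> l bl; rewrite yx (homj_comp _ _ (hom_gr p)) addr0 x20 //.
  exact: (lin0 (gh_lin p)).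
have [] := @compare _ _ (Some 0) R (fun t => res_dif R t) M Y a delta (res_aug R) => //.
- by move=> t; exact: res_proj.
- by move=> t; exact: hom_gr.
- exact: res_dd.
- move=> y; rewrite aE; split=> [y0|[x ->]]; last first.
    by rewrite /= deltaE res_augd.
  have [x xT xE] := lift_trunc _ _ (res_dif R 0) _ (lsub_valP y) (iffLR (@res_exact_at0 _ _ _ R _) y0).
  by exists (LSub xT); apply: val_inj; rewrite -[LHS]/(lsub_val y) xE; symmetry; exact: deltaE.
- move=> t y; split=> [y0|[x ->]]; last first.
    by apply: val_inj; rewrite [LHS]deltaE deltaE res_dd.
  have y0' : res_dif R t (lsub_val y) = 0 by rewrite -deltaE y0.
  have [x xT xE] := lift_trunc _ _ (res_dif R t.+1) _ (lsub_valP y) (iffLR (@res_exact_at _ _ _ R t _) y0').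
  by exists (LSub xT); apply: val_inj; rewrite -[LHS]/(lsub_val y) xE; symmetry; exact: deltaE.
- exact: hom_gr.
- move=> x; have [y yT yE] := lift_trunc _ _ (res_aug R) (res_aug R x) (trunc_full M0 _) (ex_intro _ x erefl).
  by exists (LSub yT); rewrite aE yE.
- exact: res_augd.
move=> psi [psih psi0 psid].
apply: (@cob_ext _ _ _ _ _ _ _ (fun x => f (x - lsub_val (psi n x)))).
  move=> x; rewrite (linB (hom_linear fh)) [f (lsub_val _)](_ : _ = 0) ?subr0 //.
  have -> : f (lsub_val (psi n x)) = gcomp 0 (f (lsub_val (psi n x))).
    by rewrite gcomp_id ?trivial_deg0.
  rewrite (homj_comp _ _ fh) add0r.
  have /asboolP -> // := lsub_valP (psi n x).
  exact: (lin0 (hom_linear fh)).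
apply: (@htpy_cob _ _ (Some j) _ _ R R T n (fun t x => x - lsub_val (psi t x))) => //.
- move=> t; apply: homB; first exact: hom_id.
  exact: (hom_compose0r (psih t) (hom_gr (subval _))).
- by move=> x; rewrite (linB (gh_lin (res_aug R))) -[X in _ - X]aE psi0 subrr.
- by move=> t x; rewrite (linB (gh_lin (res_dif R t))) -deltaE psid.
Qed.

(* Filtering [M] by degree: a layer concentrated in degree [b] contributes the
   cohomology of the trivial module shifted by [b]. *)
Lemma cob_bound (P : resolution T) (t : int) n : semisimple0 A ->
  (forall j (f : P n.+1 -> T), (j < t)%R -> ghom (Some j) f ->
     (forall x, f (res_dif P n.+1 x) = 0) -> cob (Some j) f) ->
  forall M (R : resolution M) (b j : int) (f : R n.+1 -> T), locally_fd M ->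
    (forall l x, (l < b)%R -> x \in gm_deg M l -> x = 0) -> (j < b + t)%R ->
    ghom (Some j) f -> (forall x, f (res_dif R n.+1 x) = 0) -> cob (Some j) f.
Proof.
move=> ss Pt.
(* N bounds the number of layers between b and j; when none is left, [cob_below] applies. *)
suff main (N : nat) : forall M (R : resolution M) (b j : int) (f : R n.+1 -> T),
    locally_fd M -> (forall l x, (l < b)%R -> x \in gm_deg M l -> x = 0) ->
    (j < b + t)%R -> (j < b + N%:Z)%R -> ghom (Some j) f ->
    (forall x, f (res_dif R n.+1 x) = 0) -> cob (Some j) f.
  move=> M R b j f Mf M0 jt; apply: (main `|j - b|.+1 M R b) => //.
  by rewrite -ltrBlDl -addn1 PoszD ltzD1 lez_abs.
elim: N => [|N IHN] M R b j f Mf M0 jt jN fh fd.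
  by apply: (cob_below M0) => //; rewrite -[b]addr0.
pose M' := truncGr M (b + 1).
have [R'] := resolution_exists (subGr M').
have [iota [iotah iota0 iotad]] := res_compare R' R (hom_gr (subval M')).
have [] : cob (Some j) (fun x => f (iota n.+1 x)).
  apply: (IHN _ R' (b + 1)) => //.
  - exact: sub_lfd.
  - by move=> l x lb xl; apply: val_inj; exact: (trunc_deg0 (lsub_valP x) xl lb).
  - by apply: lt_le_trans jt _; rewrite addrAC lerDl.
  - by rewrite -addrA -PoszD add1n.
  - exact: hom_compose0l (iotah _) fh.
  - by move=> x; rewrite -iotad fd.
move=> g gh gE.
have [||k [y [Phi [h [w [[yh Phih Phi0 Phid] hh hd wh fE]]]]]] :=
  @bottom_layer_lift _ _ ss M b M' (Mf b) M0 _ _ P R R' iota iotah iota0 iotad (Some j) n f g fh fd gh gE.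
- by move=> l x bl xl; apply: (mem_trunc xl); rewrite lezD1.
- by move=> x xM xb; apply: (trunc_deg0 xM xb); rewrite ltrDl.
(* A layer in degree b lowers the degree on [P] to j - b, which is below t by assumption. *)
have /choice[u uP] l : exists u : P n -> T, ghom (Some (j - b)) u /\
    forall x, h l x = u (res_dif P n x).
  by have [|u uh uE] := Pt (j - b) (h l) _ (hh l) (hd l); [rewrite ltrBlDl|exists u].
exists (fun x => \sum_l u l (Phi l n x) + w x).
  apply: homD => //; apply: hom_sum => l _.
  by have := hom_compose (Phih l n) (uP l).1; rewrite /= addrC subrK.
move=> x; rewrite fE; congr (_ + _); apply: eq_bigr => l _.
by rewrite (uP l).2 Phid.
Qed.

End DegreeBound.

(** * Ext classes and Yoneda products *)

Section ExtClasses.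
Variables (F : fieldType) (A : grAlg F).
Implicit Types (M N K : grMod A).
Local Notation T := (trivial_mod A).

Definition rep M (P : resolution M) N n (z : Ext P N n) (f : P n -> N) : Prop :=
  exists2 c : cocycle P N n, coc_fun c = f & z = ext_class c.

Section Rep.
Variables (M : grMod A) (P : resolution M) (N : grMod A) (n : nat).
Implicit Types (z : Ext P N n) (f : P n -> N).

Lemma rep_ex z : exists f, rep z f.
Proof. by have [c ->] := lproj_surj z; exists (coc_fun c), c. Qed.

Lemma rep_hom z f : rep z f -> ghom None f.
Proof. by case=> c <- _; have /andP[] := lsub_valP c. Qed.

Lemma rep_d z f x : rep z f -> f (res_dif P n x) = 0.
Proof. by case=> c <- _; have /andP[_ /asboolP cd] := lsub_valP c; exact: cd. Qed.

Lemma rep_of f : ghom None f -> (forall x, f (res_dif P n x) = 0) -> exists z, rep z f.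
Proof.
move=> fh fd.
have fC : (f : P n -> resF N) \in Submod (cocycle_submod P N n).
  by apply/andP; split=> //; exact/asboolP.
by exists (ext_class (LSub fC : cocycle P N n)), (LSub fC).
Qed.

Lemma rep_eq z z' f f' : rep z f -> rep z' f' ->
  z = z' <-> cob None (fun x => f x - f' x).
Proof.
move=> [c <- ->] [c' <- ->].
have E : coc_fun (c - c') = fun x => coc_fun c x - coc_fun c' x.
  exact: (raddfB (val : lsub (Submod (cocycle_submod P N n)) -> _)).
rewrite -coboundaryP -E; split=> [/lproj_eq/asboolP|cc]; first exact.
by apply/lproj_eq/asboolP.
Qed.

Lemma rep_lin a z z' f f' : rep z f -> rep z' f' ->
  rep (a *: z + z') (fun x => (a%:A : A) *: f x + f' x).
Proof.
move=> [c <- ->] [c' <- ->]; exists (a *: c + c').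
  exact: (linearP (val : lsub (Submod (cocycle_submod P N n)) -> _)).
by rewrite /ext_class lproj_linear.
Qed.

Lemma rep0 : rep (0 : Ext P N n) (fun=> 0).
Proof.
exists 0; first exact: (raddf0 (val : lsub (Submod (cocycle_submod P N n)) -> _)).
by rewrite /ext_class raddf0.
Qed.

Lemma repD z z' f f' : rep z f -> rep z' f' -> rep (z + z') (fun x => f x + f' x).
Proof.
move=> zf zf'; have := rep_lin 1 zf zf'; rewrite scale1r.
by congr rep; apply: funext => x; rewrite !scale1r.
Qed.

Lemma rep_sum (I : Type) (r : seq I) (z : I -> Ext P N n) (f : I -> P n -> N) :
  (forall i, rep (z i) (f i)) -> rep (\sum_(i <- r) z i) (fun x => \sum_(i <- r) f i x).
Proof.
move=> zf; elim: r => [|i r IHr].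
  by rewrite big_nil; have := rep0; congr rep; apply: funext => x; rewrite big_nil.
rewrite big_cons; have := repD (zf i) IHr; congr rep.
by apply: funext => x; rewrite big_cons.
Qed.

Lemma rep_eq0 z f : rep z f -> z = 0 <-> cob None f.
Proof.
move=> zf; rewrite (rep_eq zf rep0).
by split; apply: cob_ext => x; rewrite subr0.
Qed.

Lemma rep_cob z f f' : rep z f -> ghom None f' -> (forall x, f' (res_dif P n x) = 0) ->
  cob None (fun x => f x - f' x) -> rep z f'.
Proof.
by move=> zf f'h f'd ff'; have [z' zf'] := rep_of f'h f'd; rewrite (rep_eq zf zf').2.
Qed.

Lemma Ext_degP j z : reflect (exists2 f, ghom (Some j) f & rep z f) (z \in Ext_deg P N n j).
Proof.
apply: (iffP (asboolP _)) => [[c ch ->]|[f fh [c cf ->]]].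
  by exists (coc_fun c) => //; exists c.
by exists c => //; rewrite cf.
Qed.

Lemma Ext_deg_submod j : submod_closed (Ext_deg P N n j).
Proof.
split=> [|a u v /Ext_degP[f fh uf] /Ext_degP[g gh vg]]; apply/Ext_degP.
  by exists (fun=> 0); [exact: (hom0 _ _ (Some j))|exact: rep0].
exists (fun x => (a%:A : A) *: f x + g x); last exact: rep_lin.
exact: (hom_linF (o := Some j)).
Qed.

Lemma rep_homog z : exists (s : seq int) (f : int -> P n -> N) (w : int -> Ext P N n),
  [/\ uniq s, forall j, ghom (Some j) (f j), forall j, rep (w j) (f j)
    & z = \sum_(j <- s) w j].
Proof.
have [f zf] := rep_ex z; have [s [g [us gh fE]]] := uHomP (rep_hom zf).
have gd j : j \in s -> forall x, g j (res_dif P n x) = 0.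
  move=> js x; have gdh l : ghom (Some l) (fun x => g l (res_dif P n x)).
    exact: hom_compose0l (hom_gr _) (gh l).
  by apply: (homj_sum0 us gdh) => // y; rewrite -fE; exact: rep_d zf.
pose g' j := if j \in s then g j else fun=> 0.
have g'h j : ghom (Some j) (g' j).
  by rewrite /g'; case: ifP => _; [exact: gh|exact: (hom0 _ _ (Some j))].
have /choice[w wg] j : exists z, rep z (g' j).
  apply: rep_of; first exact: hom_None (g'h j).
  by rewrite /g'; case: ifP => // /gd.
exists s, g', w; split=> //.
apply/(rep_eq zf (rep_sum s wg)); apply: cob_ext (cob0 None P N n) => x.
rewrite fE (eq_big_seq (fun j => g' j x)) ?subrr // => j js.
by rewrite /g' js.
Qed.

Definition vanish (j : int) : Prop :=
  forall f, ghom (Some j) f -> (forall x, f (res_dif P n x) = 0) -> cob (Some j) f.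

Lemma vanish_deg j z : vanish j -> z \in Ext_deg P N n j -> z = 0.
Proof.
move=> vj /Ext_degP[f fh zf]; apply/(rep_eq0 zf); apply: (@cob_None _ _ (Some j)).
by apply: vj => // x; exact: rep_d zf.
Qed.

Lemma vanish_sum (S : seq int) (z : Ext P N n) : uniq S ->
  (forall j, j \notin S -> vanish j) ->
  exists2 w : int -> Ext P N n, forall j, w j \in Ext_deg P N n j & z = \sum_(j <- S) w j.
Proof.
move=> uS vS; have [s [f [w [us fh wf ->]]]] := rep_homog z.
have wj j : w j \in Ext_deg P N n j by apply/Ext_degP; exists (f j).
exists (fun j => if j \in s then w j else 0).
  by move=> j; case: ifP => // _; case: (Ext_deg_submod j).
pose r := undup (s ++ S).
have w0 j : j \notin S -> w j = 0 by move=> /vS/vanish_deg; apply.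
rewrite -(@big_uniq_supp _ _ S r) ?undup_uniq //; last 2 first.
- by move=> j jS; rewrite mem_undup mem_cat jS orbT.
- by move=> j /w0->; case: ifP.
rewrite (@big_uniq_supp _ _ s r) ?undup_uniq //; last 2 first.
- by move=> j js; rewrite mem_undup mem_cat js.
- by move=> j /negbTE->.
by apply: eq_big_seq => j ->.
Qed.

Lemma vanish_of_sum (S : seq int) (j : int) : uniq S -> j \notin S ->
  (forall z : Ext P N n, z \in Ext_deg P N n j ->
     exists2 w : int -> Ext P N n, forall j, w j \in Ext_deg P N n j & z = \sum_(j <- S) w j) ->
  vanish j.
Proof.
move=> uS jS hS f fh fd; have [z zf] := rep_of (hom_None fh) fd.
have [|w wd zE] := hS z; first by apply/Ext_degP; exists f.
have /choice[g gP] l : exists g : P n -> N, ghom (Some l) g /\ rep (w l) g.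
  by have /Ext_degP[g gh wg] := wd l; exists g.
(* Putting f at the index j outside [S] and the negatives of the components at the indices of [S]
   makes the relation one sum of homogeneous cochains, from which [cob_comp] extracts f. *)
pose G l := if l == j then f else fun x => - g l x.
have Gh l : ghom (Some l) (G l).
  by rewrite /G; case: eqP => [->//|_]; apply: (homN (o := Some l)); case: (gP l).
have := @cob_comp _ _ M P N n (j :: S) G _ Gh _ j (mem_head _ _).
rewrite /G eqxx; apply; first by rewrite /= jS.
have := (rep_eq zf (rep_sum S (fun l => (gP l).2))).1 zE; apply: cob_ext => x.
rewrite big_cons eqxx; congr (_ + _); rewrite -sumrN; apply: eq_big_seq => l lS.
by case: eqP lS jS => // -> ->.
Qed.

End Rep.

Lemma vanish_indep M (P Q : resolution M) N n j : vanish P N n j -> vanish Q N n j.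
Proof.
move=> vP f fh fd.
have [al [be [[alh _ ald] [beh _ bed] _ Qeq]]] := resolutions_eqv P Q.
have c1 := Qeq _ _ _ _ fh fd.
have c2 : cob (Some j) (fun x => f (be n (al n x))).
  apply: (chain_cob (f := fun x => f (be n x)) alh ald); apply: vP.
    exact: hom_compose0l (beh n) fh.
  by move=> x; rewrite -bed fd.
by apply: cob_ext (cobD c1 c2) => x; rewrite subrK.
Qed.

Section Yoneda.
Variables (M K N : grMod A) (R : resolution M) (P : resolution K).

Definition lifts o m (g : R m -> K) (phi : forall t, R (t + m)%N -> P t) : Prop :=
  [/\ forall t, ghom o (phi t), forall u, res_aug P (phi 0%N u) = g u
    & forall t u, res_dif P t (phi t.+1 u) = phi t (res_dif R (t + m)%N u)].

Lemma lifts_exist o m (g : R m -> K) : ghom o g ->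
  (forall x, g (res_dif R m x) = 0) -> exists phi, lifts o g phi.
Proof.
move=> gh gd.
apply: (@compare _ _ o (fun t => R (t + m)%N) (fun t => res_dif R (t + m)%N) K P
  (res_aug P) (fun t => res_dif P t) g) => //.
- by move=> t; exact: res_proj.
- by move=> t; exact: hom_gr.
- by move=> t x; exact: res_dd.
- exact: res_exact_at0.
- exact: res_exact_at.
- by move=> x; exact: res_surj.
Qed.

Lemma yonedaP i m (x : Ext P N i) (y : Ext R K m) (z : Ext R N (i + m)) :
  yoneda x y z <-> exists f g h phi,
    [/\ rep x f, rep y g, rep z h, lifts None g phi & forall u, h u = f (phi i u)].
Proof.
split.
  move=> [f [g [h [phi [[-> -> ->] [p1 p2 p3 hE]]]]]].
  by exists (coc_fun f), (coc_fun g), (coc_fun h), phi; split=> //; [exists f|exists g|exists h].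
move=> [_ [_ [_ [phi [[f <- ->] [g <- ->] [h <- ->] [p1 p2 p3] hE]]]]].
by exists f, g, h, phi.
Qed.

Lemma lifts_cob o i m (f : P i -> N) (g : R m -> K) phi :
  ghom None f -> (forall x, f (res_dif P i x) = 0) -> lifts o g phi ->
  cob None g -> cob None (fun x => f (phi i x)).
Proof.
move=> fh fd [ph p0 pd]; have fl := hom_linear fh.
have ph' t : ghom None (phi t) := hom_None (ph t).
have Rproj t : projective (R (t + m)%N) by exact: res_proj.
have Rdh t : ghom (Some 0) (res_dif R (t + m)%N) by exact: hom_gr.
have Rdd t x : res_dif R (t + m)%N (res_dif R (t.+1 + m)%N x) = 0 by exact: res_dd.
case: m g phi ph p0 pd ph' Rproj Rdh Rdd => [|m] g phi ph p0 pd ph' Rproj Rdh Rdd /=.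
  move=> g0.
  have [|s [sh s0 sE]] := nullhtpy Rproj Rdh Rdd ph' _ pd.
    by move=> x; rewrite p0 g0.
  case: i f fh fd fl => [|i] f fh fd fl /=; first by move=> x; rewrite s0 fd.
  exists (fun x => f (s i x)); first exact: (hom_compose (sh i) fh).
  by move=> x; rewrite sE (linD fl) fd add0r.
move=> [v vh0 vE]; have vh : ghom None v := vh0.
have [x|s_ s_h s_E] := lift_hom (p := res_aug P) (@res_proj _ _ _ R m) vh.
  exact: res_surj.
(* [phi] covers the coboundary of v, which [s_] lifts through the augmentation. Subtracting
   [s_ \o d] in degree 0 gives a chain map covering 0, and higher degrees are unaffected since d d =
   0. *)
pose phi' t : R (t + m.+1)%N -> P t :=
  match t with
  | 0 => fun x => phi 0%N x - s_ (res_dif R m x)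
  | t'.+1 => phi t'.+1
  end.
have [|x|[|t] x|s [sh s0 sE]] := @nullhtpy _ _ None _ _ _ P phi' Rproj Rdh Rdd.
- case=> [|t]; last exact: ph'.
  by apply: (@homB F A _ _ None (phi 0%N) (fun x => s_ (res_dif R m x))); [exact: ph'|exact: (hom_compose0l (hom_gr (res_dif R m)) s_h)].
- by rewrite /= (linB (gh_lin (res_aug P))) p0 s_E vE subrr.
- by rewrite /= pd res_dd (lin0 (hom_linear s_h)) subr0.
- by rewrite /= pd.
case: i f fh fd fl => [|i] f fh fd fl /=.
  exists (fun x => f (s_ x)); first exact: (hom_compose s_h fh).
  move=> x; have -> : phi 0%N x = phi' 0%N x + s_ (res_dif R m x) by rewrite subrK.
  by rewrite s0 (linD fl) fd add0r.
exists (fun x => f (s i x)); first exact: (hom_compose (sh i) fh).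
by move=> x; rewrite -[phi i.+1 x]/(phi' i.+1 x) sE (linD fl) fd add0r.
Qed.

Lemma lifts_unique i m (f f' : P i -> N) (g g' : R m -> K) phi phi' :
  ghom None f -> (forall x, f (res_dif P i x) = 0) -> cob None (fun x => f x - f' x) ->
  lifts None g phi -> lifts None g' phi' -> cob None (fun x => g x - g' x) ->
  cob None (fun x => f (phi i x) - f' (phi' i x)).
Proof.
move=> fh fd ff' [ph p0 pd] [p'h p'0 p'd] gg'.
have c1 : cob None (fun x => f (phi i x - phi' i x)).
  apply: (@lifts_cob None _ _ f _ (fun t x => phi t x - phi' t x)) gg' => //; split.
  - by move=> t; exact: homB.
  - by move=> u; rewrite (linB (gh_lin (res_aug P))) p0 p'0.
  - by move=> t u; rewrite (linB (gh_lin (res_dif P t))) pd p'd.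
have c2 : cob None (fun x => f (phi' i x) - f' (phi' i x)).
  clear c1; case: i f f' fh fd ff' phi phi' ph p0 pd p'h p'0 p'd =>
      [|i] f f' fh fd ff' phi phi' ph p0 pd p'h p'0 p'd.
    have ff0 x : f x - f' x = 0 := ff' x.
    by apply: cob_ext (cob0 None R N (0 + m)) => x; rewrite ff0.
  move: ff' => [u uh uE]; exists (fun x => u (phi' i x)); first exact: hom_compose (p'h i) uh.
  by move=> x; rewrite uE p'd.
by apply: cob_ext (cobD c1 c2) => x; rewrite (linB (hom_linear fh)) subrKA.
Qed.

(** The product is given only as a relation; this makes every choice of representatives and of lift
    compute it. *)
Lemma yoneda_rep i m x y z (f : P i -> N) (g : R m -> K) phi :
  yoneda x y z -> rep x f -> rep y g -> lifts None g phi -> rep z (fun u => f (phi i u)).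
Proof.
move=> /yonedaP[f' [g' [h [phi' [xf' yg' zh phi'g' hE]]]]] xf yg phig.
have [ph _ pd] := phig.
apply: (rep_cob zh).
- exact: hom_compose (ph i) (rep_hom xf).
- by move=> u; rewrite -pd (rep_d _ xf).
apply: (@cob_ext _ _ _ _ _ _ _ (fun x => f' (phi' i x) - f (phi i x))).
  by move=> u; rewrite hE.
apply: lifts_unique phi'g' phig _ => //.
- exact: rep_hom xf'.
- by move=> u; exact: rep_d xf'.
- by apply/(rep_eq xf' xf).
- by apply/(rep_eq yg' yg).
Qed.

Lemma yoneda_deg i m x y z a b : x \in Ext_deg P N i a -> y \in Ext_deg R K m b ->
  yoneda x y z -> z \in Ext_deg R N (i + m) (b + a).
Proof.
move=> /Ext_degP[f fh xf] /Ext_degP[g gh yg] xyz.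
have [phi phig] := lifts_exist gh (fun u => rep_d u yg).
have [ph p0 pd] := phig.
have phig' : lifts None g phi by split=> // t; exact: hom_None (ph t).
apply/Ext_degP; exists (fun u => f (phi i u)); last exact: yoneda_rep xyz xf yg phig'.
exact: (hom_compose (ph i) fh).
Qed.

Lemma yoneda_prod_deg i m (X : {pred Ext P N i}) (Y : {pred Ext R K m}) a b :
  {subset X <= Ext_deg P N i a} -> {subset Y <= Ext_deg R K m b} ->
  {subset yoneda_prod X Y <= Ext_deg R N (i + m) (b + a)}.
Proof.
move=> Xa Yb; apply: lspan_min; first exact: Ext_deg_submod.
by move=> z [x [y [/Xa xa /Yb yb xyz]]]; exact: yoneda_deg xa yb xyz.
Qed.

End Yoneda.
End ExtClasses.

(** * Minimal resolutions *)

Section RightMultiplication.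
Variables (F : fieldType) (A : grAlg F).
Implicit Types (M N K : grMod A).
Local Notation T := (trivial_mod A).

(* The trivial module is the ring [A / J]; [rmul s t] is the product [t s]. *)
Definition rmul (s t : T) : T := sval (cid (tproj_surj t)) *: s.

Lemma rmulE s a : rmul s (tproj a) = a *: s.
Proof.
rewrite /rmul; case: cid => b /= /tproj_eq ab; apply/eqP; rewrite eq_sym -subr_eq0.
by rewrite -scalerBl Jrad_trivial.
Qed.

Lemma rmul_linear s : linear (rmul s).
Proof.
move=> a u v; have [b ->] := tproj_surj u; have [c ->] := tproj_surj v.
by rewrite tproj_scale -tprojD !rmulE scalerDl scalerA.
Qed.

Lemma rmulD s s' t : rmul (s + s') t = rmul s t + rmul s' t.
Proof. by rewrite /rmul scalerDr. Qed.

Lemma rmulB s s' t : rmul (s - s') t = rmul s t - rmul s' t.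
Proof. by rewrite /rmul scalerBr. Qed.

Lemma rmul0 t : rmul 0 t = 0.
Proof. by rewrite /rmul scaler0. Qed.

Lemma rmulZF (c : F) s t : rmul ((c%:A : A) *: s) t = (c%:A : A) *: rmul s t.
Proof. by rewrite /rmul !scalerA mulr_algl mulr_algr. Qed.

Lemma rmulA s s' t : rmul (rmul s s') t = rmul s (rmul s' t).
Proof.
have [a ->] := tproj_surj t; have [b ->] := tproj_surj s'.
by rewrite [rmul (tproj b) _]rmulE tproj_scale !rmulE scalerA.
Qed.

Lemma rmul_hom s : ghom (Some 0) (rmul s).
Proof.
apply/homjP; split=> [|i x xi]; first exact: rmul_linear.
rewrite subr0; have [->|i0] := eqVneq i 0; first exact: trivial_deg0.
by rewrite (trivial_deg xi i0) (lin0 (rmul_linear s)) gm_0.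
Qed.

Lemma endo_trivial (f : T -> T) : linear f -> forall t, f t = rmul (f (tproj 1)) t.
Proof.
move=> lf t; have [a ->] := tproj_surj t.
by rewrite rmulE -(linZ lf) tproj_scale mulr1.
Qed.

(** A degree-0 cocycle kills the kernel of the augmentation, so it factors through T; endomorphisms
    of the cyclic module T = A/J are right multiplications. *)
Lemma Ext0_rmul (P : resolution T) (c : Ext P T 0) :
  exists s : T, rep c (fun x => rmul s (res_aug P x)).
Proof.
have [f cf] := rep_ex c; have lf := hom_linear (rep_hom cf).
have /choice[u uE] t : exists x, res_aug P x = t by exact: res_surj.
have fE x : f x = f (u (res_aug P x)).
  apply/eqP; rewrite -subr_eq0 -(linB lf); apply/eqP.
  have /res_exact0[y ->] : res_aug P (x - u (res_aug P x)) = 0.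
    by rewrite (linB (gh_lin (res_aug P))) uE subrr.
  exact: rep_d cf.
have lfu : linear (fun t => f (u t)).
  move=> a t t'; rewrite -lf [RHS]fE; congr (f (u _)).
  by rewrite gh_linear !uE.
exists (f (u (tproj 1))); move: cf; congr rep; apply: funext => x.
by rewrite fE (endo_trivial lfu).
Qed.

(** Turns linearity over E^0(A) into a statement about values: the augmentation of a lift of g is g
    itself, so E^0 acts on cocycles by right multiplication in A/J. *)
Lemma yoneda0P (P : resolution T) M (R : resolution M) n (c : Ext P T 0) s
    (y z : Ext R T n) g : rep c (fun x => rmul s (res_aug P x)) -> rep y g ->
  yoneda c y z <-> rep z (fun x => rmul s (g x)).
Proof.
move=> cs yg; have [phi phig] := lifts_exist P (rep_hom yg) (fun x => rep_d x yg).
have [_ p0 _] := phig; split=> [cyz|zs].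
  have := yoneda_rep cyz cs yg phig; congr rep; apply: funext => x.
  by rewrite p0.
apply/yonedaP; exists (fun x => rmul s (res_aug P x)), g, (fun x => rmul s (g x)), phi.
by split=> // x; rewrite p0.
Qed.

End RightMultiplication.

Arguments yoneda0P {F A P M R n c s y z g}.

Section MinimalResolution.
Variables (F : fieldType) (A : grAlg F).
Local Notation T := (trivial_mod A).
Variables (Q : resolution T) (Q_min : minimal Q).

Lemma minimal_cocycle n o (g : Q n -> T) x : ghom o g -> g (res_dif Q n x) = 0.
Proof.
move=> gh; apply: (hom_JM gh); case: n g gh x => [|n] g gh x.
  by apply: Q_min.1; exact: res_augd.
by apply: Q_min.2; exact: res_dd.
Qed.

Lemma minimal_cob n o (g : Q n -> T) : cob o g -> forall x, g x = 0.
Proof.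
by case: n g => [|n] g //= [h hh gE] x; rewrite gE (minimal_cocycle _ hh).
Qed.

(** Over a minimal resolution every map to T is a cocycle and only 0 is a coboundary. Vanishing of
    Ext in degree j thus leaves no map Q_n -> k(j), and by [detect_JM] the degree-j component lies
    in J Q_n. *)
Lemma generated_of_vanish n (S : seq nat) : semisimple0 A -> locally_fd (Q n) ->
  (forall j, j \notin map Posz S -> vanish Q T n j) -> generated_in (Q n) S.
Proof.
move=> ss Qf vQ; apply: generated_in_bounded.
  by move=> j x; exact: (minimal_ge0 Q_min).
move=> j x xj jS; apply: (detect_JM ss (Qf j) xj) => y yh.
apply: (minimal_cob (o := Some j)); apply: vQ => //; last first.
  by move=> z; exact: minimal_cocycle yh.
by apply/negP => /mapP[s sS js]; have := jS s sS; rewrite js eqxx.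
Qed.

Lemma vanish_of_generated n (S : seq nat) : generated_in (Q n) S ->
  forall j, j \notin map Posz S -> vanish Q T n j.
Proof.
move=> Qg j jS f fh _.
have f0 : forall x, f x = 0.
  apply: (generated_hom0 Qg _ fh) => s sS; apply: contraNneq jS => ->.
  exact: map_f.
by apply: cob_ext (cob0 (Some j) Q T n) => x.
Qed.

(* Cohomology classes are the homomorphisms out of the terms of [Q]. *)
Lemma minimal_rep (P : resolution T) n : exists q : Ext P T n -> Q n -> resF T,
  [/\ linear q, forall z, ghom None (q z), injective q,
      forall j z, z \in Ext_deg P T n j -> ghom (Some j) (q z)
    & (forall g : Q n -> T, ghom None g -> exists z, q z = g) /\
      forall (c : Ext P T 0) s z z', rep c (fun x => rmul s (res_aug P x)) ->
        yoneda c z z' <-> q z' = (fun x => rmul s (q z x))].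
Proof.
have [al [be [[alh _ ald] [beh _ bed] Peq Qeq]]] := resolutions_eqv P Q.
have al_eq (z : Ext P T n) f f' : rep z f -> rep z f' -> forall x, f (al n x) = f' (al n x).
  move=> zf zf'; have ff' := minimal_cob (chain_cob alh ald ((rep_eq zf zf').1 erefl)).
  move=> x.
  by apply/eqP; rewrite -subr_eq0 ff'.
have /choice[q qP] z : exists g : Q n -> resF T, forall f, rep z f -> forall x, g x = f (al n x).
  by have [f zf] := rep_ex z; exists (fun x => f (al n x)) => f' zf'; exact: (al_eq _ _ _ zf zf').
have qh z : ghom None (q z).
  have [f zf] := rep_ex z; apply: hom_ext (hom_compose0l (alh n) (rep_hom zf)) => x.
  by rewrite (qP z f).
have ql : linear q.
  move=> a z z'; have [f zf] := rep_ex z; have [f' zf'] := rep_ex z'.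
  apply: funext => x; rewrite (qP _ _ (rep_lin a zf zf')).
  by rewrite -[RHS]/((a%:A : A) *: (q z x : T) + q z' x) (qP z f) // (qP z' f').
have qinj : injective q.
  move=> z z' zz'; apply/eqP; rewrite -subr_eq0; apply/eqP; set y := z - z'.
  have y0 : q y = 0 by rewrite (linB ql) zz' subrr.
  have [f yf] := rep_ex y; apply/(rep_eq0 yf).
  apply: cob_ext (Peq _ _ _ _ (rep_hom yf) (fun x => rep_d x yf)) => x.
  by rewrite -(qP y f) // y0 subr0.
exists q; split=> //.
  move=> j z /Ext_degP[f fh zf]; apply: hom_ext (hom_compose0l (alh n) fh) => x.
  by rewrite (qP z f).
split=> [g gh|c s z z' cs].
  have [||z zg] := @rep_of _ _ _ P T n (fun x => g (be n x)).
  - exact: hom_compose0l (beh n) gh.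
  - by move=> x; rewrite -bed (minimal_cocycle _ gh).
  exists z; apply: funext => x; rewrite (qP _ _ zg); apply/eqP; rewrite eq_sym -subr_eq0.
  apply/eqP; apply: (minimal_cob (o := None) (g := fun x => g x - g (be n (al n x)))).
  by apply: Qeq => // y; exact: minimal_cocycle gh.
have [f zf] := rep_ex z.
have [w wf] : exists w : Ext P T n, rep w (fun x => rmul s (f x)).
  apply: rep_of; first exact: hom_compose0r (rep_hom zf) (rmul_hom s).
  by move=> x; rewrite (rep_d _ zf) (lin0 (rmul_linear s)).
have wE : q w = fun x => rmul s (q z x).
  by apply: funext => x; rewrite (qP _ _ wf) (qP z f).
split=> [zz'|].
  have z's := (@yoneda0P _ _ P T P n c s z z' f cs zf).1 zz'.
  by apply: funext => x; rewrite (qP _ _ z's) (qP z f).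
rewrite -wE => /qinj ->.
exact: (@yoneda0P _ _ P T P n c s z w f cs zf).2 wf.
Qed.

(** A map of degree j to T is determined by its values on a finite spanning list of M_j. Evaluations
    are imposed one at a time, each having values in the finite-dimensional T. *)
Lemma homj_fdim M j : locally_fd M -> locally_fd T ->
  fdim (V := M -> resF T) (fun f => ghom (Some j) (f : M -> T)).
Proof.
move=> Mf Tf; have [s sE] := Mf j.
have evl (b : M) : linear (fun f : M -> resF T => f b) by [].
pose H (s : seq M) (f : M -> resF T) := ghom (Some j) (f : M -> T) /\ forall b, b \in s -> f b = 0.
have Hl s' : lclosed (H s').
  split=> [|a f g [fh f0] [gh g0]]; first by split=> //; exact: (hom0 _ _ (Some j)).
  split; first exact: (hom_linF (o := Some j)).
  by move=> b bs; rewrite -[LHS]/(a *: f b + g b) f0 // g0 // scaler0 addr0.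
have step s' : fdim (H s') -> fdim (H [::]).
  elim: s' => // b s' IHs Hf; apply: IHs.
  apply: (fdim_ext (f := fun f : M -> resF T => f b)) => //.
    by apply: fdim_sub (Tf 0) => t [f _ _]; exact: trivial_deg0.
  apply: fdim_sub Hf => f [[fh f0] fb]; split=> // b'.
  by rewrite inE => /orP[/eqP->|/f0].
apply: (@fdim_sub _ _ _ (H [::])) => [f fh //|]; apply: (step s).
exists [::] => f [fh f0]; rewrite (_ : f = 0) ?lspan0 //.
have lf := hom_linear (fh : ghom (Some j) (f : M -> T)).
apply: funext => x; elim/gr_ind: x => [|u v uf vf|i x xi].
- exact: (lin0 lf).
- by rewrite [LHS](linD lf) [X in X + _]uf [X in _ + X]vf; exact: addr0.
have [ij|ij] := eqVneq i j; last exact: homj_trivial_ne fh xi ij.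
rewrite ij in xi; have /eqP := xi; move/sE: xi => xs _.
apply/eqP; move: x xs; apply: (@lspan_min _ (resF M) _ [pred x | f x == 0]).
  split=> [|a u v]; rewrite !inE; first by rewrite [f 0](lin0 lf).
  by move=> /eqP u0 /eqP v0; rewrite [f _]lf u0 v0 scaler0 addr0.
by move=> b bs; rewrite inE f0.
Qed.

Lemma Ext_deg_fdim (P : resolution T) n j : (forall i, locally_fd (Q i)) -> locally_fd T ->
  fdim (fun z => z \in Ext_deg P T n j).
Proof.
move=> Qf Tf; have [q [ql qh qinj qd _]] := minimal_rep P n.
apply: (fdim_ext (f := q)) => //.
- by case: (Ext_deg_submod P T n j).
- by apply: fdim_sub (homj_fdim j (Qf n) Tf) => _ [z zj ->]; exact: qd.
- exists [::] => z [_ qz]; rewrite (qinj z 0) ?lspan0 //.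
  by rewrite (lin0 ql).
Qed.

End MinimalResolution.

(** * Syzygies *)

Section Generation.
Variables (F : fieldType) (A : grAlg F).
Implicit Types (M N K : grMod A).

Lemma generated_surj M N (f : grHom M N) S : (forall y, exists x, f x = y) ->
  generated_in M S -> generated_in N S.
Proof.
move=> fsurj Mg X [X0 Xl] XS y; have [x <-] := fsurj y.
apply: (Mg [pred x | f x \in X]) => [|s z sS zs]; last first.
  by rewrite inE; apply: (XS s) => //; exact: gh_deg.
split=> [|a u v]; rewrite !inE ?(lin0 (gh_lin f)) // => uX vX.
by rewrite gh_linear; exact: Xl.
Qed.

Lemma generated1_low M (b : nat) : generated_in M [:: b] ->
  forall j x, (j < b%:Z)%R -> x \in gm_deg M j -> x = 0.
Proof.
move=> Mg j x jb xj; apply: (trunc_deg0 _ xj jb).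
apply: Mg => [|s y]; first exact: trunc_submod.
by rewrite inE => /eqP-> yb; exact: (mem_trunc yb).
Qed.

Lemma generated1_high M (b : nat) : generated_in M [:: b] ->
  forall j x, (b%:Z < j)%R -> x \in gm_deg M j -> x \in JM M.
Proof.
move=> Mg j x bj xj.
suff : x - gcomp b%:Z x \in JM M.
  by rewrite (gcomp_ne xj) ?subr0 // lt_eqF.
suff /asboolP : x \in [pred x | `[< x - gcomp b%:Z x \in JM M >]] by [].
apply: Mg => [|s y]; last first.
  by rewrite inE => /eqP-> yb; apply/asboolP; rewrite gcomp_id // subrr grsub0.
split=> [|a u v /asboolP uJ /asboolP vJ]; apply/asboolP.
  by rewrite gcomp0 subr0 grsub0.
rewrite gcompD opprD addrACA; apply: grsubD => //.
elim/ga_ind: a => [|a a' aJ a'J|[|k] a ak].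
- by rewrite scale0r gcomp0 subr0 grsub0.
- by rewrite scalerDl gcompD opprD addrACA grsubD.
- by rewrite (gcomp_act _ _ ak) subr0 -scalerBr grsubZ.
- by apply: grsubB; rewrite ?grsub_comp //; exact: mem_JM ak.
Qed.

Lemma generated1_JM M (b : nat) : generated_in M [:: b] ->
  forall x, x \in JM M -> x \in gm_deg M b%:Z -> x = 0.
Proof.
move=> Mg x; apply: (@JM_ind _ _ M (fun x => x = 0)) => //.
  by move=> u v -> ->; rewrite addr0.
move=> k a y k0 ak yj; rewrite (generated1_low Mg _ yj) ?scaler0 //.
by rewrite gtrDl oppr_lt0 ltz_nat.
Qed.

Lemma JM_lift M N (f : grHom M N) y : (forall y, exists x, f x = y) ->
  y \in JM N -> exists2 x, x \in JM M & f x = y.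
Proof.
move=> fsurj /asboolP yJ.
suff /asboolP : y \in [pred y | `[< exists2 x, x \in JM M & f x = y >]] by [].
apply: yJ => [|_ [a [w [aJ ->]]]].
  split=> [|a u v /asboolP[x xJ <-] /asboolP[x' x'J <-]]; apply/asboolP.
    by exists 0; [exact: grsub0|exact: (lin0 (gh_lin f))].
  by exists (a *: x + x'); [apply: grsubD => //; exact: grsubZ|exact: gh_linear].
have [x <-] := fsurj w; apply/asboolP; exists (a *: x); last exact: (linZ (gh_lin f)).
by apply: mem_lspan; exists a, x.
Qed.

End Generation.

Section SyzygyResolution.
Variables (F : fieldType) (A : grAlg F) (K : grMod A) (Q : resolution K) (p : nat).

Lemma syz_cover_mem (x : Q p.+2) :
  res_dif Q p.+1 x \in Submod (ker_submod (res_dif Q p)).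
Proof. by rewrite inE res_dd. Qed.

Definition syz_cover_fun (x : Q p.+2) : syzygy Q p.+2 := LSub (syz_cover_mem x).

Lemma syz_cover_linear : linear syz_cover_fun.
Proof. by move=> a u v; apply: val_inj; exact: (gh_lin (res_dif Q p.+1)). Qed.

Lemma syz_cover_deg j x : x \in gm_deg (Q p.+2) j ->
  syz_cover_fun x \in gm_deg (syzygy Q p.+2) j.
Proof.
by move=> xj; change (res_dif Q p.+1 x \in gm_deg (Q p.+1) j); exact: gh_deg.
Qed.

Definition syz_cover : grHom (Q p.+2) (syzygy Q p.+2) :=
  GrHom syz_cover_linear syz_cover_deg.

Lemma syz_cover_surj y : exists x, syz_cover x = y.
Proof.
have := lsub_valP y; rewrite inE => /eqP/res_exact[x xE].
by exists x; apply: val_inj; rewrite /= xE.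
Qed.

Lemma syz_cover_exact : exact_at (res_dif Q p.+2) syz_cover.
Proof.
move=> y; rewrite -res_exact_at; split=> [/(congr1 val) //|y0].
by apply: val_inj.
Qed.

(** The tail of [Q] resolves the syzygy. The index has the form p + 2 because [syzygy] treats 0 and
    1 separately, and every 3n with n >= 1 has this form. *)
Definition syz_resolution : resolution (syzygy Q p.+2) :=
  @Resolution F A (syzygy Q p.+2) (fun t => Q (t + p.+2)%N)
    (fun t => res_dif Q (t + p.+2)%N) syz_cover
    (fun t => @res_proj _ _ _ Q (t + p.+2)%N) syz_cover_surj syz_cover_exact
    (fun t => @res_exact_at _ _ _ Q (t + p.+2)%N).

End SyzygyResolution.

(** * Restricting cocycles from a syzygy to its radical *)

Section Restriction.
Variables (F : fieldType) (A : grAlg F).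
Local Notation T := (trivial_mod A).
Hypothesis A0_ss : semisimple0 A.
Variables (P Q : resolution T) (p b : nat).
Hypotheses (Q_min : minimal Q) (Q_lfd : forall n, locally_fd (Q n))
  (Q_gen : generated_in (Q p.+2) [:: b]).
Local Notation m := p.+2.
Local Notation M := (syzygy Q p.+2).
Variable R : resolution (subGr (JM M)).

Lemma syz_gen : generated_in M [:: b].
Proof. exact: generated_surj (@syz_cover_surj _ _ _ Q p) Q_gen. Qed.

Lemma syz_lfd : locally_fd M.
Proof. exact: sub_lfd. Qed.

Lemma Jsyz_low j x : (j < b%:Z + 1)%R -> x \in gm_deg (subGr (JM M)) j -> x = 0.
Proof.
rewrite ltzD1 le_eqVlt => /orP[/eqP->|jb] xj; apply: val_inj.
  exact: (generated1_JM syz_gen (lsub_valP x) xj).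
exact: (generated1_low syz_gen jb xj).
Qed.

Lemma Ext_Jsyz_bound (t : int) i j (f : R i.+1 -> T) :
  (forall l, (l < t)%R -> vanish P T i.+1 l) -> (j < b%:Z + 1 + t)%R ->
  ghom (Some j) f -> (forall x, f (res_dif R i.+1 x) = 0) -> cob (Some j) f.
Proof.
move=> vP jt fh fd.
apply: (cob_bound A0_ss (P := P) (t := t) _ (b := b%:Z + 1)) => //.
- by move=> l g lt gh gd; exact: vP.
- by apply: sub_lfd; exact: syz_lfd.
- exact: Jsyz_low.
Qed.

(* [mu] induces the restriction of [Ext^(t + m)(k, k) = Ext^t(M, k)] to
   [Ext^t(J M, k)]; its kernel consists of the products. *)
Lemma restriction : exists mu : forall t, R t -> P (t + m)%N,
  [/\ (forall t, ghom (Some 0) (mu t)) /\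
      (forall t x, res_dif P (t + m)%N (mu t.+1 x) = mu t (res_dif R t x)),
      forall i (z : Ext P T (i.+1 + m)) f, rep z f ->
        cob None (fun x => f (mu i.+1 x)) ->
        z \in yoneda_prod (E_all P i.+1) (E_all P m),
      forall i (X : {pred Ext P T i.+1}) (Y : {pred Ext P T m}) (z : Ext P T (i.+1 + m)) f,
        z \in yoneda_prod X Y -> rep z f -> cob None (fun x => f (mu i.+1 x))
    & forall i j (w : R i.+1 -> T), ghom (Some j) w ->
        (forall x, w (res_dif R i.+1 x) = 0) -> vanish P T i.+2 (j - b%:Z) ->
        exists f : P (i.+1 + m)%N -> T, [/\ ghom (Some j) f,
          forall x, f (res_dif P (i.+1 + m)%N x) = 0
          & cob None (fun x => f (mu i.+1 x) - w x)]].
Proof.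
pose S := syz_resolution Q p.
have [al [be [[alh al0 ald] [beh be0 bed] Peq Qeq]]] := resolutions_eqv P Q.
have [iota [iotah iota0 iotad]] := res_compare R S (hom_gr (subval (JM M))).
pose mu t x := al (t + m)%N (iota t x).
have muh t : ghom (Some 0) (mu t) by exact: (hom_compose0l (iotah t) (alh (t + m)%N)).
have mud t x : res_dif P (t + m)%N (mu t.+1 x) = mu t (res_dif R t x).
  by rewrite /mu ald -[res_dif Q _ (iota t.+1 x)]/(res_dif S t (iota t.+1 x)) iotad.
have mucob o i (f : P (i.+1 + m)%N -> T) : cob o f -> cob o (fun x => f (mu i.+1 x)).
  move=> [g gh gE]; exists (fun x => g (mu i x)); first exact: hom_compose0l (muh i) gh.
  by move=> x; rewrite gE mud.
have iotacob o i (f : Q (i.+1 + m)%N -> T) : cob o f -> cob o (fun x => f (iota i.+1 x)).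
  move=> [g gh gE]; exists (fun x => g (iota i x)); first exact: hom_compose0l (iotah i) gh.
  by move=> x; rewrite gE -iotad.
exists mu; split=> //.
- move=> i z f zf fmu.
  pose g x := f (al (i.+1 + m)%N x).
  have gh : ghom None g := hom_compose0l (alh _) (rep_hom zf).
  have gd x : g (res_dif S i.+1 x) = 0 by exact: (minimal_cocycle Q_min _ gh).
  case: fmu => u uh uE.
  have [k [y [Phi [h [w [[yh Phih Phi0 Phid] hh hd wh gE]]]]]] :=
    @bottom_layer_lift _ _ A0_ss M b%:Z (JM M) (syz_lfd b%:Z) (generated1_low syz_gen)
      (generated1_high syz_gen) (generated1_JM syz_gen) P S R iota iotah iota0 iotad
      None i g u gh gd uh uE.
  (* The functionals on M, pulled back to P_m, are cocycles representing elements of E^m(A), and the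
     chain maps [Phi l] are lifts of them; each summand [h l \o Phi l] is therefore a Yoneda
     product. *)
  pose y' l (x : P m) : T := y l (res_aug S (be m x)).
  have y'h l : ghom (Some b%:Z) (y' l).
    exact: (hom_compose0l (hom_compose0l (beh m) (hom_gr (res_aug S))) (yh l)).
  have y'd l x : y' l (res_dif P m x) = 0.
    rewrite /y' -bed -[res_dif Q m _]/(res_dif S 0 _) res_augd.
    exact: (lin0 (hom_linear (yh l))).
  have /choice[Y YP] l := rep_of (hom_None (y'h l)) (y'd l).
  have /choice[H HP] l := rep_of (hh l : ghom None (h l)) (hd l).
  have philift l : lifts None (y' l) (fun t x => Phi l t (be (t + m)%N x)).
    split=> [t|x|t x].
    - exact: hom_None (hom_compose0l (beh _) (Phih l t)).
    - exact: Phi0.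
    - by rewrite Phid -bed.
  have /choice[W WP] l : exists W : Ext P T (i.+1 + m), rep W (fun x => h l (Phi l i.+1 (be (i.+1 + m)%N x))).
    have [ph _ pd] := philift l; apply: rep_of; first exact: hom_compose (ph i.+1) (hh l).
    by move=> x; rewrite -pd hd.
  have -> : z = \sum_l W l.
    apply/(rep_eq zf (rep_sum _ WP)).
    apply: (@cob_ext _ _ _ _ _ _ _ (fun x => (f x - g (be _ x)) + w (be (i + m)%N (res_dif P (i + m)%N x)))).
      move=> x; rewrite gE -[res_dif S i _]/(res_dif Q (i + m)%N _) bed.
      by rewrite opprD addrA subrK.
    apply: cobD; first by apply: Peq; [exact: rep_hom zf|move=> x; exact: rep_d zf].
    by exists (fun x => w (be (i + m)%N x)); first exact: hom_compose0l (beh _) wh.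
  apply: lspan_sum => l _; apply: mem_lspan; exists (H l), (Y l); split=> //.
  by apply/yonedaP; exists (h l), (y' l), (fun x => h l (Phi l i.+1 (be (i.+1 + m)%N x))),
    (fun t x => Phi l t (be (t + m)%N x)).
- move=> i X Y z f zXY.
  pose C : {pred Ext P T (i.+1 + m)} :=
    [pred z | `[< exists2 f, rep z f & cob None (fun x => f (mu i.+1 x)) >]].
  have /asboolP[f' zf' cf'] : z \in C.
    apply: lspan_min zXY => [|z' [x [y [_ _ xyz]]]].
      split=> [|a u v /asboolP[g ug gc] /asboolP[h vh hc]]; apply/asboolP.
        by exists (fun=> 0); [exact: rep0|exact: (cob0 None R T i.+1)].
      by exists (fun x => (a%:A : A) *: g x + h x);
        [exact: rep_lin|apply: cobD => //; exact: cobZF].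
    have [f0 [g [h [phi [xf yg zh [ph p0 pd] hE]]]]] := (yonedaP x y _).1 xyz.
    apply/asboolP; exists h => //.
    apply: (@cob_ext _ _ _ _ _ _ _ (fun x => f0 (phi i.+1 (mu i.+1 x)))).
      by move=> u; rewrite hE.
    apply: (htpy_cob_oadd (o := None) (o' := None) (psi := fun t x => phi t (mu t x)) (rep_hom xf)).
    - by move=> u; exact: rep_d xf.
    - by move=> t; exact: hom_compose0l (muh t) (ph t).
    - move=> u; rewrite p0 /mu /=.
      have gal : ghom None (fun v => g (al m v)) by exact: hom_compose0l (alh m) (rep_hom yg).
      (* Over JM the element [iota 0%N u] differs from an element of J Q_m by a boundary. A map from
         Q_m to T kills both by minimality, so the lift restricted to JM covers 0 and the product
         restricts to a coboundary. *)
      have [q qJ qE] := JM_lift (f := syz_cover Q p) (@syz_cover_surj _ _ _ Q p)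
        (lsub_valP (res_aug R u) : lsub_val (res_aug R u) \in JM M).
      have : syz_cover Q p (iota 0%N u - q) = 0.
        rewrite (linB (gh_lin (syz_cover Q p))) qE.
        by rewrite -[syz_cover Q p (iota 0%N u)]/(res_aug S (iota 0%N u)) iota0 subrr.
      move=> /syz_cover_exact[r rE].
      have := minimal_cocycle Q_min r gal; rewrite -rE.
      rewrite (linB (hom_linear gal)) [X in _ - X](hom_JM gal qJ) subr0.
      exact.
    - by move=> t u; rewrite pd mud.
  move=> zf; have c := mucob _ _ _ ((rep_eq zf zf').1 erefl).
  by apply: cob_ext (cobD c cf') => x; rewrite subrK.
- move=> i j w wh wd vP.
  (* The obstruction lies in the cohomology of the layer M/JM, which sits in degree b; hence it is
     tested in degree j - b of E^(i+2)(A). *)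
  have [|z [v [zh zd vh zE]]] :=
    @bottom_layer_extend _ _ A0_ss M b%:Z (JM M) (syz_lfd b%:Z) (generated1_low syz_gen)
      (generated1_high syz_gen) (generated1_JM syz_gen) P S R iota iotah iota0 iotad
      (Some j) i w wh wd.
    rewrite /= addrC => f fh fd; have [g gh gE] := vP f fh fd.
    by exists g.
  exists (fun x => z (be (i.+1 + m)%N x)); split.
  + exact: hom_compose0l (beh _) zh.
  + by move=> x; rewrite -bed; exact: zd.
  apply: (@cob_ext _ _ _ _ _ _ _ (fun x => v (res_dif R i x) -
      (z (iota i.+1 x) - z (be (i.+1 + m)%N (al (i.+1 + m)%N (iota i.+1 x)))))).
    by move=> x; rewrite zE opprB addrCA opprD (addrCA (v _)) subrr addr0.
  apply: cobB; first by exists v => //; exact: hom_None vh.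
  apply: cob_None (iotacob _ _ _ (Qeq (Some j) _ _ z zh _)) => x; exact: zd.
Qed.

End Restriction.

(** * Restriction to the radical of a syzygy *)

Section DualSystem.
Variables (F : fieldType) (A : grAlg F).
Local Notation T := (trivial_mod A).
Hypothesis A0_ss : semisimple0 A.
Variables (X : grMod A) (G : (X -> T) -> Prop).
Hypotheses (G_lin : forall f, G f -> linear f) (G0 : G (fun=> 0))
  (GD : forall f g, G f -> G g -> G (fun x => f x + g x))
  (GB : forall f g, G f -> G g -> G (fun x => f x - g x))
  (GM : forall s f, G f -> G (fun x => rmul s (f x))).

(* The right module spanned by the [h i] is split off by the projection
   [z |-> \sum_k z(v_k) x_k]. *)
Lemma dual_system (h : nat -> X -> T) r : (forall i, (i < r)%N -> G (h i)) ->
  exists n (x : 'I_n -> X -> T) (v : 'I_n -> X),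
  [/\ forall l, G (x l), forall l u, x l u = \sum_k rmul (x l (v k)) (x k u)
    & forall i u, (i < r)%N -> h i u = \sum_k rmul (h i (v k)) (x k u)].
Proof.
elim: r => [|r IHr] Gh.
  by exists 0%N, (fun _ _ => 0), (fun=> 0); split=> // -[].
have [|n [x [v [Gx xE hE]]]] := IHr; first by move=> i ir; apply: Gh; exact: ltnW.
pose p (z : X -> T) u := \sum_k rmul (z (v k)) (x k u).
have Gp z : G (p z).
  rewrite /p; have : forall l, G (fun u => rmul (z (v l)) (x l u)) by move=> l; exact: GM.
  move: (fun l u => rmul (z (v l)) (x l u)) => f Gf; elim: (index_enum _) => [|l s IHs].
    by have := G0; congr G; apply: funext => u; rewrite big_nil.
  by have := GD (Gf l) IHs; congr G; apply: funext => u; rewrite big_cons.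
have Ghr := Gh r (ltnSn r).
pose h0 u := h r u - p (h r) u.
have Gh0 : G h0 by exact: GB.
have lh0 := G_lin Gh0.
(* The values of the remainder h0 form a left ideal of A_0 = A/J. If e is its right identity and h0
   takes the value e at v0, then right multiplication by h0(v0) fixes h0. *)
pose I : {pred A} := [pred a | (a \in ga_deg A 0) && `[< exists u, tproj a = h0 u >]].
have II : left_ideal0 I.
  split.
  - by move=> a /andP[].
  - by rewrite inE ga0_0; apply/asboolP; exists 0; rewrite tproj0 (lin0 lh0).
  - move=> a a' /andP[a0 /asboolP[u uE]] /andP[a'0 /asboolP[u' u'E]].
    by rewrite inE ga0_D //; apply/asboolP; exists (u + u'); rewrite tprojD uE u'E (linD lh0).
  - move=> a a' a0 /andP[a'0 /asboolP[u uE]].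
    by rewrite inE ga0_M //; apply/asboolP; exists (a *: u); rewrite -tproj_scale uE (linZ lh0).
have [e /andP[e0 /asboolP[v0 v0E]] eP] := left_ideal_idem A0_ss II.
have /choice[c cE] k := tproj_surj (x k v0).
(* The correction makes every z with p z = z vanish at [vn], in particular the earlier [x k], and
   keeps the value of h0 because p h0 = 0. *)
pose vn := v0 - \sum_k c k *: v k.
have vnE z : linear z -> z vn = z v0 - p z v0.
  move=> lz; rewrite (linB lz) (lin_sum lz); congr (_ - _); apply: eq_bigr => k _.
  by rewrite (linZ lz) cE rmulE.
have vn0 z : linear z -> (forall u, z u = p z u) -> z vn = 0.
  by move=> lz zp; rewrite vnE // -zp subrr.
have pp z u : p (p z) u = p z u.
  rewrite /p; transitivity (\sum_k \sum_l rmul (rmul (z (v l)) (x l (v k))) (x k u)).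
    apply: eq_bigr => k _.
    by apply: (big_morph (fun s => rmul s (x k u)) (fun s s' => rmulD s s' _) (rmul0 _)).
  rewrite exchange_big; apply: eq_bigr => l _; rewrite [in RHS]xE.
  rewrite (lin_sum (rmul_linear _)); apply: eq_bigr => k _; exact: rmulA.
have pB z z' u : p (fun w => z w - z' w) u = p z u - p z' u.
  by rewrite /p -sumrB; apply: eq_bigr => k _; exact: rmulB.
have ph0 u : p h0 u = 0 by rewrite pB pp subrr.
have h0vn : h0 vn = tproj e by rewrite vnE // ph0 subr0 v0E.
have h0E u : rmul (h0 vn) (h0 u) = h0 u.
  have [a a0 aE] := tproj_surj0 (h0 u).
  rewrite h0vn aE rmulE tproj_scale -eP //.
  by rewrite inE a0; apply/asboolP; exists u.
exists n.+1, (fun i => oapp x h0 (unlift ord0 i)), (fun i => oapp v vn (unlift ord0 i)).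
have sumE z u : \sum_(k < n.+1) rmul (z (oapp v vn (unlift ord0 k)))
    (oapp x h0 (unlift ord0 k) u) = rmul (z vn) (h0 u) + p z u.
  rewrite big_ord_recl unlift_none /=; congr (_ + _).
  by apply: eq_bigr => k _; rewrite liftK.
split=> [l|l u|i u].
- by case: (unlift ord0 l) => [l'|] /=.
- rewrite (sumE (oapp x h0 (unlift ord0 l))); case: (unlift ord0 l) => [l'|] /=.
    by rewrite vn0 ?rmul0 ?add0r //; exact: G_lin.
  by rewrite h0E ph0 addr0.
rewrite ltnS leq_eqVlt sumE => /orP[/eqP->|ir].
  rewrite vnE; last exact: G_lin.
  by rewrite -[_ - _]/(h0 v0) -v0E -h0vn h0E /h0 subrK.
rewrite vn0; [by rewrite rmul0 add0r hE|exact: G_lin (Gh i (ltnW ir))|].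
by move=> w; rewrite hE.
Qed.

End DualSystem.

(** * The restriction map on Ext classes *)

Section RestrictionMap.
Variables (F : fieldType) (A : grAlg F).
Local Notation T := (trivial_mod A).
Hypothesis A0_ss : semisimple0 A.
Variables (P Q : resolution T) (p b : nat).
Hypotheses (Q_min : minimal Q) (Q_lfd : forall n, locally_fd (Q n))
  (Q_gen : generated_in (Q p.+2) [:: b]).
Local Notation m := p.+2.
Variable R : resolution (subGr (JM (syzygy Q p.+2))).

(** Restriction precomposes with a chain map while E^0(A) acts by right multiplication on values, so
    the two commute. *)
Lemma restriction_map i : exists rho : Ext P T (i.+1 + m) -> Ext R T i.+1,
  [/\ linear rho,
      forall z, rho z = 0 <-> z \in yoneda_prod (E_all P i.+1) (E_all P m),
      (forall j z, z \in Ext_deg P T (i.+1 + m) j -> rho z \in Ext_deg R T i.+1 j) /\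
      (forall (t : int) j z, (forall l, (l < t)%R -> vanish P T i.+1 l) ->
         (j < b%:Z + 1 + t)%R -> z \in Ext_deg P T (i.+1 + m) j -> rho z = 0),
      forall j y, y \in Ext_deg R T i.+1 j -> vanish P T i.+2 (j - b%:Z) ->
        exists2 z, z \in Ext_deg P T (i.+1 + m) j & rho z = y
    & forall (c : Ext P T 0) (z z' : Ext P T (i.+1 + m)),
        yoneda c z z' -> yoneda c (rho z) (rho z')].
Proof.
have [mu [[muh mud] K1 K2 K3]] := restriction A0_ss P Q_min Q_lfd Q_gen R.
have mucob o (f : P (i.+1 + m)%N -> T) : cob o f -> cob o (fun x => f (mu i.+1 x)).
  move=> [g gh gE]; exists (fun x => g (mu i x)); first exact: hom_compose0l (muh i) gh.
  by move=> x; rewrite gE mud.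
have repmu (z : Ext P T (i.+1 + m)) f : rep z f -> exists y, rep y (fun x => f (mu i.+1 x)).
  move=> zf; apply: rep_of; first exact: hom_compose0l (muh _) (rep_hom zf).
  by move=> x; rewrite -mud (rep_d _ zf).
have /choice[rho rhoP] (z : Ext P T (i.+1 + m)) : exists y : Ext R T i.+1,
    forall f, rep z f -> rep y (fun x => f (mu i.+1 x)).
  have [f zf] := rep_ex z; have [y yf] := repmu _ _ zf; exists y => f' zf'.
  have [y' y'f'] := repmu _ _ zf'; suff -> : y = y' by [].
  apply/(rep_eq yf y'f'); apply: (mucob None (fun x => f x - f' x)).
  exact: ((rep_eq zf zf').1 erefl).
exists rho; split.
- move=> a z z'; have [f zf] := rep_ex z; have [f' zf'] := rep_ex z'.
  apply/(rep_eq (rhoP _ _ (rep_lin a zf zf')) (rep_lin a (rhoP _ _ zf) (rhoP _ _ zf'))).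
  by apply: cob_ext (cob0 None R T i.+1) => x; rewrite subrr.
- move=> z; have [f zf] := rep_ex z; rewrite (rep_eq0 (rhoP _ _ zf)).
  by split=> [|zX]; [exact: K1|exact: K2 zX zf].
- split=> [j z /Ext_degP[f fh zf]|t j z vP jt /Ext_degP[f fh zf]].
    by apply/Ext_degP; exists (fun x => f (mu i.+1 x));
      [exact: hom_compose0l (muh _) fh|exact: rhoP].
  apply/(rep_eq0 (rhoP _ _ zf)); apply: (@cob_None _ _ (Some j)).
  apply: (Ext_Jsyz_bound A0_ss Q_lfd Q_gen vP jt); first exact: hom_compose0l (muh _) fh.
  by move=> x; rewrite -mud (rep_d _ zf).
- move=> j y /Ext_degP[w wh yw] vP.
  have [f [fh fd fw]] := K3 i j w wh (fun x => rep_d x yw) vP.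
  have [z zf] := rep_of (hom_None fh) fd; exists z; first by apply/Ext_degP; exists f.
  exact/(rep_eq (rhoP _ _ zf) yw).
- move=> c z z' czz'; have [s cs] := Ext0_rmul c; have [f zf] := rep_ex z.
  have z'f : rep z' (fun x => rmul s (f x)).
    exact: (@yoneda0P _ _ P T P (i.+1 + m) c s z z' f cs zf).1.
  exact: (@yoneda0P _ _ P _ R i.+1 c s (rho z) (rho z') _ cs (rhoP _ _ zf)).2 (rhoP _ _ z'f).
Qed.

End RestrictionMap.

(** * The second cohomology of the radical of a syzygy *)

Section SecondLayer.
Variables (F : fieldType) (A : grAlg F).
Local Notation T := (trivial_mod A).
Hypothesis A0_ss : semisimple0 A.
Variables (P Q : resolution T) (p b d : nat).
Hypotheses (Q_min : minimal Q) (Q_lfd : forall n, locally_fd (Q n))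
  (T_lfd : locally_fd T) (Q_gen : generated_in (Q p.+2) [:: b]).
Local Notation m := p.+2.
Variable R : resolution (subGr (JM (syzygy Q p.+2))).
Hypothesis P3_vanish : vanish P T 3 (d + 1)%N%:Z.

Local Notation W := (Ext P T (2 + m)).
Local Notation S := [:: (b + d)%N%:Z; (b + d + 1)%N%:Z].

Lemma uniq_degrees : uniq S.
Proof. by rewrite /= inE andbT eqz_nat addn1 neq_ltn ltnSn. Qed.

(** Degree d + 1 of E^3(A) is where the obstruction to lifting Ext^2 of JM in degree b + d + 1
    lives. *)
Lemma degree_shift : (b + d + 1)%N%:Z - b%:Z = (d + 1)%N%:Z.
Proof. by rewrite -addnA PoszD addrC addKr. Qed.

(** The kernel of [rho] consists of the products and its image is the component of degree b + d + 1.
    An E^0-linear retraction [pr] onto the kernel makes z |-> (pr z, rho z) the desired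
    isomorphism. *)
Lemma dsum_iso : (forall l, (l < d%:Z)%R -> vanish P T 2 l) ->
  (forall j, j \notin S -> vanish P T (2 + m) j) ->
  E0_iso_dsum (E_mul (E_all P 2) (E_all P m)) (Ext_deg R T 2 (b + d + 1)%N%:Z).
Proof.
move=> P2_vanish PW.
have [rho [rl rker [rdeg rbound] rsurj rE0]] :=
  restriction_map A0_ss P Q_min Q_lfd Q_gen R 1.
have [q [ql qh qinj qd [qsurj qE0]]] := minimal_rep Q_min P (2 + m).
have decomp (z : W) : exists u v, [/\ u \in Ext_deg P T (2 + m) (b + d)%N%:Z,
    v \in Ext_deg P T (2 + m) (b + d + 1)%N%:Z & z = u + v].
  have [w wd ->] := vanish_sum z uniq_degrees PW.
  by exists (w (b + d)%N%:Z), (w (b + d + 1)%N%:Z); rewrite big_cons big_seq1.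
have W_fd : fdim (fun _ : W => True).
  apply: fdim_sub (fdim_cup (Ext_deg_fdim Q_min P (2 + m) (b + d)%N%:Z Q_lfd T_lfd)
    (Ext_deg_fdim Q_min P (2 + m) (b + d + 1)%N%:Z Q_lfd T_lfd)) => z _.
  by have [u [v [? ? ->]]] := decomp z; exists u, v.
have Xl : lclosed (fun z : W => rho z = 0).
  by split=> [|a u v u0 v0]; [exact: (lin0 rl)|rewrite rl u0 v0 scaler0 addr0].
have [s sX sE] := fdim_basis Xl (fdim_sub (fun _ _ => I) W_fd).
(* Viewed inside the maps Q_(2+m) -> T, the kernel of [rho] is closed under right multiplications
   because [rho] is E^0-linear, and [s] spans it; so [dual_system] provides a projection onto it. *)
pose G (f : Q (2 + m)%N -> T) := exists2 z, rho z = 0 & q z = f.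
have GL f g a : G f -> G g -> G (fun x => (a%:A : A) *: f x + g x).
  move=> [z z0 <-] [z' z'0 <-]; exists (a *: z + z'); first exact: Xl.2.
  by rewrite ql.
have GM t f : G f -> G (fun u => rmul t (f u)).
  move=> [z z0 <-].
  have [c ct] : exists c : Ext P T 0, rep c (fun x => rmul t (res_aug P x)).
    apply: rep_of; first exact: hom_None (hom_compose0l (hom_gr (res_aug P)) (rmul_hom t)).
    by move=> u; rewrite res_augd (lin0 (rmul_linear t)).
  have [z' z'E] := qsurj (fun u => rmul t (q z u)) (hom_compose0r (qh z) (rmul_hom t)).
  exists z' => //; have zz' : yoneda c z z' by apply/(qE0 _ _ _ _ ct).
  have := rE0 _ _ _ zz'; rewrite z0 => /(yoneda0P ct (rep0 R T 2)) r0.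
  apply/(rep_eq0 r0); apply: cob_ext (cob0 None R T 2) => u.
  by rewrite (lin0 (rmul_linear t)).
have [|||||n [x [v [Gx xE hE]]]] := @dual_system _ _ A0_ss _ G _ _ _ _ GM
    (fun i => q s`_i) (size s).
- by move=> _ [z _ <-]; exact: hom_linear (qh z).
- by exists 0; [exact: (lin0 rl)|rewrite (lin0 ql)].
- move=> f g fG gG; have := GL _ _ 1 fG gG; congr G; apply: funext => u.
  by rewrite !scale1r.
- move=> f g fG gG; have := GL _ _ (-1) gG fG; congr G; apply: funext => u.
  by rewrite !scaleN1r addrC.
- by move=> i iS; exists s`_i => //; apply: sX; exact: mem_nth.
have /choice[pr prE] (z : W) : exists z', q z' = fun u => \sum_k rmul (q z (v k)) (x k u).
  apply: qsurj; apply: hom_sum => k _; have [y _ <-] := Gx k.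
  exact: hom_compose0r (qh y) (rmul_hom _).
have prl : linear pr.
  move=> a z z'; apply: qinj; rewrite prE ql; apply: funext => u.
  rewrite ql -[RHS]/((a%:A : A) *: (q (pr z) u : T) + q (pr z') u) !prE.
  rewrite scaler_sumr -big_split /=; apply: eq_bigr => k _.
  by rewrite rmulD rmulZF.
have prX z : rho z = 0 -> pr z = z.
  move=> /sE zs; apply/eqP; move: z zs.
  apply: (@lspan_min _ _ _ [pred z | pr z == z]).
    split=> [|a u u']; rewrite !inE; first by rewrite (lin0 prl).
    by move=> /eqP uE /eqP u'E; rewrite prl uE u'E.
  move=> g gs; rewrite inE; apply/eqP; apply: qinj; rewrite prE; apply: funext => u.
  by have := hE (index g s) u; rewrite index_mem nth_index // => ->.
have rho_pr z : rho (pr z) = 0.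
  suff [z' z'0 /qinj <-] : G (q (pr z)) by [].
  rewrite prE; elim: (index_enum _) => [|k r IHr].
    exists 0; first exact: (lin0 rl).
    by rewrite (lin0 ql); apply: funext => u; rewrite big_nil.
  have := GL _ _ 1 (GM (q z (v k)) _ (Gx k)) IHr; congr G; apply: funext => u.
  by rewrite big_cons !scale1r.
pose phi (z : W) : W * Ext R T 2 := (pr z, rho z).
have phil : linear phi by move=> a u u'; rewrite /phi prl rl.
pose phiL : {linear E P (2 + m) -> (E P (2 + m) * Ext R T 2)%type} :=
  HB.pack phi (GRing.isLinear.Build F _ _ _ phi phil).
exists phiL; split.
- move=> z z' [przz' rhozz']; apply/eqP; rewrite -subr_eq0 -(prX (z - z')).
    by rewrite (linB prl) przz' subrr.
  by rewrite (linB rl) rhozz' subrr.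
- move=> [w1 w2] /=; split=> [[z [<- <-]]|[w1X w2Y]].
    split; first exact/rker.
    (* The component in degree b + d restricts to 0, because b + d < b + 1 + d. *)
    have [u [u' [ud u'd ->]]] := decomp z.
    rewrite (linD rl) (rbound d%:Z _ u P2_vanish _ ud) ?add0r; first exact: rdeg.
    by rewrite -!PoszD ltz_nat addn1 addSn.
  have [z2 _ z2E] : exists2 z, z \in Ext_deg P T (2 + m) (b + d + 1)%N%:Z & rho z = w2.
    by have := rsurj _ _ w2Y; rewrite degree_shift; apply.
  have w1E := (rker w1).2 w1X.
  (* z2 - pr z2 has the same restriction as z2 and is killed by the retraction, while w1 lies in the
     kernel of [rho] and is fixed by it. *)
  exists (w1 + z2 - pr z2); congr (_, _).
    rewrite -[pr _]/(pr (w1 + z2 - pr z2)) (linB prl) (linD prl) (prX w1) //.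
    by rewrite (prX (pr z2)) // addrK.
  by rewrite -[rho _]/(rho (w1 + z2 - pr z2)) (linB rl) (linD rl) w1E rho_pr subr0 add0r.
- move=> c e e' ee'; split; last exact: rE0.
  have [t ct] := Ext0_rmul c; apply/(qE0 _ _ _ _ ct); rewrite /= !prE.
  apply: funext => u; rewrite (lin_sum (rmul_linear t)); apply: eq_bigr => k _.
  by rewrite ((qE0 _ _ _ _ ct).1 ee') rmulA.
Qed.

(** The given isomorphism need not involve [rho], so only its injectivity into X (+) Y is used.
    [rho] alone gives a subspace of dimension dim X + dim Y inside the two allowed degrees: the
    products together with lifts of a basis of Y. A class outside those degrees would exceed the
    dimension of X (+) Y. *)
Lemma concentrated_of_iso :
  {subset E_all P 2 <= [pred z | `[< exists u v, [/\ u \in Ext_deg P T 2 d%:Z,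
     v \in Ext_deg P T 2 (d + 1)%N%:Z & z = u + v] >]]} ->
  (forall j, j != b%:Z -> vanish P T m j) ->
  E0_iso_dsum (E_mul (E_all P 2) (E_all P m)) (Ext_deg R T 2 (b + d + 1)%N%:Z) ->
  forall j, j \notin S -> vanish P T (2 + m) j.
Proof.
move=> P2_deg Pm_deg [phi [phi_inj phi_im _]].
have [rho [rl rker [rdeg rbound] rsurj rE0]] :=
  restriction_map A0_ss P Q_min Q_lfd Q_gen R 1.
pose X (z : W) := rho z = 0.
have Xl : lclosed X.
  by split=> [|a u v u0 v0]; [exact: (lin0 rl)|rewrite /X rl u0 v0 scaler0 addr0].
pose D (z : W) := exists u v, [/\ u \in Ext_deg P T (2 + m) (b + d)%N%:Z,
    v \in Ext_deg P T (2 + m) (b + d + 1)%N%:Z & z = u + v].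
have E0 j : 0 \in Ext_deg P T (2 + m) j by case: (Ext_deg_submod P T (2 + m) j).
have Dl : lclosed D.
  split=> [|a _ _ [u [v [uD vD ->]]] [u' [v' [u'D v'D ->]]]].
    by exists 0, 0; rewrite addr0; split=> //; exact: E0.
  exists (a *: u + u'), (a *: v + v'); split.
  - by case: (Ext_deg_submod P T (2 + m) (b + d)%N%:Z) => _; apply.
  - by case: (Ext_deg_submod P T (2 + m) (b + d + 1)%N%:Z) => _; apply.
  - by rewrite scalerDr addrACA.
have D_fd : fdim D.
  exact: fdim_cup (Ext_deg_fdim Q_min P (2 + m) (b + d)%N%:Z Q_lfd T_lfd)
    (Ext_deg_fdim Q_min P (2 + m) (b + d + 1)%N%:Z Q_lfd T_lfd).
(* The kernel of [rho] consists of products, and factors of degrees d or d + 1 and of degree b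
   multiply into the two allowed degrees. *)
have XD z : X z -> D z.
  move=> /rker; pose D' : {pred W} := [pred z | `[< D z >]].
  suff : {subset yoneda_prod (E_all P 2) (E_all P m) <= D'} by move=> h /h/asboolP.
  apply: lspan_min => [|z' [x [y [x2 _ xyz']]]].
    split=> [|a u v /asboolP uD /asboolP vD]; apply/asboolP; first exact: Dl.1.
    exact: Dl.2.
  have [x1 [x1' [x1D x1'D xE]]] := asboolW (P2_deg x x2).
  have yb : y \in Ext_deg P T m b%:Z.
    have [|w wd ->] := vanish_sum y (S := [:: b%:Z]) isT; last by rewrite big_seq1.
    by move=> j; rewrite inE; exact: Pm_deg.
  have /Ext_degP[g gh yg] := yb.
  have [phi' [ph p0 pd]] := lifts_exist P gh (fun u => rep_d u yg).
  have phig : lifts None g phi' by split=> // t; exact: hom_None (ph t).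
  have /Ext_degP[f fh xf] := x1D; have /Ext_degP[f' f'h xf'] := x1'D.
  have prod_deg j (h : P 2 -> T) (x0 : Ext P T 2) : ghom (Some j) h -> rep x0 h ->
      exists2 w : W, w \in Ext_deg P T (2 + m) (b%:Z + j) & rep w (fun u => h (phi' 2 u)).
    move=> hh xh; have [||w wh] := @rep_of _ _ _ P T (2 + m) (fun u => h (phi' 2 u)).
    - exact: hom_None (hom_compose (ph 2%N) hh).
    - by move=> u; rewrite -pd (rep_d _ xh).
    exists w => //; apply/Ext_degP; exists (fun u => h (phi' 2 u)) => //.
    exact: (hom_compose (ph 2%N) hh).
  have [u uD uf] := prod_deg _ _ _ fh xf; have [v vD vf] := prod_deg _ _ _ f'h xf'.
  apply/asboolP; exists u, v; rewrite -[(b + d + 1)%N]addnA; split=> //.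
  have z'r := yoneda_rep xyz' _ yg phig.
  have xr : rep x (fun u => f u + f' u) by rewrite xE; exact: repD.
  apply/(rep_eq (z'r _ xr) (repD uf vf)).
  by apply: cob_ext (cob0 None P T (2 + m)) => w; rewrite subrr.
suff WD z : D z.
  move=> j jS; apply: (@vanish_of_sum _ _ _ P T (2 + m) S j uniq_degrees jS) => z _.
  have [u [v [uD vD ->]]] := WD z.
  exists (fun k => if k == (b + d)%N%:Z then u else if k == (b + d + 1)%N%:Z then v else 0).
    move=> k; case: eqP => [->//|_]; case: eqP => [->//|_].
    by case: (Ext_deg_submod P T (2 + m) k).
  rewrite big_cons big_seq1 !eqxx; case: eqP => // /eqP.
  by rewrite eqz_nat addn1 eqn_leq ltnn.
apply: contrapT => zD.
pose Y (y : Ext R T 2) := y \in Ext_deg R T 2 (b + d + 1)%N%:Z.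
have Yl : lclosed Y by case: (Ext_deg_submod R T 2 (b + d + 1)%N%:Z).
have Ysurj y : Y y -> exists2 z, z \in Ext_deg P T (2 + m) (b + d + 1)%N%:Z & rho z = y.
  by move=> Yy; have := rsurj _ _ Yy; rewrite degree_shift; apply.
have Y_fd : fdim Y.
  apply: fdim_sub (fdim_image rl (Ext_deg_fdim Q_min P (2 + m) (b + d + 1)%N%:Z Q_lfd T_lfd)).
  by move=> y /Ysurj[w wd <-]; exists w.
have [s [x [xX fx xE]]] := lfree_basis Xl (fdim_sub XD D_fd).
have [t [y [yY fy yE]]] := lfree_basis Yl Y_fd.
have /choice[w wP] j : exists w, w \in Ext_deg P T (2 + m) (b + d + 1)%N%:Z /\ rho w = y j.
  by have [w wd wE] := Ysurj _ (yY j); exists w.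
pose fam (k : 'I_(s + t)) := match fintype.split k with inl i => x i | inr j => w j end.
(* The hypothetical class z is put in front of s products and t lifts; all of the latter lie in D,
   so z is independent of them. *)
pose u (k : 'I_(s + t).+1) := oapp fam z (unlift ord0 k).
have famD k : D (fam k).
  rewrite /fam; case: fintype.split => [i|j]; first exact: XD.
  by exists 0, (w j); rewrite add0r; split=> //; case: (wP j).
have fam_sum (c : 'I_(s + t) -> F) : \sum_k c k *: fam k =
    \sum_i c (lshift t i) *: x i + \sum_j c (rshift s j) *: w j.
  rewrite big_split_ord; congr (_ + _); apply: eq_bigr => i _; rewrite /fam.
    by rewrite -[lshift t i]/(unsplit (inl i)) unsplitK.
  by rewrite -[rshift s i]/(unsplit (inr i)) unsplitK.
have fu : lfree u.
  move=> c; rewrite big_ord_recl {1}/u unlift_none /=.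
  rewrite (eq_bigr (fun k => c (lift ord0 k) *: fam k)) => [c0|k _]; last by rewrite /u liftK.
  have c00 : c ord0 = 0.
    apply/eqP; apply: contrapT => /negP cn; apply: zD.
    have -> : z = - (c ord0)^-1 *: \sum_k c (lift ord0 k) *: fam k.
      move/eqP: c0; rewrite addr_eq0 => /eqP c0.
      by rewrite scaleNr -scalerN -c0 scalerA mulVf ?scale1r.
    have DZ a v : D v -> D (a *: v) by move=> vD; rewrite -[_ *: _]addr0; apply: Dl.2 => //; exact: Dl.1.
    apply: DZ; elim: (index_enum _) => [|k r IHr]; first by rewrite big_nil; exact: Dl.1.
    by rewrite big_cons; apply: Dl.2.
  move: c0; rewrite c00 scale0r add0r fam_sum => c0.
  have cr j : c (lift ord0 (rshift s j)) = 0.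
    apply: (fy (fun j => c (lift ord0 (rshift s j)))).
    have := congr1 rho c0; rewrite (linD rl) !(lin_sum rl) (lin0 rl).
    rewrite big1 ?add0r => [e|i _]; last by rewrite (linZ rl) xX scaler0.
    by rewrite -[RHS]e; apply: eq_bigr => k _; rewrite (linZ rl) (wP k).2.
  have cl i : c (lift ord0 (lshift t i)) = 0.
    apply: (fx (fun i => c (lift ord0 (lshift t i)))); rewrite -[RHS]c0.
    by rewrite [X in _ = _ + X]big1 ?addr0 // => j _; rewrite cr scale0r.
  move=> k; case: (unliftP ord0 k) => [k'|] -> //.
  by rewrite -[k']splitK; case: (fintype.split k') => ?; [exact: cl|exact: cr].
(* The images under [phi] lie in X (+) Y, which this list of length s + t spans; the independent
   family has s + t + 1 members. *)
pose l : seq (W * Ext R T 2)%type :=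
  [seq (x i, 0) | i <- enum 'I_s] ++ [seq (0, y j) | j <- enum 'I_t].
have sl : size l = (s + t)%N.
  by rewrite size_cat (size_map _ (enum 'I_s)) (size_map _ (enum 'I_t)) !size_enum_ord.
suff : ((s + t).+1 <= size l)%N by rewrite sl ltnn.
apply: (@steinitz _ _ l _ (fun k => phi (u k))); last first.
  move=> c c0; apply: fu; apply: phi_inj; rewrite linear0 linear_sum -[RHS]c0.
  by apply: eq_bigr => k _; rewrite linearZ.
move=> k; have [/rker w1X w2Y] := (phi_im (phi (u k))).1 (ex_intro _ (u k) erefl).
have [c1 c1E] := xE _ w1X; have [c2 c2E] := yE _ w2Y.
have -> : phi (u k) = \sum_i c1 i *: (x i, 0 : Ext R T 2) + \sum_j c2 j *: (0 : W, y j).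
  have fst_sum (I : Type) (r : seq I) (f : I -> W * Ext R T 2) :
      (\sum_(i <- r) f i).1 = \sum_(i <- r) (f i).1 by exact: (big_morph fst).
  have snd_sum (I : Type) (r : seq I) (f : I -> W * Ext R T 2) :
      (\sum_(i <- r) f i).2 = \sum_(i <- r) (f i).2 by exact: (big_morph snd).
  rewrite [LHS]surjective_pairing c1E c2E; congr (_, _).
    rewrite /= fst_sum fst_sum [X in _ = _ + X]big1 ?addr0 // => i _.
    by rewrite /= scaler0.
  rewrite /= snd_sum snd_sum [X in _ = X + _]big1 ?add0r // => i _.
  by rewrite /= scaler0.
apply: lspanD; apply: lspan_sum => i _; apply: lspanZ; apply: mem_lspan.
  by rewrite mem_cat map_f ?mem_enum.
by rewrite mem_cat map_f ?orbT ?mem_enum.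
Qed.

End SecondLayer.

(** * Degrees of the Koszul dual *)

Section Delta.
Variable d : nat.

Lemma Delta0 n : Delta d (n * 3) = [:: 2 * n * d]%N.
Proof. by rewrite /Delta modnMl mulnK. Qed.

Lemma Delta1 n : Delta d (1 + n * 3) = [:: 2 * n * d + 1]%N.
Proof. by rewrite /Delta addnC modnMDl divnMDl // addn0. Qed.

Lemma Delta2 n : Delta d (2 + n * 3) = [:: 2 * n * d + d; 2 * n * d + d + 1]%N.
Proof. by rewrite /Delta addnC modnMDl divnMDl // addn0. Qed.

End Delta.

Section Concentration.
Variables (F : fieldType) (A : grAlg F).
Local Notation T := (trivial_mod A).
Variable P : resolution T.

Lemma Ext_deg_inter n i j (z : Ext P T n) :
  z \in Ext_deg P T n i -> z \in Ext_deg P T n j -> i != j -> z = 0.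
Proof.
move=> /Ext_degP[f fh zf] /Ext_degP[g gh zg] ij; apply/(rep_eq0 zf).
pose G l := if l == i then f else if l == j then fun x => - g x else fun=> 0.
have Gh l : ghom (Some l) (G l).
  rewrite /G; case: eqP => [->//|_]; case: eqP => [->|_]; last exact: (hom0 _ _ (Some l)).
  exact: (homN (o := Some j)).
have := @cob_comp _ _ T P T n [:: i; j] G _ Gh _ i (mem_head _ _).
have -> : G i = f by rewrite /G eqxx.
move=> h; apply: (@cob_None _ _ (Some i)); apply: h.
  by rewrite /= inE andbT.
apply: cob_ext ((rep_eq zf zg).1 erefl) => x.
by rewrite big_cons big_seq1 /G !eqxx [j == i]eq_sym (negbTE ij).
Qed.

Lemma vanish_singleP n (k : nat) :
  (forall j, j \notin map Posz [:: k] -> vanish P T n j) <-> E_all P n =i E_deg P n k.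
Proof.
split=> [vP z|Pk j jk].
  rewrite [LHS]inE; symmetry; have [w wd ->] := vanish_sum z (S := [:: k%:Z]) isT vP.
  by rewrite big_seq1; exact: wd.
apply: (vanish_of_sum (S := [:: k%:Z])) => // z _.
have zk : z \in E_deg P n k by rewrite -Pk.
exists (fun l => if l == k%:Z then z else 0); last by rewrite big_seq1 eqxx.
by move=> l; case: eqP => [->//|_]; case: (Ext_deg_submod P T n l).
Qed.

Lemma vanish_pairP n (k l : nat) : (k != l)%N ->
  (forall j, j \notin map Posz [:: k; l] -> vanish P T n j) <->
  is_dsum2 (E_deg P n k) (E_deg P n l).
Proof.
move=> kl; have kl' : k%:Z != l%:Z by [].
have ukl : uniq (map Posz [:: k; l]) by rewrite /= inE andbT.
split=> [vP|[dE _] j jk].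
  split=> [z|z zk zl]; last exact: (Ext_deg_inter zk zl).
  have [w wd ->] := vanish_sum z ukl vP.
  by exists (w k), (w l); rewrite big_cons big_seq1; split=> //; exact: wd.
apply: (vanish_of_sum ukl) => // z _; have [x [y [xk yl ->]]] := dE z.
exists (fun i => if i == k%:Z then x else if i == l%:Z then y else 0).
  move=> i; case: eqP => [->//|_]; case: eqP => [->//|_].
  by case: (Ext_deg_submod P T n i).
by rewrite big_cons big_seq1 !eqxx [l%:Z == _]eq_sym (negbTE kl').
Qed.

Lemma vanish0 j : j != 0 -> vanish P T 0 j.
Proof.
move=> j0 f fh fd; have lf := hom_linear fh.
move=> x; elim/gr_ind: x => [|u v u0 v0|i x xi].
- exact: (lin0 lf).
- by rewrite (linD lf) u0 v0 addr0.
have [ij|ij] := eqVneq i j; last exact: (homj_trivial_ne fh xi ij).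
have /res_exact0[y ->] : res_aug P x = 0.
  by apply: (trivial_deg (gh_deg (res_aug P) xi)); rewrite ij.
exact: fd.
Qed.

Lemma yoneda_prod_sub n m (X X' : {pred Ext P T n}) (Y Y' : {pred Ext P T m}) :
  {subset X <= X'} -> {subset Y <= Y'} ->
  {subset yoneda_prod X Y <= yoneda_prod X' Y'}.
Proof.
move=> XX YY; apply: lspan_sub => z [x [y [/XX xX /YY yY xyz]]].
by apply: mem_lspan; exists x, y.
Qed.

Lemma E3_pow_deg (k n : nat) : {subset E_all P 3 <= E_deg P 3 k} ->
  {subset E3_pow P n.+1 <= E_deg P (n.+1 * 3) (n.+1 * k)}.
Proof.
move=> P3; elim: n => [|n IHn]; first by rewrite -{1}(mul1n k) in P3.
rewrite [(n.+2 * k)%N]mulSn addnC; exact: yoneda_prod_deg P3 IHn.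
Qed.

Hypotheses (A0_ss : semisimple0 A) (A_lfd : forall i, fdim (fun x => x \in ga_deg A i)).

(** The resolution in [bi_Koszul] is existential, while the Koszul dual is computed on [P] and the
    syzygies on [Q]. Vanishing of Ext in a given degree is independent of the resolution and
    mediates between them. *)
Lemma bi_KoszulP (Q : resolution T) d : minimal Q -> bi_Koszul A d <->
  forall n j, j \notin map Posz (Delta d n) -> vanish P T n j.
Proof.
move=> Qmin; split=> [[P' [_ P'gen]] n j jn|vP].
  exact: vanish_indep (vanish_of_generated (P'gen n) jn).
exists Q; split=> // n; apply: generated_of_vanish => //; first exact: minimal_lfd.
by move=> j jn; exact: vanish_indep (vP n j jn).
Qed.

End Concentration.

(** * Bi-Koszulity and the structure of the Koszul dual *)

Theorem theorem0p1 (F : fieldType) (A : grAlg F) (d : nat)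
    (A0_ss : semisimple_artin0 A)
    (A1_fg : finite_dim (ga_deg A 1))
    (A_gen : generated_in_degrees_01 A)
    (d_ge2 : (2 <= d)%N)
    (P : resolution (trivial_mod A))
    (Q : resolution (trivial_mod A)) (Q_min : minimal Q)
    (R : forall n : nat, resolution (subGr (JM (syzygy Q (3 * n))))) :
  bi_Koszul A d <->
    E_all P 1 =i E_deg P 1 1 /\
    is_dsum2 (E_deg P 2 d) (E_deg P 2 (d + 1)) /\
    E_all P 3 =i E_deg P 3 (2 * d) /\
    (forall n : nat, (1 <= n)%N ->
       [/\ E_all P (n * 3) =i E3_pow P n,
           E_all P (1 + n * 3) =i E_mul (E_all P 1) (E_all P (n * 3))
         & E0_iso_dsum (E_mul (E_all P 2) (E_all P (n * 3)))
             (Ext_deg (R n) (trivial_mod A) 2 (2 * n * d + d + 1)%N%:Z)]).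
Proof.
have [A0_fd ss] := A0_ss.
have A_lfd := ga_deg_fdim A_gen A0_fd A1_fg.
have T_lfd := trivial_lfd A_lfd.
have Q_lfd := minimal_lfd A_lfd Q_min.
have dd1 : (d != d + 1)%N by rewrite addn1 neq_ltn ltnSn.
rewrite (bi_KoszulP P ss A_lfd d Q_min).
have Q_gen (n : nat) S : (forall j, j \notin map Posz S -> vanish P (trivial_mod A) n j) ->
    generated_in (Q n) S.
  move=> vP; apply: generated_of_vanish => // j jS; exact: vanish_indep (vP j jS).
(* Conditions (a) and (b) do not mention a resolution of the radical, so any one serves for them;
   the transport only exchanges 3 * n and n * 3. *)
have R' n : resolution (subGr (JM (syzygy Q (n * 3)))) by rewrite mulnC; exact: R.
split=> [vP|[P1 [P2 [P3 Pn]]]].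
  have v1 : forall j, j \notin map Posz [:: 1%N] -> vanish P (trivial_mod A) 1 j 
    by have := vP (1 + 0 * 3)%N; rewrite Delta1 muln0 mul0n.
  have v2 : forall j, j \notin map Posz [:: d; (d + 1)%N] -> vanish P (trivial_mod A) 2 j.
    by have := vP (2 + 0 * 3)%N; rewrite Delta2 muln0 mul0n.
  have v3 : forall j, j \notin map Posz [:: (2 * d)%N] -> vanish P (trivial_mod A) 3 j.
    by have := vP (1 * 3)%N; rewrite Delta0 muln1.
  split; first exact/vanish_singleP; split; first exact/vanish_pairP.
  split; first exact/vanish_singleP; case=> // n _.
  have Qn_gen k : generated_in (Q (k.+1 * 3)%N) [:: (2 * k.+1 * d)%N].
    by apply: Q_gen => j; rewrite -Delta0; exact: vP.
  have low (S : seq nat) (t : nat) i : (forall s, s \in S -> (t <= s)%N) ->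
      (forall j, j \notin map Posz S -> vanish P (trivial_mod A) i j) ->
      forall l, (l < t%:Z)%R -> vanish P (trivial_mod A) i l.
    move=> St vS l lt; apply: vS; apply/negP => /mapP[s /St ts ls].
    by move: lt; rewrite ls ltz_nat ltnNge ts.
  split.
  - elim: n => [|n IHn] z //.
    have [rho [_ rker [_ rbound] _ _]] :=
      restriction_map ss P Q_min Q_lfd (Qn_gen n) (R' n.+1) 2.
    rewrite [LHS]inE; symmetry.
    suff : z \in yoneda_prod (E_all P 3) (E_all P (n.+1 * 3)).
      by apply: yoneda_prod_sub => // y; rewrite IHn.
    (* The class has degree 2(n+2)d = b + 2d with b = 2(n+1)d. Starting the radical at b + 1 instead
       of b makes this just fall below the bound b + 1 + 2d. *)
    apply/rker; apply: (rbound (2 * d)%N%:Z (2 * n.+2 * d)%N%:Z).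
    + by apply: low v3 => s; rewrite inE => /eqP->.
    + by rewrite -!PoszD ltz_nat [(2 * n.+2)%N]mulnS mulnDl addnAC addn1 addnC ltnSn.
    + have zE : E_all P (n.+2 * 3) =i E_deg P (n.+2 * 3) (2 * n.+2 * d).
        by apply/vanish_singleP; have := vP (n.+2 * 3)%N; rewrite Delta0.
      by have := zE z; rewrite [LHS]inE => <-.
  - move=> z; rewrite [LHS]inE; symmetry.
    have [rho [_ rker [_ rbound] _ _]] :=
      restriction_map ss P Q_min Q_lfd (Qn_gen n) (R' n.+1) 0.
    (* The same margin of one: the degree b + 1 lies below b + 1 + 1. *)
    apply/rker; apply: (rbound 1%N%:Z (2 * n.+1 * d + 1)%N%:Z).
    + by apply: low v1 => s; rewrite inE => /eqP->.
    + by rewrite -!PoszD ltz_nat !addn1 ltnSn.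
    + have zE : E_all P (1 + n.+1 * 3) =i E_deg P (1 + n.+1 * 3) (2 * n.+1 * d + 1).
        by apply/vanish_singleP; have := vP (1 + n.+1 * 3)%N; rewrite Delta1.
      by have := zE z; rewrite [LHS]inE => <-.
  (* Here the resolution [R n] itself occurs in the statement, over the index 3 * n. Generalizing
     the index and substituting avoids transporting the Ext group. *)
  have main k (Rk : resolution (subGr (JM (syzygy Q k)))) : k = (n.+1 * 3)%N ->
      E0_iso_dsum (E_mul (E_all P 2) (E_all P (n.+1 * 3)))
        (Ext_deg Rk (trivial_mod A) 2 (2 * n.+1 * d + d + 1)%N%:Z).
    move=> ek; subst k.
    apply: (dsum_iso ss Q_min Q_lfd T_lfd (Qn_gen n)).
    (* This is 2d != d + 1, where d >= 2 is used. *)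
    + apply: v3; rewrite inE eqz_nat neq_ltn.
      by rewrite mul2n -addnn ltn_add2l d_ge2.
    + by apply: low v2 => s; rewrite !inE => /orP[]/eqP->; rewrite ?leq_addr.
    + by move=> j jS; have := vP (2 + n.+1 * 3)%N j; rewrite Delta2; apply.
  by apply: main; rewrite mulnC.
have P1' := (vanish_singleP P 1 1).2 P1; have P2' := (vanish_pairP P 2 dd1).2 P2.
have P3' := (vanish_singleP P 3 (2 * d)).2 P3.
(* For k = 0 the hypotheses say nothing, but E^0(A) always sits in degree 0, which is the degree in
   [Delta d 0]. *)
have V0 k j : j \notin map Posz (Delta d (k * 3)) -> vanish P (trivial_mod A) (k * 3) j.
  rewrite Delta0; case: k => [|k].
    by rewrite muln0 mul0n inE => j0; exact: vanish0.
  move: j; apply/vanish_singleP => z; have [Pk _ _] := Pn k.+1 isT.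
  rewrite [LHS]inE; symmetry; have zE : z \in E3_pow P k.+1 by rewrite -Pk.
  have := E3_pow_deg (k := 2 * d) (n := k) _ zE.
  rewrite mulnA [(k.+1 * 2)%N]mulnC; apply=> y; by rewrite P3.
have V1 k j : j \notin map Posz (Delta d (1 + k * 3)) -> vanish P (trivial_mod A) (1 + k * 3) j.
  rewrite Delta1; case: k => [|k]; first by rewrite muln0 mul0n; exact: P1'.
  move: j; apply/vanish_singleP => z; have [_ Pk _] := Pn k.+1 isT.
  rewrite [LHS]inE; symmetry.
  have : z \in E_mul (E_all P 1) (E_all P (k.+1 * 3)) by rewrite -Pk.
  have k3 : E_all P (k.+1 * 3) =i E_deg P (k.+1 * 3) (2 * k.+1 * d).
    by apply/vanish_singleP; have := V0 k.+1; rewrite Delta0.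
  rewrite /E_deg PoszD; apply: (@yoneda_prod_deg _ _ _ _ _ P P 1 (k.+1 * 3)) => y.
    by rewrite P1.
  by rewrite k3.
have V2 k j : j \notin map Posz (Delta d (2 + k * 3)) -> vanish P (trivial_mod A) (2 + k * 3) j.
  rewrite Delta2; case: k => [|k]; first by rewrite muln0 mul0n; exact: P2'.
  have [_ _ Pk] := Pn k.+1 isT.
  have Qk_gen : generated_in (Q (k.+1 * 3)%N) [:: (2 * k.+1 * d)%N].
    by apply: Q_gen => i; rewrite -Delta0; exact: V0.
  have main l (Rl : resolution (subGr (JM (syzygy Q l)))) : l = (k.+1 * 3)%N ->
      E0_iso_dsum (E_mul (E_all P 2) (E_all P (k.+1 * 3)))
        (Ext_deg Rl (trivial_mod A) 2 (2 * k.+1 * d + d + 1)%N%:Z) ->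
      j \notin map Posz [:: (2 * k.+1 * d + d)%N; (2 * k.+1 * d + d + 1)%N] ->
      vanish P (trivial_mod A) (2 + k.+1 * 3) j.
    move=> el; subst l => iso.
    apply: (concentrated_of_iso ss Q_min Q_lfd T_lfd Qk_gen _ _ _ iso).
    + apply: P3'; rewrite inE eqz_nat neq_ltn.
      by rewrite mul2n -addnn ltn_add2l d_ge2.
    + by move=> z _; apply/asboolP; have [x [y [xd yd ->]]] := P2.1 z; exists x, y.
    + by move=> i ib; have := V0 k.+1 i; rewrite Delta0 inE; apply.
  by apply: main Pk; rewrite mulnC.
move=> n j; rewrite (divn_eq n 3) addnC.
have : (n %% 3 < 3)%N by rewrite ltn_mod.
by case: (n %% 3)%N => [|[|[|//]]] _; [exact: V0|exact: V1|exact: V2].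
Qed.
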